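(* Assume that the semigroup $S$ is subMarkovian, that $(0,0)\in f$ (i.e. $0\in f(0)$), that $u_0\in L^0(\mathcal F_0;L^1)$, and that \[ S\diamond B\in L^0(\Omega;C([0,T];L^1)). \] For $\lambda>0$ let $u_\lambda\in L^0(\Omega;C([0,T];L^1))$ be the unique solution to $u_\lambda+S\ast f_\lambda(u_\lambda)=Su_0+S\diamond B$, where $f_\lambda$ is the Yosida approximation of $f$. If, almost surely, the family $(f_\lambda(u_\lambda))_{\lambda>0}$ is equiintegrable on $[0,T]\times G$ and the family $(f_\lambda(u_\lambda)u_\lambda)_{\lambda>0}$ is bounded in $L^1([0,T]\times G)$, then there exists a unique ($L^1$-valued) mild solution to \[ u(t)+\int_0^t S(t-s)f(u(s))\,ds=S(t)u_0+\int_0^t S(t-s)B(s)\,dW(s),\qquad t\in[0,T]. \]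
   Context: Setting. $G$ is a bounded domain of $\mathbb R^n$; $L^s:=L^s(G)$ (real-valued functions). $\mathbb R_+=[0,\infty)$. $T>0$ is fixed; $(\Omega,\mathcal F,\mathbb P)$ is a probability space with a complete right-continuous filtration $(\mathcal F_t)_{t\in[0,T]}$, and $W$ is a cylindrical Wiener process on a real separable Hilbert space $H$. $A$ is a linear (unbounded) $m$-accretive operator on $L^1$ which restricts to an operator of the same class on every $L^s$, $s\in\,]1,\infty[$; $-A$ generates, on each $L^s$, $s\in[1,\infty[$, a strongly continuous semigroup of contractions, and these consistent semigroups are all denoted by $S$. $S$ subMarkovian means: $0\le\phi\le1$ a.e. implies $0\le S(t)\phi\le1$ a.e. for all $t$. The function $f:\mathbb R\to\mathbb R$ is increasing (i.e. nondecreasing, possibly discontinuous) and there are $d\in\mathbb R_+$ and a constant $C$ with $|f(x)|\le C(1+|x|^d)$ for all $x\in\mathbb R$. $f$ is identified with its maximal monotone extension $x\mapsto[f(x-),f(x+)]$. Its Yosida approximation is $f_\lambda:=\frac1\lambda\bigl(I-(I+\lambda f)^{-1}\bigr)$, a monotone Lipschitz function on $\mathbb R$, acting on functions by composition. $B$ is a strongly measurable adapted $\mathcal L(H,E)$-valued process, where $E$ is a Banach space such that the stochastic convolution $(S\diamond B)(t)=\int_0^tS(t-s)B(s)\,dW(s)$ is a well-defined (adapted) $L^1$-valued process. $(S\ast\phi)(t)=\int_0^tS(t-s)\phi(s)\,ds$. $L^0(\Omega;X)$ is the space of $X$-valued random variables, $L^0(\mathcal F_0;X)$ that of the $\mathcal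 F_0$-measurable ones. A family is equiintegrable (uniformly integrable) if it is bounded in $L^1$ and the integrals of the moduli over sets of measure less than $\delta$ tend to $0$ as $\delta\to0$ uniformly over the family. Definition. An $L^1$-valued mild solution is an adapted process $u\in L^0(\Omega;C([0,T];L^1))$ such that there exists an adapted process $g\in L^0(\Omega;L^1(0,T;L^1))$ with $g\in f(u)$ a.e. in $\Omega\times[0,T]\times G$ and $u+S\ast g=Su_0+S\diamond B$ in the sense of indistinguishable $L^1$-valued processes. Uniqueness is understood for $u$, up to indistinguishability. *)

(* Defs.v *)
From HB Require Import structures.
From mathcomp Require Import all_boot all_order all_algebra.
From mathcomp Require Import all_classical all_reals all_analysis.
From mathcomp Require Import measurable_realfun ess_sup_inf.

Set Implicit Arguments.
Unset Strict Implicit.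
Unset Printing Implicit Defensive.

Import Order.TTheory GRing.Theory Num.Theory.
Import numFieldNormedType.Exports.

Local Open Scope classical_set_scope.
Local Open Scope ring_scope.

Section image_measure.
Context d d' (T1 : measurableType d) (T2 : measurableType d') (R : realType).
Variables (m : {measure set T1 -> \bar R}) (f : {mfun T1 >-> T2}).

Definition image_measure : set T2 -> \bar R := pushforward m f.

Let image_measure0 : image_measure set0 = 0%E.
Proof. by rewrite /image_measure /pushforward preimage_set0 measure0. Qed.

Let image_measure_ge0 A : (0 <= image_measure A)%E.
Proof. exact: measure_ge0. Qed.

Let image_measure_sigma_additive : semi_sigma_additive image_measure.
Proof.
exact: (@measure_semi_sigma_additive _ _ _
  (measure_function_pushforward__canonical__measure_function_Measure m
    (@measurable_funPT _ _ _ _ f))).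
Qed.

HB.instance Definition _ := isMeasure.Build _ _ _ image_measure
  image_measure0 image_measure_ge0 image_measure_sigma_additive.

End image_measure.

Definition borel_rV (R : realType) (n : nat) :=
  g_sigma_algebraType (@open 'rV[R]_n).

Section lebesgue_rV.
Context (R : realType).

Definition tuple_cons n (x : measurableTypeR R * n.-tuple (measurableTypeR R)) :=
  [the n.+1.-tuple (measurableTypeR R) of x.1 :: x.2].

Lemma measurable_tuple_cons n : measurable_fun setT (@tuple_cons n).
Proof. exact: measurable_cons. Qed.

HB.instance Definition _ n :=
  isMeasurableFun.Build _ _ _ _ (@tuple_cons n) (@measurable_tuple_cons n).

(* [\x^] is the library's product measure with a sigma-finite left factor *)
Fixpoint lebesgue_tuple (n : nat) :
    {measure set (n.-tuple (measurableTypeR R)) -> \bar R} :=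
  match n with
  | 0 => [the {measure set _ -> \bar R} of
           \d_([tuple] : 0.-tuple (measurableTypeR R))]
  | m.+1 => [the {measure set _ -> \bar R} of
           image_measure
             [the {measure set _ -> \bar R} of
                (@lebesgue_measure R \x^ lebesgue_tuple m)%E]
             (@tuple_cons m)]
  end.

Definition tuple_rV n (x : n.-tuple (measurableTypeR R)) : borel_rV R n :=
  \row_(i < n) (tnth x i : R).

Lemma measurable_tuple_rV n : measurable_fun setT (@tuple_rV n).
Proof.
apply: (@measurability _ _ _ _ setT (@tuple_rV n) (@open 'rV[R]_n)) => //.
move=> _ [U oU <-]; rewrite setTI.
pose D := [set qk : 'rV[rat]_n * nat |
  ball (map_mx (@ratr R) qk.1 : 'rV[R]_n) qk.2.+1%:R^-1 `<=` U].
have UE : U = \bigcup_(qk in D)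
    ball (map_mx (@ratr R) qk.1 : 'rV[R]_n) qk.2.+1%:R^-1.
  apply/seteqP; split => [x Ux|x [qk Dqk]]; last exact: Dqk.
  have /nbhs_ballP[e /= e0 xeU] : nbhs (x : 'rV[R]_n) U.
    exact: open_nbhs_nbhs.
  have e20 : 0 < e / 2 by rewrite divr_gt0.
  have [k ke] : exists k : nat, k.+1%:R^-1 < e / 2.
    have [k _ /(_ k)/(_ (leqnn _)) ke] := near_infty_natSinv_lt (PosNum e20).
    by exists k.
  have kgt0 : (0 : R) < k.+1%:R^-1 by [].
  have qP i : exists q : rat, ball (x ord0 i) k.+1%:R^-1 (ratr q).
    have /rat_in_itvoo[q] : x ord0 i - k.+1%:R^-1 < x ord0 i + k.+1%:R^-1.
      by rewrite ltrBlDr -addrA ltrDl addr_gt0.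
    by rewrite in_itv/= => qx; exists q; rewrite /ball/= ltr_distlC.
  pose q : 'rV[rat]_n := \row_i projT1 (cid (qP i)).
  have xq : ball x k.+1%:R^-1 (map_mx (@ratr R) q : 'rV[R]_n).
    split=> // i j; rewrite !mxE (ord1 i); exact: projT2 (cid (qP j)).
  exists (q, k); last exact: ball_sym.
  move=> y /= qy; apply: xeU; apply: (@le_ball _ _ x (k.+1%:R^-1 + k.+1%:R^-1)).
    by rewrite (splitr e) ltW// ltrD.
  exact: ball_triangle xq qy.
rewrite UE preimage_bigcup bigcup_mkcond.
apply: countable_bigcupT_measurable => [|[q k]].
  exact: countableP.
case: ifPn => _ //=.
rewrite [X in measurable X](_ : _ = \bigcap_(i in [set: 'I_n])
  ((fun x : n.-tuple (measurableTypeR R) => tnth x i) @^-1`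
     (ball (ratr (q ord0 i) : R) k.+1%:R^-1))); last first.
  apply/seteqP; split => [x [_ xq] i _ /=|x xq /=].
    by have := xq ord0 i; rewrite !mxE.
  by split=> // i j; have := xq j I; rewrite !mxE (ord1 i).
apply: fin_bigcap_measurable => // i _.
rewrite -[X in measurable X]setTI; apply: measurable_tnth => //.
exact: measurable_ball.
Qed.

HB.instance Definition _ n :=
  isMeasurableFun.Build _ _ _ _ (@tuple_rV n) (@measurable_tuple_rV n).

Definition lebesgue_rV n : {measure set (borel_rV R n) -> \bar R} :=
  [the {measure set _ -> \bar R} of
     image_measure (lebesgue_tuple n) (@tuple_rV n)].

Lemma open_measurable_rV n (G : set 'rV[R]_n) :
  open G -> measurable (G : set (borel_rV R n)).
Proof. exact: sub_sigma_algebra. Qed.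

(* Lebesgue measure on an open set G; as a measure on the whole of R^n it does
   not charge the complement of G, so that its L^s spaces are those of G. *)
Definition lebesgue_on n (G : set 'rV[R]_n) (oG : open G) :
    {measure set (borel_rV R n) -> \bar R} :=
  [the {measure set _ -> \bar R} of
     mrestr (lebesgue_rV n) (open_measurable_rV oG)].

End lebesgue_rV.

Section Lp.
Context d (X : measurableType d) (R : realType).
Variables (mu : {measure set X -> \bar R}) (p : \bar R) (p1 : (1 <= p)%E).
Local Notation F := (LfunType mu p1).

Definition Lp_eq (f g : F) : bool := `[< {ae mu, forall x, f x = g x} >].

Let Lp_eq_refl : reflexive Lp_eq.
Proof. by move=> f; apply/asboolP; exact: aeW. Qed.

Let Lp_eq_sym : symmetric Lp_eq.
Proof.
by move=> f g; apply/idP/idP => /asboolP fg; apply/asboolP; apply: filterS fg.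
Qed.

Let Lp_eq_trans : transitive Lp_eq.
Proof.
move=> g f h /asboolP fg /asboolP gh; apply/asboolP.
by apply: filterS2 fg gh => x -> ->.
Qed.

Canonical Lp_equiv := EquivRel Lp_eq Lp_eq_refl Lp_eq_sym Lp_eq_trans.

Local Open Scope quotient_scope.

Definition Lp : Type := {eq_quot Lp_equiv}.
HB.instance Definition _ := Choice.on Lp.
HB.instance Definition _ := EqQuotient.on Lp.

Definition Lp_fun (u : Lp) : X -> R := (repr u : F).
Coercion Lp_fun : Lp >-> Funclass.

Definition Lp_class (f : F) : Lp := \pi_Lp f.

Lemma Lp_classE (f : F) : {ae mu, forall x, Lp_class f x = f x}.
Proof.
have : repr (Lp_class f) = f %[mod Lp] by rewrite reprK.
by move=> /eqmodP/asboolP.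
Qed.

Lemma eq_Lp_class (f g : F) :
  {ae mu, forall x, f x = g x} -> Lp_class f = Lp_class g.
Proof. by move=> fg; apply/eqmodP/asboolP. Qed.

Lemma Lp_funK (u : Lp) : Lp_class (repr u) = u.
Proof. exact: reprK. Qed.

Definition Lp_add (u v : Lp) : Lp := Lp_class (repr u + repr v).
Definition Lp_opp (u : Lp) : Lp := Lp_class (- repr u).
Definition Lp_zero : Lp := Lp_class 0.
Definition Lp_scale (a : R) (u : Lp) : Lp := Lp_class (a *: repr u).

Lemma LpP (u v : Lp) : {ae mu, forall x, u x = v x} -> u = v.
Proof. by move=> uv; rewrite -(Lp_funK u) -(Lp_funK v); exact: eq_Lp_class. Qed.

Lemma Lp_class_add f g : Lp_add (Lp_class f) (Lp_class g) = Lp_class (f + g).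
Proof.
apply: eq_Lp_class; apply: filterS2 (Lp_classE f) (Lp_classE g) => x fx gx.
by rewrite -[LHS]/(Lp_class f x + Lp_class g x) fx gx.
Qed.

Lemma Lp_class_opp f : Lp_opp (Lp_class f) = Lp_class (- f).
Proof.
apply: eq_Lp_class; apply: filterS (Lp_classE f) => x fx.
by rewrite -[LHS]/(- Lp_class f x) fx.
Qed.

Lemma Lp_class_scale a f : Lp_scale a (Lp_class f) = Lp_class (a *: f).
Proof.
apply: eq_Lp_class; apply: filterS (Lp_classE f) => x fx.
by rewrite -[LHS]/(a * Lp_class f x) fx.
Qed.

Let addA : associative Lp_add.
Proof.
move=> u v w; rewrite -(Lp_funK u) -(Lp_funK v) -(Lp_funK w).
by rewrite !Lp_class_add addrA.
Qed.

Let addC : commutative Lp_add.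
Proof. by move=> u v; rewrite /Lp_add addrC. Qed.

Let add0 : left_id Lp_zero Lp_add.
Proof. by move=> u; rewrite -(Lp_funK u) Lp_class_add add0r. Qed.

Let addN : left_inverse Lp_zero Lp_opp Lp_add.
Proof.
by move=> u; rewrite -(Lp_funK u) Lp_class_opp Lp_class_add addNr.
Qed.

HB.instance Definition _ := GRing.isZmodule.Build Lp addA addC add0 addN.

Lemma Lp_classD f g : Lp_class f + Lp_class g = Lp_class (f + g).
Proof. exact: Lp_class_add. Qed.

Let scaleA (a b : R) (u : Lp) :
  Lp_scale a (Lp_scale b u) = Lp_scale (a * b) u.
Proof. by rewrite -(Lp_funK u) !Lp_class_scale scalerA. Qed.

Let scale1 : left_id 1 Lp_scale.
Proof. by move=> u; rewrite -(Lp_funK u) Lp_class_scale scale1r. Qed.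

Let scaleDr : right_distributive Lp_scale +%R.
Proof.
move=> a u v; rewrite -(Lp_funK u) -(Lp_funK v) Lp_classD !Lp_class_scale.
by rewrite Lp_classD scalerDr.
Qed.

Let scaleDl u : {morph Lp_scale^~ u : a b / a + b}.
Proof.
move=> a b; rewrite -(Lp_funK u) !Lp_class_scale.
by rewrite Lp_classD scalerDl.
Qed.

HB.instance Definition _ := GRing.Zmodule_isLmodule.Build R Lp
  scaleA scale1 scaleDr scaleDl.

Lemma Lp_classZ a f : a *: Lp_class f = Lp_class (a *: f).
Proof. exact: Lp_class_scale. Qed.

Definition Lp_norm (u : Lp) : R := fine ('N[mu]_p[EFin \o u])%E.

Let measurable_normpowR (r : R) (h : X -> R) : measurable_fun [set: X] h ->
  measurable_fun [set: X] (fun x => (`|(EFin \o h) x| `^ r)%E).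
Proof.
move=> mh; apply: (@measurableT_comp _ _ _ _ _ _ (fun y : \bar R => (y `^ r)%E)).
  exact: measurable_poweR.
by apply: measurableT_comp => //; exact/measurable_EFinP.
Qed.

Let Lnorm_ae (q : \bar R) (f g : X -> R) :
    measurable_fun [set: X] f -> measurable_fun [set: X] g ->
    {ae mu, forall x, f x = g x} ->
  ('N[mu]_q[EFin \o f] = 'N[mu]_q[EFin \o g])%E.
Proof.
rewrite unlock /Lnorm => mf mg fg; case: q => [r||].
- congr (_ `^ _)%E; apply: ae_eq_integral => //;
    [exact: measurable_normpowR..|by apply: filterS fg => x /= ->].
- by case: ifPn => // _; apply: eq_ess_sup; apply: filterS fg => x /= ->.
- by case: ifPn => // _; apply: eq_ess_inf; apply: filterS fg => x /= ->.
Qed.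

Lemma Lp_norm_class (f : F) : Lp_norm (Lp_class f) = fine ('N[mu]_p[EFin \o f])%E.
Proof.
by congr fine; apply: Lnorm_ae => //; exact: Lp_classE.
Qed.

Let normD u v : Lp_norm (u + v) <= Lp_norm u + Lp_norm v.
Proof.
rewrite -(Lp_funK u) -(Lp_funK v) Lp_classD !Lp_norm_class.
exact: ler_LnormD.
Qed.

Let normZ a u : Lp_norm (a *: u) = `|a| * Lp_norm u.
Proof.
rewrite -(Lp_funK u) Lp_classZ !Lp_norm_class.
apply: EFin_inj; rewrite finite_norm_fine EFinM finite_norm_fine.
exact: LnormZ.
Qed.

Let norm_eq0 u : Lp_norm u = 0 -> u = 0.
Proof.
move=> u0; rewrite -(Lp_funK u); apply: eq_Lp_class.
by apply: filterS (@fine_Lnormr_eq0 _ _ _ _ _ p1 (repr u) u0) => x; exact.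
Qed.

HB.instance Definition _ :=
  Lmodule_isNormed.Build R Lp normD normZ norm_eq0.

End Lp.

(* The class of h if h is p-integrable, the junk value 0 otherwise. *)
Definition to_Lp d (X : measurableType d) (R : realType)
    (mu : {measure set X -> \bar R}) (p : \bar R) (p1 : (1 <= p)%E)
    (h : X -> R) : Lp mu p1 :=
  match pselect (h \in Lfun mu p) with
  | left h_p => Lp_class (Lfun_Sub p1 h_p)
  | right _ => 0
  end.

Section bochner.
Context (R : realType) (V : normedModType R).

Definition simple_fun (X : Type) (e : seq (set X * V)) (x : X) : V :=
  \sum_(a <- e) (\1_(a.1) x : R) *: a.2.

Definition strongly_measurable (X : Type) (F : set (set X)) (D : set X)
    (f : X -> V) : Prop :=
  exists e : nat -> seq (set X * V),
    (forall n a, a \in e n -> F a.1) /\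
    (forall x, D x -> simple_fun (e n) x @[n --> \oo] --> f x).

Definition bochner_integral d (X : measurableType d)
    (mu : {measure set X -> \bar R}) (D : set X) (f : X -> V) (v : V) : Prop :=
  strongly_measurable (@measurable d X) D f /\
  exists e : nat -> seq (set X * V),
    [/\ forall n a, a \in e n ->
          measurable a.1 /\ (mu (a.1 `&` D) < +oo)%E,
        (\int[mu]_(x in D) `|f x - simple_fun (e n) x|%:E)%E
          @[n --> \oo] --> 0%E
      & (\sum_(a <- e n) fine (mu (a.1 `&` D)) *: a.2) @[n --> \oo] --> v].

End bochner.

Section semigroups.
Context (R : realType) (V : normedModType R).

(* An unbounded operator is identified with its graph. *)
Definition linear_operator (A : set (V * V)) : Prop :=
  [/\ A (0, 0),
      forall (a : R) x y x' y', A (x, y) -> A (x', y') ->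
        A (a *: x + x', a *: y + y')
    & forall x y y', A (x, y) -> A (x, y') -> y = y'].

Definition m_accretive (A : set (V * V)) : Prop :=
  [/\ linear_operator A,
      forall x y, A (x, y) ->
        forall lam : R, 0 < lam -> `|x| <= `|x + lam *: y|
    & forall lam : R, 0 < lam ->
        forall z, exists x y, A (x, y) /\ x + lam *: y = z].

Definition contraction_semigroup (S : R -> V -> V) : Prop :=
  [/\ forall t, 0 <= t -> linear (S t),
      forall x, S 0 x = x,
      forall s t x, 0 <= s -> 0 <= t -> S (s + t) x = S s (S t x),
      forall t x, 0 <= t -> `|S t x| <= `|x|
    & forall x, S t x @[t --> 0^'+] --> x].

Definition generated_by_opp (A : set (V * V)) (S : R -> V -> V) : Prop :=
  forall x y, A (x, y) <-> t^-1 *: (S t x - x) @[t --> 0^'+] --> - y.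

End semigroups.

Lemma le1_EFin (R : realType) (s : R) : 1 <= s -> (1 <= s%:E)%E.
Proof. by rewrite lee_fin. Qed.

Notation L1 mu := (Lp mu (lexx 1%E)).
Notation Ls mu s1 := (Lp mu (le1_EFin s1)).

Section spaces_Ls.
Context d (X : measurableType d) (R : realType).
Variable mu : {measure set X -> \bar R}.

Local Notation L1 := (L1 mu).
Local Notation Ls s1 := (Ls mu s1).

Definition operator_restriction (A : set (L1 * L1)) (s : R) (s1 : 1 <= s) :
    set (Ls s1 * Ls s1) :=
  [set xy : Ls s1 * Ls s1 | exists x' y' : L1, [/\ A (x', y'),
     {ae mu, forall z, xy.1 z = x' z} & {ae mu, forall z, xy.2 z = y' z}]].

Arguments operator_restriction A {s} s1 : rename.

Definition consistent (S : R -> L1 -> L1) (s : R) (s1 : 1 <= s)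
    (Ss : R -> Ls s1 -> Ls s1) : Prop :=
  forall t (phi : Ls s1) (phi' : L1), 0 <= t ->
    {ae mu, forall z, phi z = phi' z} ->
    {ae mu, forall z, Ss t phi z = S t phi' z}.

Definition submarkovian (S : R -> L1 -> L1) : Prop :=
  forall t (phi : L1), 0 <= t -> {ae mu, forall z, 0 <= phi z <= 1} ->
    {ae mu, forall z, 0 <= S t phi z <= 1}.

Definition consistent_accretive_operator (A : set (L1 * L1))
    (S : R -> L1 -> L1) : Prop :=
  [/\ m_accretive A, contraction_semigroup S, generated_by_opp A S
    & forall (s : R) (s1 : 1 < s),
        m_accretive (operator_restriction A (ltW s1)) /\
        exists Ss : R -> Ls (ltW s1) -> Ls (ltW s1),
          [/\ contraction_semigroup Ss,
              generated_by_opp (operator_restriction A (ltW s1)) Ss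
            & consistent S Ss]].

(* The action on E of the semigroup S, making sense of S(t)B for operators B
   with values in E: bounded operators S(t) : E -> L^1, t > 0, such that
   S(r)S(t) = S(r + t). If E is continuously embedded in L^1 by j, this is
   S(t) o j. *)
Definition semigroup_action (S : R -> L1 -> L1) (E : normedModType R)
    (SE : R -> E -> L1) : Prop :=
  (forall t, 0 < t -> linear (SE t) /\ continuous (SE t)) /\
  (forall r t x, 0 <= r -> 0 < t -> S r (SE t x) = SE (r + t) x).

End spaces_Ls.

Section monotone_graph.
Context (R : realType).

Definition monotone_extension (f : R -> R) (x y : R) : Prop :=
  lim (f z @[z --> x^'-]) <= y <= lim (f z @[z --> x^'+]).

Definition resolvent (f : R -> R) (lam x : R) : R :=
  xget 0 [set y | exists2 z, monotone_extension f y z & x = y + lam * z].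

Definition yosida (f : R -> R) (lam x : R) : R :=
  lam^-1 * (x - resolvent f lam x).

End monotone_graph.

(* The composition phi o u is integrable, so that the junk value of [to_Lp] is
   not reached, if mu is finite and phi is Lipschitz. *)
Definition nemytskii d (X : measurableType d) (R : realType)
    (mu : {measure set X -> \bar R}) (phi : R -> R) (u : L1 mu) : L1 mu :=
  to_Lp mu (lexx 1%E) (phi \o u).

Section equiintegrable.
Context d (X : measurableType d) (R : realType).
Variables (nu : {measure set X -> \bar R}) (D : set X).

Definition bounded_in_L1 (I : Type) (J : set I) (h : I -> X -> R) : Prop :=
  exists M : R, forall i, J i -> (\int[nu]_(x in D) `|h i x|%:E <= M%:E)%E.

Definition equiintegrable (I : Type) (J : set I) (h : I -> X -> R) : Prop :=
  bounded_in_L1 J h /\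
  forall eps : R, 0 < eps -> exists2 delta : R, 0 < delta &
    forall i A, J i -> measurable A -> A `<=` D -> (nu A < delta%:E)%E ->
      (\int[nu]_(x in A) `|h i x|%:E <= eps%:E)%E.

End equiintegrable.

Section filtration.
Context d (Omega : measurableType d) (R : realType).
Variables (P : probability Omega R) (T : R).

Definition complete_right_continuous_filtration (F : R -> set (set Omega)) :=
  [/\ forall t, 0 <= t <= T -> sigma_algebra [set: Omega] (F t),
      forall t, 0 <= t <= T -> F t `<=` measurable,
      forall s t, 0 <= s -> s <= t -> t <= T -> F s `<=` F t,
      forall t, 0 <= t < T -> F t = \bigcap_(s in `]t, T]) F s
    & P.-negligible `<=` F 0].

End filtration.

Section processes.
Context d (Omega : measurableType d) (R : realType) (V : normedModType R).
Variables (P : probability Omega R) (T : R) (F : R -> set (set Omega)).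
Implicit Types u : R -> Omega -> V.

Definition adapted u : Prop :=
  forall t, 0 <= t <= T -> strongly_measurable (F t) setT (u t).

(* A C([0,T]; V)-valued random variable: for V separable, the Borel sigma-algebra
   of C([0,T]; V) is generated by the evaluations at fixed times. *)
Definition continuous_process u : Prop :=
  (forall t, 0 <= t <= T ->
     strongly_measurable (@measurable _ Omega) setT (u t)) /\
  {ae P, forall w, {within `[0, T], continuous (fun t => u t w)}}.

Definition measurable_process u : Prop :=
  strongly_measurable (@measurable _ (measurableTypeR R * Omega)%type)
    (`[0, T] `*` setT) (fun tw => u tw.1 tw.2).

(* An element of L^0(Omega; L^1(0,T; V)), by means of a version which is
   measurable in (t, w). *)
Definition integrable_process u : Prop :=
  measurable_process u /\
  {ae P, forall w,
    (\int[@lebesgue_measure R]_(t in `[0%R, T]) `|u t w|%:E < +oo)%E}.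

Definition indistinguishable u v : Prop :=
  {ae P, forall w, forall t, 0 <= t <= T -> u t w = v t w}.

End processes.

Definition hilbert_space (R : realType) (H : completeNormedModType R)
    (ip : H -> H -> R) : Prop :=
  [/\ forall x y, ip x y = ip y x,
      forall a x y z, ip (a *: x + y) z = a * ip x z + ip y z
    & forall x, ip x x = `|x| ^+ 2].

Definition separable_space (V : topologicalType) : Prop :=
  exists2 D : set V, countable D & closure D = setT.

Section stochastic_integral.
Context d (Omega : measurableType d) (R : realType).
Context (H : completeNormedModType R) (ip : H -> H -> R).
Variables (P : probability Omega R) (T : R) (F : R -> set (set Omega)).

(* The increments of W(.)h over [s,t] are independent of F_s and centred
   Gaussian of variance (t - s)|h|^2 (the library's [normal_prob] is
   parametrised by the standard deviation, which has to be nonzero); the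
   covariance structure in h follows by linearity. *)
Definition cylindrical_wiener (W : R -> H -> Omega -> R) : Prop :=
  [/\ forall t a h k, 0 <= t <= T ->
        {ae P, forall w, W t (a *: h + k) w = a * W t h w + W t k w},
      forall h, {ae P, forall w, W 0 h w = 0},
      forall t h A, 0 <= t <= T -> measurable A -> F t (W t h @^-1` A),
      forall h, {ae P, forall w, {within `[0, T], continuous (fun t => W t h w)}}
    & forall s t h A B, 0 <= s -> s < t -> t <= T -> h != 0 ->
        measurable A -> F s B ->
        P (B `&` (fun w => W t h w - W s h w) @^-1` A) =
        (P B * normal_prob 0 (Num.sqrt (t - s) * `|h|) A)%E].

(* A step (a, b, A, h) stands for the process 1_]a,b](s) 1_A(w) h. *)
Definition step : Type := (R * R * set Omega * H)%type.

Definition elementary_value (e : seq step) (s : R) (w : Omega) : H :=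
  \sum_(q <- e) let: (a, b, A, h) := q in
    ((\1_(`]a, b]) s : R) * (\1_A w : R)) *: h.

Definition elementary_integral (W : R -> H -> Omega -> R) (e : seq step)
    (w : Omega) : R :=
  \sum_(q <- e) let: (a, b, A, h) := q in
    (\1_A w : R) * (W b h w - W a h w).

Definition elementary_on (t : R) (e : seq step) : Prop :=
  forall q, q \in e -> let: (a, b, A, h) := q in
    [/\ 0 <= a, a < b, b <= t & F a A].

(* [I] is the Ito integral of the H-valued process [psi] over [0,t]: the limit
   in probability of the integrals of adapted elementary processes converging
   to [psi] in L^2(0,t; H) in probability. *)
Definition ito_integral (W : R -> H -> Omega -> R) (t : R)
    (psi : R -> Omega -> H) (I : Omega -> R) : Prop :=
  strongly_measurable (@measurable _ (measurableTypeR R * Omega)%type)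
    (`]0, t[ `*` setT) (fun sw => psi sw.1 sw.2) /\
  exists e : nat -> seq step,
    [/\ forall n, elementary_on t (e n),
        forall eps : R, 0 < eps ->
          P [set w | (eps%:E < \int[@lebesgue_measure R]_(s in `]0%R, t[)
               (`|psi s w - elementary_value (e n) s w| ^+ 2)%:E)%E]
            @[n --> \oo] --> 0%E
      & forall eps : R, 0 < eps ->
          P [set w | eps < `|I w - elementary_integral W (e n) w|]
            @[n --> \oo] --> 0%E].

(* [xi] is the stochastic integral over [0,t] of the L(H,V)-valued process
   [Phi], defined by duality: for every continuous linear functional l on V,
   <xi, l> is the Ito integral of the H-valued process Phi^* l. *)
Definition stochastic_integral (V : normedModType R)
    (W : R -> H -> Omega -> R) (t : R) (Phi : R -> Omega -> H -> V)
    (xi : Omega -> V) : Prop :=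
  forall l : {linear V -> R^o}, continuous l ->
    exists2 psi : R -> Omega -> H,
      (forall s w h, 0 < s < t -> ip (psi s w) h = l (Phi s w h)) &
      ito_integral W t psi (l \o xi).

End stochastic_integral.

(* Measurability of L(H,E)-valued processes is in the strong operator sense. *)
Definition adapted_operator_process d (Omega : measurableType d) (R : realType)
    (T : R) (F : R -> set (set Omega)) (H E : normedModType R)
    (B : R -> Omega -> H -> E) : Prop :=
  [/\ forall t w, 0 <= t <= T -> linear (B t w) /\ continuous (B t w),
      forall h, measurable_process T (fun t w => B t w h)
    & forall h, adapted T F (fun t w => B t w h)].

Section mild.
Context d (Omega : measurableType d) (R : realType).
Variables (P : probability Omega R) (T : R) (F : R -> set (set Omega)).
Context d' (X : measurableType d') (mu : {measure set X -> \bar R}).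
Local Notation L1 := (L1 mu).
Variables (S : R -> L1 -> L1).

Definition stochastic_convolution (H : completeNormedModType R)
    (ip : H -> H -> R) (W : R -> H -> Omega -> R) (E : normedModType R)
    (SE : R -> E -> L1) (B : R -> Omega -> H -> E) (Z : R -> Omega -> L1) :=
  forall t, 0 <= t <= T ->
    stochastic_integral ip P F W t (fun s w h => SE (t - s) (B s w h)) (Z t).

(* v is the value at time t of the convolution of S and phi. *)
Definition convolution (phi : R -> L1) (t : R) (v : L1) : Prop :=
  bochner_integral (@lebesgue_measure R) `[0, t] (fun s => S (t - s) (phi s)) v.

Definition mild_equation (u g : R -> Omega -> L1) (u0 : Omega -> L1)
    (Z : R -> Omega -> L1) : Prop :=
  {ae P, forall w, forall t, 0 <= t <= T ->
    exists2 v, convolution (fun s => g s w) t v &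
      u t w + v = S t (u0 w) + Z t w}.

(* "g in f(u) a.e. in Omega x [0,T] x G" is written with iterated a.e.
   quantifiers, u and g being L^1-valued functions of (t, w). *)
Definition mild_solution (f : R -> R) (u0 : Omega -> L1)
    (Z : R -> Omega -> L1) (u : R -> Omega -> L1) : Prop :=
  [/\ adapted T F u, continuous_process P T u
    & exists g : R -> Omega -> L1,
      [/\ adapted T F g, integrable_process P T g,
          {ae P, forall w, {ae (@lebesgue_measure R), forall t, 0 <= t <= T ->
            {ae mu, forall x, monotone_extension f (u t w x) (g t w x)}}}
        & mild_equation u g u0 Z]].

Definition regularized_solution (f : R -> R) (lam : R) (u0 : Omega -> L1)
    (Z : R -> Omega -> L1) (u : R -> Omega -> L1) : Prop :=
  continuous_process P T u /\
  mild_equation u (fun t w => nemytskii (yosida f lam) (u t w)) u0 Z.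

(* [v] is a measurable function on [0,T] x X representing the L^1-valued
   function [phi]. *)
Definition represents (v : measurableTypeR R * X -> R) (phi : R -> L1) : Prop :=
  measurable_fun (`[0, T] `*` setT) v /\
  {ae (@lebesgue_measure R), forall t, 0 <= t <= T ->
    {ae mu, forall x, v (t, x) = phi t x}}.

End mild.

(* Main.v *)
From HB Require Import structures.
Require Import Defs.
From mathcomp Require Import all_boot all_order all_algebra.
From mathcomp Require Import all_classical all_reals all_analysis.
From mathcomp Require Import measurable_realfun.
From mathcomp Require Import lra ring.

(* The argument is pathwise.  Put z = S u_0 + S <> B and g_lam = f_lam(u_lam),
   so that z - u_lam = S * g_lam.  The functional Psi_d(v) = int (|v| - d)^+ is
   decreased by the subMarkovian semigroup S, and its difference quotient along
   S * h is controlled by the sign of h: applied to u_lam - u_mu, where the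
   monotonicity of f gives this sign up to the error lam g_lam - mu g_mu, it
   shows by equiintegrability that (u_lam) is Cauchy in C([0,T]; L^1); applied
   to two solutions it gives uniqueness.  Near-minimisers of the strictly convex
   int sqrt(1 + y^2) over convex combinations of the tails of (g_lam) converge
   in L^1, by equiintegrability again; their limit g satisfies z - u = S * g,
   and g in f(u) because (I + lam f)^-1 u_lam tends to u a.e.  Finally
   g(t) = lim n (y(t) - S(1/n) y(t - 1/n)) for a.e. t, where y = z - u, which
   makes g a measurable adapted process; u_lam is adapted as the limit of the
   Euler scheme of its equation. *)

Set Implicit Arguments.
Unset Strict Implicit.
Unset Printing Implicit Defensive.

Import Order.TTheory GRing.Theory Num.Theory.
Import numFieldNormedType.Exports.

Local Open Scope classical_set_scope.
Local Open Scope ring_scope.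

(** * Strong measurability *)

(** By monotonicity [g_lam - g_mu] has the sign of the difference of the resolvents, which is that
    of [u_lam - u_mu] only where the latter exceeds the error [lam g_lam - mu g_mu]. An L^1 norm
    would charge this mismatch at small values of [u_lam - u_mu]; cutting at height [delta] ignores
    it unless the error itself reaches [delta]. By Chebyshev this happens on a set of small measure,
    where equiintegrability takes over. The cut costs at most [delta] times the measure of [G],
    finite as [G] is bounded. A mild solution need not be differentiable in time, so left quotients
    twisted by the semigroup stand for the time derivative. The limit [g] is built for each outcome,
    with subsequences and weights that depend on it, hence without any measurability in the outcome.
    The limit [u] does not suffer from this, since the whole sequence converges. As [g] is
    determined by [z - u] for a.e. [t], recovering it from that path by a fixed countable procedure
    restores joint measurability and adaptedness. *)

Lemma lipschitz_continuous (R : realType) (V W : normedModType R) (F : V -> W) (L : R) :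
  0 <= L -> (forall x y, `|F x - F y| <= L * `|x - y|) -> continuous F.
Proof.
move=> L0 FL x; apply/cvgrPdist_lt => eps eps0.
have idx : y @[y --> x] --> x by exact: cvg_id.
have L1 : 0 < L + 1 by rewrite ltr_wpDl.
have /cvgrPdist_lt/(_ _ (divr_gt0 eps0 L1)) := idx.
apply: filterS => y; rewrite ltr_pdivlMr// mulrC => h.
by apply: le_lt_trans (FL _ _) _; apply: le_lt_trans h; rewrite ler_wpM2r// lerDl.
Qed.

Lemma measurable_absE d (X : measurableType d) (R : realType) (D : set X) (h : X -> R) :
  measurable_fun D h -> measurable_fun D (fun x => `|h x|%:E).
Proof. by move=> mh; apply/measurable_EFinP; exact: measurableT_comp. Qed.

(** The integral of a nonnegative function is a supremum over the simple functions below it, hence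
    monotone even for non-measurable integrands. *)
Lemma le_integral_ge0 d (X : measurableType d) (R : realType)
    (mu : {measure set X -> \bar R}) (D : set X) (f g : X -> \bar R) :
  (forall x, D x -> 0 <= f x)%E -> (forall x, D x -> f x <= g x)%E ->
  (\int[mu]_(x in D) f x <= \int[mu]_(x in D) g x)%E.
Proof.
move=> f0 fg; rewrite (integral_mkcond D f) (integral_mkcond D g).
have f0' x : (0 <= (f \_ D) x)%E by apply: erestrict_ge0 => y /f0.
have g0' x : (0 <= (g \_ D) x)%E.
  by apply: erestrict_ge0 => y Dy; exact: le_trans (f0 _ Dy) (fg _ Dy).
rewrite !ge0_integralTE//; apply: le_ereal_sup => _ [h hf <-].
exists h => // x; apply: le_trans (hf x) _.
by rewrite !patchE; case: ifPn => // /set_mem /fg.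
Qed.

Section simple_functions.
Context (R : realType) (V : normedModType R).

Lemma simple_fun_nil (X : Type) (x : X) :
  simple_fun (nil : seq (set X * V)) x = 0.
Proof. by rewrite /simple_fun big_nil. Qed.

Lemma simple_fun_cons (X : Type) (a : set X * V) e x :
  simple_fun (a :: e) x = (\1_(a.1) x : R) *: a.2 + simple_fun e x.
Proof. by rewrite /simple_fun big_cons. Qed.

Lemma simple_fun_cat (X : Type) (e1 e2 : seq (set X * V)) x :
  simple_fun (e1 ++ e2) x = simple_fun e1 x + simple_fun e2 x.
Proof. by rewrite /simple_fun big_cat. Qed.

Definition simple_map (U : normedModType R) (X : Type) (phi : V -> U)
    (e : seq (set X * V)) : seq (set X * U) :=
  [seq (a.1, phi a.2) | a <- e].

Definition simple_restrict (X : Type) (A : set X)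
    (e : seq (set X * V)) : seq (set X * V) :=
  [seq (a.1 `&` A, a.2) | a <- e].

Lemma simple_fun_restrict (X : Type) (A : set X) e x :
  simple_fun (simple_restrict A e) x = (\1_A x : R) *: simple_fun e x.
Proof.
rewrite /simple_fun /simple_restrict big_map scaler_sumr.
by apply: eq_bigr => a _ /=; rewrite indicI/= mulrC scalerA.
Qed.

Lemma simple_fun_map_linear (U : normedModType R) (X : Type) (phi : V -> U) e
    (x : X) : linear phi ->
  simple_fun (simple_map phi e) x = phi (simple_fun e x).
Proof.
move=> lphi; pose HH := GRing.isLinear.Build _ _ _ _ phi lphi.
pose phiL : {linear V -> U} := HB.pack phi HH.
rewrite -[phi]/(phiL : V -> U) /simple_fun /simple_map big_map linear_sum.
by apply: eq_bigr => a _; rewrite linearZ_LR.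
Qed.

Section measurable_simple.
Context d (X : measurableType d).
Implicit Types (e : seq (set X * V)) (D : set X).

Definition msimple e := forall a, a \in e -> measurable a.1.

Lemma msimple_cons a e : msimple (a :: e) -> measurable a.1 /\ msimple e.
Proof.
move=> m; split; first by apply: m; rewrite mem_head.
by move=> b be; apply: m; rewrite in_cons be orbT.
Qed.

Lemma msimple_cat e1 e2 : msimple e1 -> msimple e2 -> msimple (e1 ++ e2).
Proof. by move=> m1 m2 a; rewrite mem_cat => /orP[/m1|/m2]. Qed.

Lemma msimple_restrict D e : measurable D -> msimple e ->
  msimple (simple_restrict D e).
Proof. by move=> mD me a /mapP[b /me mb ->]; exact: measurableI. Qed.

(* Functions of a simple function are handled by induction on the list,
   generalizing over an additive constant. *)
Lemma measurable_simple_comp D (psi : V -> R) e c : msimple e ->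
  measurable_fun D (fun x => psi (c + simple_fun e x)).
Proof.
move=> me; apply: measurable_funTS; elim: e c me => [|a e IH] c.
  by move=> _; under eq_fun do rewrite simple_fun_nil; exact: measurable_cst.
move=> /msimple_cons[ma me].
rewrite (_ : (fun _ => _) = (fun x => \1_(a.1) x * psi (c + a.2 + simple_fun e x)
    + (1 - \1_(a.1) x) * psi (c + simple_fun e x))); last first.
  apply/funext => x; rewrite simple_fun_cons indicE.
  case: (x \in _) => /=; first by rewrite scale1r subrr mul0r addr0 mul1r addrA.
  by rewrite scale0r add0r subr0 mul0r add0r mul1r.
apply: measurable_funD; apply: measurable_funM => //; try exact: IH.
by apply: measurable_funB => //; exact: measurable_indic.
Qed.

Definition simple_int (mu : {measure set X -> \bar R}) D e : V :=
  \sum_(a <- e) fine (mu (a.1 `&` D)) *: a.2.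

(** The sets of the list may overlap, so bounding term by term would lose cancellations. Splitting
    [D] along the first set, whose vector is absorbed in [c] on one of the two halves, reduces to
    the tail of the list. *)
Lemma norm_simple_int (mu : {measure set X -> \bar R}) D c e : measurable D -> (mu D < +oo)%E -> msimple e ->
  ((`|fine (mu D) *: c + simple_int mu D e|)%:E <=
   \int[mu]_(x in D) `|c + simple_fun e x|%:E)%E.
Proof.
move=> mD muD me; elim: e c D me mD muD => [|a e IH] c D.
  move=> _ mD muD; rewrite /simple_int big_nil addr0.
  under eq_integral do rewrite simple_fun_nil addr0.
  rewrite integral_cst// normrZ ger0_norm; last exact: fine_ge0.
  by rewrite muleC EFinM fineK// ge0_fin_numE.
move=> mae mD muD; have [ma me] := msimple_cons mae.
have muS B : measurable B -> B `<=` D -> (mu B < +oo)%E.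
  by move=> mB BD; apply: le_lt_trans muD; apply: le_measure; rewrite ?inE.
have mDA : measurable (D `&` a.1) by exact: measurableI.
have mDC : measurable (D `\` a.1) by exact: measurableD.
have fD B : measurable B -> fine (mu (B `&` D)) =
    fine (mu (B `&` (D `&` a.1))) + fine (mu (B `&` (D `\` a.1))).
  move=> mB; rewrite -fineD; last 2 first.
  - rewrite ge0_fin_numE//; apply: muS; first exact: measurableI.
    by move=> x [_ []].
  - rewrite ge0_fin_numE//; apply: muS; first exact: measurableI.
    by move=> x [_ []].
  rewrite -measureU; first by rewrite -setIUr setUIDK.
  - exact: measurableI.
  - exact: measurableI.
  - rewrite -subset0 => x [[_ [_ xa]] [_ [_ nxa]]]; exact: (nxa xa).
rewrite -(setUIDK D a.1) ge0_integral_setU//=; last 2 first.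
- rewrite setUIDK; apply/measurable_EFinP.
  exact: (@measurable_simple_comp D (fun v => `|v|) (a :: e) c).
- by apply/disj_setPS => x [[_ xa] [_ nxa]]; exact: (nxa xa).
rewrite setUIDK.
have -> : (\int[mu]_(x in D `&` a.1) `|c + simple_fun (a :: e) x|%:E =
    \int[mu]_(x in D `&` a.1) `|c + a.2 + simple_fun e x|%:E)%E.
  apply: eq_integral => x /set_mem[_ xa].
  by rewrite simple_fun_cons indicE mem_set// scale1r addrA.
have -> : (\int[mu]_(x in D `\` a.1) `|c + simple_fun (a :: e) x|%:E =
    \int[mu]_(x in D `\` a.1) `|c + simple_fun e x|%:E)%E.
  apply: eq_integral => x /set_mem[_ xa].
  by rewrite simple_fun_cons indicE memNset// scale0r add0r.
apply: le_trans; last first.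
  by apply: leeD; apply: IH => //; apply: muS.
rewrite -EFinD lee_fin; apply: le_trans (ler_normD _ _); rewrite le_eqVlt.
apply/orP; left; apply/eqP; congr (`| _ |).
have -> : simple_int mu D (a :: e) =
    fine (mu (D `&` a.1)) *: a.2 + simple_int mu D e.
  by rewrite /simple_int big_cons setIC.
have -> : simple_int mu D e =
    simple_int mu (D `&` a.1) e + simple_int mu (D `\` a.1) e.
  rewrite /simple_int -big_split/=; apply: eq_big_seq => b /me mb.
  by rewrite fD// scalerDl.
have := fD setT measurableT; rewrite !setTI => ->.
by rewrite scalerDr scalerDl -!addrA; congr (_ + _);
  rewrite [LHS]addrC -!addrA; congr (_ + _); rewrite [RHS]addrCA [in RHS]addrC -!addrA.
Qed.

End measurable_simple.
End simple_functions.

Notation smeas := (strongly_measurable (@measurable _ _)).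

Section strong_measurability.
Context (R : realType) (V : normedModType R).
Context d (X : measurableType d).
Implicit Types (D : set X) (f : X -> V) (e : seq (set X * V)).

Lemma smeas_simple D e : msimple e -> smeas D (simple_fun e).
Proof. by move=> me; exists (fun=> e); split=> [n|x _]; [exact: me|exact: cvg_cst]. Qed.

Lemma smeas_subset D D' f : D' `<=` D -> smeas D f -> smeas D' f.
Proof. by move=> D'D [e [me ef]]; exists e; split => // x /D'D /ef. Qed.

Lemma eq_smeas D f g : {in D, f =1 g} -> smeas D f -> smeas D g.
Proof.
move=> fg [e [me ef]]; exists e; split => // x Dx.
by rewrite -fg ?inE//; exact: ef.
Qed.

Lemma smeas_cst D (v : V) : smeas D (fun=> v).
Proof.
apply: (@eq_smeas _ (simple_fun [:: (setT, v)])); last first.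
  by apply: smeas_simple => a; rewrite inE => /eqP -> /=; exact: measurableT.
by move=> x _; rewrite simple_fun_cons simple_fun_nil indicT scale1r addr0.
Qed.

Lemma smeasD D f g : smeas D f -> smeas D g -> smeas D (fun x => f x + g x).
Proof.
move=> [e [me ef]] [e' [me' eg]]; exists (fun n => e n ++ e' n); split.
  by move=> n; exact: (msimple_cat (me n) (me' n)).
move=> x Dx; under eq_fun do rewrite simple_fun_cat.
by apply: cvgD; [exact: ef|exact: eg].
Qed.

Lemma smeas_indic D f A : measurable A -> smeas D f ->
  smeas D (fun x => (\1_A x : R) *: f x).
Proof.
move=> mA [e [me ef]]; exists (fun n => simple_restrict A (e n)); split.
  by move=> n; exact: (msimple_restrict mA (me n)).
move=> x Dx; under eq_fun do rewrite simple_fun_restrict.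
by apply: cvgZr; exact: ef.
Qed.

(** A nonlinear [F] does not act term by term on a sum over overlapping sets. Each set splits the
    space in two, and [c] accumulates the vectors of the sets met so far. *)
Fixpoint simple_comp (U : normedModType R) (F : V -> U) (c : V) e :
    seq (set X * U) :=
  match e with
  | nil => [:: (setT, F c)]
  | a :: e' => simple_restrict a.1 (simple_comp F (c + a.2) e') ++
               simple_restrict (~` a.1) (simple_comp F c e')
  end.

Lemma simple_compE (U : normedModType R) (F : V -> U) c e x :
  simple_fun (simple_comp F c e) x = F (c + simple_fun e x).
Proof.
elim: e c => [|a e IH] c /=.
  by rewrite simple_fun_cons !simple_fun_nil/= indicT scale1r !addr0.
rewrite simple_fun_cat !simple_fun_restrict !IH simple_fun_cons !indicE in_setC.
case: (x \in a.1) => /=; first by rewrite !scale1r scale0r addr0 addrA.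
by rewrite !scale0r scale1r !add0r.
Qed.

Lemma msimple_comp (U : normedModType R) (F : V -> U) c e : msimple e ->
  msimple (simple_comp F c e).
Proof.
elim: e c => [|a e IH] c /=; first by move=> _ b; rewrite inE => /eqP -> /=; exact: measurableT.
move=> /msimple_cons[ma me]; apply: msimple_cat; apply: msimple_restrict => //.
- exact: IH.
- exact: measurableC.
- exact: IH.
Qed.

Lemma smeas_comp (U : normedModType R) (F : V -> U) D f :
  continuous F -> smeas D f -> smeas D (F \o f).
Proof.
move=> cF [e [me ef]]; exists (fun n => simple_comp F 0 (e n)); split.
  by move=> n; exact: (@msimple_comp U F 0 _ (me n)).
move=> x Dx; under eq_fun do rewrite simple_compE add0r.
by apply: (cvg_comp _ _ (ef _ Dx)); exact: cF.
Qed.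

Lemma smeasN D f : smeas D f -> smeas D (fun x => - f x).
Proof. by apply: (@smeas_comp V (fun v => - v)); exact: opp_continuous. Qed.

Lemma smeasB D f g : smeas D f -> smeas D g -> smeas D (fun x => f x - g x).
Proof. by move=> mf mg; apply: smeasD => //; exact: smeasN. Qed.

Lemma smeasZ D f (a : R) : smeas D f -> smeas D (fun x => a *: f x).
Proof. by apply: (@smeas_comp V (fun v => a *: v)); exact: scaler_continuous. Qed.

Lemma smeas_extend D f : measurable D -> smeas D f ->
  smeas setT (fun x => (\1_D x : R) *: f x).
Proof.
move=> mD [s [ms sf]]; exists (fun n => simple_restrict D (s n)); split.
  by move=> n; exact: (msimple_restrict mD (ms n)).
move=> x _; under eq_fun do rewrite simple_fun_restrict.
have [Dx|nDx] := pselect (D x).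
  by rewrite indicE mem_set//; apply: cvgZr; exact: sf.
by rewrite indicE memNset//; under eq_fun do rewrite scale0r; rewrite scale0r; exact: cvg_cst.
Qed.

Lemma smeas_sum (I : Type) (s : seq I) D (f : I -> X -> V) :
  (forall i, smeas D (f i)) -> smeas D (fun x => \sum_(i <- s) f i x).
Proof.
move=> mf; elim: s => [|i s IH].
  by under eq_fun do rewrite big_nil; exact: smeas_cst.
by under eq_fun do rewrite big_cons; exact: smeasD.
Qed.

Lemma smeas_norm D f : smeas D f -> measurable_fun D (fun x => `|f x|).
Proof.
move=> [e [me ef]].
apply: (@measurable_fun_cvg _ _ _ _ (fun n x => `|simple_fun (e n) x|)).
  move=> n; under eq_fun do rewrite -(add0r (simple_fun _ _)).
  exact: (@measurable_simple_comp _ _ _ _ D (fun v => `|v|) _ 0 (me n)).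
by move=> x Dx; apply: cvg_norm; exact: ef.
Qed.

Lemma smeas_normE D f : smeas D f -> measurable_fun D (fun x => `|f x|%:E).
Proof. by move=> mf; apply/measurable_EFinP; exact: smeas_norm. Qed.

(* At each point, keep the best of the first [n] simple functions. *)
Lemma smeas_approx D f (E : nat -> seq (set X * V)) : measurable D ->
  (forall j, msimple (E j)) ->
  (forall j, measurable_fun D (fun x => `|simple_fun (E j) x - f x|)) ->
  (forall x, D x -> forall eps, 0 < eps ->
     exists j, `|simple_fun (E j) x - f x| < eps) ->
  smeas D f.
Proof.
move=> mD mE mEf Ef.
pose C j e := D `&` [set x | `|simple_fun (E j) x - f x| < `|simple_fun e x - f x|].
pose fix g n := if n is m.+1 then
  simple_restrict (C m.+1 (g m)) (E m.+1) ++ simple_restrict (~` C m.+1 (g m)) (g m)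
  else E 0.
have gE m x : D x -> `|simple_fun (g m.+1) x - f x| =
    Num.min `|simple_fun (E m.+1) x - f x| `|simple_fun (g m) x - f x|.
  move=> Dx; rewrite /= simple_fun_cat !simple_fun_restrict !indicE in_setC.
  rewrite minElt; case: ifPn => [h|/negP h].
    by rewrite mem_set//= scale0r scale1r addr0.
  rewrite memNset/=; first by rewrite scale0r scale1r add0r.
  by move=> [_]; exact: h.
have mCg j e : msimple e -> measurable_fun D (fun x => `|simple_fun e x - f x|) ->
    measurable (C j e).
  move=> me mef; have := measurable_fun_ltr (mEf j) mef.
  by move=> /(_ mD [set true]) h; apply: h.
have mg n : msimple (g n) /\ measurable_fun D (fun x => `|simple_fun (g n) x - f x|).
  elim: n => [|n [IH1 IH2]]; first by split; [exact: mE|exact: mEf].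
  split.
    apply: msimple_cat; apply: msimple_restrict => //; first exact: mCg.
    by apply: measurableC; exact: mCg.
  apply: (eq_measurable_fun (fun x =>
    Num.min `|simple_fun (E n.+1) x - f x| `|simple_fun (g n) x - f x|)).
    by move=> x /set_mem Dx; rewrite gE.
  by apply: measurable_minr.
exists g; split; first by move=> n; exact: (mg n).1.
move=> x Dx.
have gmin n j : (j <= n)%N -> `|simple_fun (g n) x - f x| <= `|simple_fun (E j) x - f x|.
  elim: n => [|n IH]; first by rewrite leqn0 => /eqP ->.
  rewrite leq_eqVlt => /orP[/eqP ->|jn]; rewrite gE// ge_min ?lexx//.
  by rewrite IH// orbT.
apply/cvgrPdist_lt => eps eps0; have [j jeps] := Ef x Dx eps eps0.
near=> n; rewrite distrC; apply: le_lt_trans jeps; apply: gmin.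
by near: n; exact: nbhs_infty_ge.
Unshelve. all: by end_near. Qed.

(** A diagonal sequence need not converge pointwise. Instead, the approximants of all the [fn n] are
    enumerated together by [pickle], and [smeas_approx] selects the best of them at each point. *)
Lemma smeas_cvg D (fn : nat -> X -> V) f : measurable D ->
  (forall n, smeas D (fn n)) -> (forall x, D x -> fn n x @[n --> \oo] --> f x) ->
  smeas D f.
Proof.
move=> mD mfn fnf; have [e he] := choice mfn.
pose E j := if @unpickle (nat * nat)%type j is Some q then e q.1 q.2 else nil.
have mE j : msimple (E j).
  by rewrite /E; case: unpickle => [q|//]; exact: (he q.1).1.
apply: (@smeas_approx _ _ E) => // [j|x Dx eps eps0].
  apply: (@measurable_fun_cvg _ _ _ _ (fun n x => `|simple_fun (E j) x - fn n x|)).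
    by move=> n; apply: smeas_norm; apply: smeasB => //; exact: smeas_simple.
  by move=> x Dx; apply: cvg_norm; apply: cvgB; [exact: cvg_cst|exact: fnf].
have e20 : 0 < eps / 2 by rewrite divr_gt0.
have /cvgrPdist_lt/(_ _ e20)[N _ /(_ N (leqnn _))/= HN] := fnf x Dx.
have /cvgrPdist_lt/(_ _ e20)[K _ /(_ K (leqnn _))/= HK] := (he N).2 x Dx.
exists (pickle (N, K)); rewrite /E pickleK/= distrC.
rewrite (le_lt_trans (ler_distD (fn N x) _ _))// (splitr eps) ltrD//.
Qed.

(** A simple function only takes subset sums of its finitely many vectors, so the approximants have
    countably many values in all. The sequence [v] later gives Lebesgue points of a vector-valued
    function. *)
Lemma smeas_dense D f : smeas D f ->
  exists v : nat -> V, forall x, D x -> forall eps, 0 < eps ->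
    exists k, `|f x - v k| < eps.
Proof.
move=> [e [me ef]].
pose fix vals (l : seq (set X * V)) : seq V := if l is a :: l' then
  vals l' ++ [seq a.2 + u | u <- vals l'] else [:: 0].
have valsP l x : simple_fun l x \in vals l.
  elim: l => [|a l IH]; first by rewrite simple_fun_nil mem_head.
  rewrite simple_fun_cons indicE /= mem_cat; case: (x \in a.1) => /=.
    by rewrite scale1r map_f ?orbT.
  by rewrite scale0r add0r IH.
exists (fun k => if @unpickle (nat * nat)%type k is Some q then nth 0 (vals (e q.1)) q.2 else 0).
move=> x Dx eps eps0.
have /cvgrPdist_lt/(_ _ eps0)[N _ /(_ N (leqnn _))/= HN] := ef x Dx.
exists (pickle (N, index (simple_fun (e N) x) (vals (e N)))).
by rewrite pickleK/= nth_index.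
Qed.

Lemma smeas_measurable_comp d' (Y : measurableType d') (phi : Y -> X) D (D' : set Y) f :
  measurable_fun setT phi -> (forall y, D' y -> D (phi y)) -> smeas D f ->
  smeas D' (f \o phi).
Proof.
move=> mphi phiD [e [me ef]].
exists (fun n => [seq (phi @^-1` a.1, a.2) | a <- e n]); split.
  move=> n a /mapP[b /me mb ->] /=; rewrite -[X in measurable X]setTI.
  exact: mphi.
move=> y /phiD /ef; rewrite /simple_fun.
by under [in X in _ -> X]eq_fun do rewrite big_map.
Qed.

Definition cauchy_seq (u : nat -> V) := forall eps : R, 0 < eps ->
  exists N, forall n, (N <= n)%N -> `|u N - u n| < eps.

Lemma measurable_cauchy_seq (fn : nat -> X -> V) : (forall n, smeas setT (fn n)) ->
  measurable [set x | cauchy_seq (fn^~ x)].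
Proof.
move=> mfn.
rewrite (_ : mkset _ = \bigcap_k \bigcup_N \bigcap_(n in [set n | (N <= n)%N])
   [set x | `|fn N x - fn n x| < k.+1%:R^-1]).
  apply: bigcapT_measurable => k.
  apply: bigcupT_measurable => N; apply: bigcap_measurable; first by exists N => /=.
  move=> n _; have := measurable_fun_ltr (smeas_norm (smeasB (mfn N) (mfn n)))
    (@measurable_cst _ _ _ _ setT (k.+1%:R^-1 : R)).
  by move=> /(_ measurableT [set true]); rewrite setTI => h; apply: h.
apply/seteqP; split => x /= fx.
  move=> k _; have [|N HN] := fx (k.+1%:R^-1); first by rewrite invr_gt0.
  by exists N => // n; exact: HN.
move=> eps eps0.
have [k ke] : exists k : nat, k.+1%:R^-1 < eps.
  have [k _ /(_ k)/(_ (leqnn _)) ke] := near_infty_natSinv_lt (PosNum eps0).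
  by exists k.
have [N _ HN] := fx k I; exists N => n Nn.
exact: lt_trans (HN _ Nn) ke.
Qed.

Lemma cvg_cauchy_seq (u : nat -> V) (v : V) : u n @[n --> \oo] --> v -> cauchy_seq u.
Proof.
move=> uv eps eps0; have e20 : 0 < eps / 2 by rewrite divr_gt0.
have /cvgrPdist_lt/(_ _ e20)[N _ HN] := uv.
exists N => n Nn; rewrite (le_lt_trans (ler_distD v _ _))// (splitr eps) ltrD//.
  by rewrite distrC; apply: HN => /=.
by apply: HN.
Qed.

End strong_measurability.

(** * Joint measurability of processes with continuous paths *)

Section caratheodory.
Context (R : realType) (V : normedModType R).
Context d (X : measurableType d).

Lemma within_continuous_dist (T : R) (u : R -> V) :
  {within `[0, T], continuous u} <->
  forall t, 0 <= t <= T -> forall eps : R, 0 < eps -> exists2 del : R, 0 < del &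
    forall s, 0 <= s <= T -> `|s - t| < del -> `|u s - u t| < eps.
Proof.
rewrite subspace_continuousP; split=> [cu t tT eps eps0|cu t /= tT].
  have /cvgrPdist_lt/(_ _ eps0) := cu t tT.
  rewrite nearE/= => /nbhs_ballP[del /= del0 Hdel]; exists del => // s sT st.
  rewrite distrC; apply: (Hdel s) => //; first by rewrite /ball/= distrC.
apply/cvgrPdist_lt => eps eps0.
have [del del0 Hdel] := cu t tT eps eps0.
rewrite nearE/=; apply/nbhs_ballP; exists del => //= s; rewrite /ball/= => ts sT.
by rewrite distrC; apply: Hdel => //; rewrite distrC.
Qed.

(** Continuity makes the process the pointwise limit of its values at the left ends of the cells of
    a grid of mesh [T / N.+1]. *)
Lemma smeas_caratheodory (T : R) (f : R -> X -> V) : 0 < T ->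
  (forall t, 0 <= t <= T -> smeas setT (f t)) ->
  (forall x, {within `[0, T], continuous (fun t => f t x)}) ->
  strongly_measurable (@measurable _ (measurableTypeR R * X)%type)
    (`[0, T] `*` setT) (fun tx => f tx.1 tx.2).
Proof.
move=> T0 mf cf.
pose p (N i : nat) : R := T * i%:R / N.+1%:R.
have pT N i : (i <= N.+1)%N -> 0 <= p N i <= T.
  move=> iN; apply/andP; split; first by rewrite divr_ge0// mulr_ge0// ltW.
  by rewrite /p ler_pdivrMr// ler_pM2l// ler_nat.
(* With [N.+2] cells the last one starts at [T], so that the time [T] itself is covered. *)
pose fn N (tx : R * X) := \sum_(i < N.+2)
   (\1_(`[p N i, p N i.+1[) tx.1 : R) *: f (p N i) tx.2.
have mI : measurable (`[0, T]%classic : set (measurableTypeR R)) by exact: measurable_itv.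
apply: (@smeas_cvg _ _ _ _ _ (fun N (tx : measurableTypeR R * X) => fn N tx)).
- exact: measurableX.
- move=> N; apply: smeas_sum => i.
  apply: (@eq_smeas _ _ _ _ _ (fun tx : measurableTypeR R * X =>
      (\1_(`[p N i, p N i.+1[ `*` setT) tx : R) *: f (p N i) tx.2)).
    by move=> [t x] _; rewrite !indicE in_setX/= in_setT andbT.
  apply: smeas_indic; first by apply: measurableX => //; exact: measurable_itv.
  apply: (@smeas_measurable_comp _ _ _ _ _ _ snd setT _ (f (p N i))) => //.
  by apply/mf/pT; rewrite -ltnS ltn_ord.
move=> [t x] [/= tT _].
have /andP[t0 tT'] : 0 <= t <= T by move: tT; rewrite in_itv.
have fnE N : fn N (t, x) = f (p N (Num.truncn (t * N.+1%:R / T))) x.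
  have r0 : 0 <= t * N.+1%:R / T by rewrite divr_ge0 ?mulr_ge0// ltW.
  set k := Num.truncn _.
  have /andP[k1 k2] : k%:R <= t * N.+1%:R / T < k.+1%:R by exact: truncn_itv.
  have kN : (k < N.+2)%N.
    rewrite ltnS -(ler_nat R) (le_trans k1)// ler_pdivrMr// mulrC ler_pM2l//.
  rewrite /fn (bigD1 (Ordinal kN))//= big1 ?addr0.
    rewrite indicE mem_set ?scale1r//=.
    rewrite in_itv/= /p ler_pdivrMr// ltr_pdivlMr//.
    by move: k1 k2; rewrite ler_pdivlMr// ltr_pdivrMr// ![_ * T]mulrC => -> ->.
  move=> i ik; rewrite indicE memNset ?scale0r//=.
  apply/negP; rewrite in_itv/= /p.
  rewrite ler_pdivrMr// ltr_pdivlMr//; apply/negP => /andP[h1 h2].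
  move/eqP : ik; apply; apply/val_inj/eqP; rewrite /= eqn_leq.
  rewrite -ltnS -(ltr_nat R) (@le_lt_trans _ _ (t * N.+1%:R / T))//=; last first.
    by rewrite ler_pdivlMr// mulrC.
  by rewrite -ltnS -(ltr_nat R) (le_lt_trans k1)// ltr_pdivrMr// [ltRHS]mulrC.
under eq_fun do rewrite fnE.
apply/cvgrPdist_lt => eps eps0.
have [|del del0 Hdel] := (within_continuous_dist _ _).1 (cf x) t _ eps eps0.
  by rewrite t0.
have [K _ HK] : \forall K \near \oo, T / K.+1%:R < del.
  have [K _ HK] := near_infty_natSinv_lt (PosNum (divr_gt0 del0 T0)).
  by exists K => // n Kn; rewrite mulrC -ltr_pdivlMr//; exact: HK.
exists K => // N /= /HK {}HK; rewrite distrC.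
set k := Num.truncn _.
have r0 : 0 <= t * N.+1%:R / T by rewrite divr_ge0 ?mulr_ge0// ltW.
have /andP[k1 k2] : k%:R <= t * N.+1%:R / T < k.+1%:R by exact: truncn_itv.
have pt : p N k <= t.
  by rewrite /p ler_pdivrMr// mulrC; move: k1; rewrite ler_pdivlMr.
apply: Hdel.
  by rewrite (le_trans pt tT') andbT /p divr_ge0// mulr_ge0// ltW.
rewrite distrC ger0_norm ?subr_ge0//; apply: le_lt_trans HK.
rewrite lerBlDr /p -mulrDl -{1}(mulr1 T) -mulrDr addrC natr1.
rewrite ler_pdivlMr//; move: k2; rewrite ltr_pdivrMr// [ltRHS]mulrC => /ltW.
by [].
Qed.
End caratheodory.

(** * The Bochner integral *)

Notation smeasI T := (strongly_measurable (@measurable _ (measurableTypeR _)) `[0, T]).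

Notation conv S h t v :=
  (bochner_integral (@lebesgue_measure _) `[0, t] (fun s => S (t - s) (h s)) v).

Section lebesgue_line.
Context (R : realType).
Local Notation leb := (@lebesgue_measure R).
Implicit Types P Q : R -> Prop.

Lemma measurable_itvcc (a b : R) : measurable (`[a, b]%classic : set (measurableTypeR R)).
Proof. exact: measurable_itv. Qed.

Lemma ae_lebesgueS P Q : (forall t, P t -> Q t) ->
  {ae leb, forall t, P t} -> {ae leb, forall t, Q t}.
Proof. by apply: (@filterS _ _ (ae_filter_ringOfSetsType leb)). Qed.

Lemma ae_lebesgueS2 P P' Q : (forall t, P t -> P' t -> Q t) ->
  {ae leb, forall t, P t} -> {ae leb, forall t, P' t} -> {ae leb, forall t, Q t}.
Proof. by apply: (@filterS2 _ _ (ae_filter_ringOfSetsType leb)). Qed.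

Lemma ae_lebesgue_neq0 : {ae leb, forall t : R, t <> 0}.
Proof.
exists [set 0]; split; [exact: measurable_set1|exact: lebesgue_measure_set1|].
by move=> t /= /contrapT.
Qed.

End lebesgue_line.

Lemma smeas_continuous (R : realType) (V : normedModType R) (T : R)
    (u : R -> V) : 0 < T -> {within `[0, T], continuous u} ->
  smeasI T u.
Proof.
move=> T0 cu.
have := @smeas_caratheodory _ _ _ unit T (fun t _ => u t) T0.
move=> /(_ (fun _ _ => smeas_cst _ _) (fun=> cu)) h.
apply: (@smeas_measurable_comp _ _ _ _ _ _ (fun t : measurableTypeR R => (t, tt)) _ _ _ _ _ h).
  by apply/measurable_fun_pairP; split; [exact: measurable_id|exact: measurable_cst].
by move=> t tT; split.
Qed.

Lemma ge0_cvge0P (R : realType) (u : nat -> \bar R) :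
  (forall n, 0 <= u n)%E ->
  (u n @[n --> \oo] --> 0%E) <->
  (forall eps : R, 0 < eps -> exists N, forall n, (N <= n)%N -> (u n <= eps%:E)%E).
Proof.
move=> u0; split=> [/fine_cvgP[[N _ fu] cu] eps eps0|cu].
  have /cvgrPdist_lt/(_ _ eps0)[M _ HM] := cu.
  exists (maxn N M) => n; rewrite geq_max => /andP[Nn Mn].
  rewrite -[leLHS](fineK (fu _ Nn)) lee_fin.
  have /= := HM _ Mn; rewrite sub0r normrN => /ltW; apply: le_trans.
  exact: ler_norm.
apply/fine_cvgP; split.
  have [N HN] := cu 1 ltr01; exists N => // n /= /HN un.
  by rewrite ge0_fin_numE// (le_lt_trans un)// ltry.
apply/cvgrPdist_le => eps eps0; have [N HN] := cu _ eps0.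
exists N => // n /= /HN un.
have fu : u n \is a fin_num by rewrite ge0_fin_numE// (le_lt_trans un)// ltry.
by rewrite sub0r normrN ger0_norm ?fine_ge0// -lee_fin fineK.
Qed.

Lemma squeeze_cvge0 (R : realType) (u w : nat -> \bar R) :
  (forall n, 0 <= u n)%E -> (forall n, u n <= w n)%E ->
  w n @[n --> \oo] --> 0%E -> u n @[n --> \oo] --> 0%E.
Proof.
move=> u0 uw; have w0 n : (0 <= w n)%E by exact: le_trans (u0 n) (uw n).
move=> /(ge0_cvge0P w0) cw; apply/(ge0_cvge0P u0) => eps /cw[N HN].
by exists N => n /HN; exact: le_trans.
Qed.

Section bochner_theory.
Context (R : realType) (V : normedModType R).
Context d (X : measurableType d) (mu : {measure set X -> \bar R}).
Implicit Types (D : set X) (f g : X -> V).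

Lemma measurable_normB D f e : smeas D f -> msimple e ->
  measurable_fun D (fun x => `|f x - simple_fun e x|%:E).
Proof.
move=> mf me; apply: smeas_normE; apply: smeasB => //.
exact: smeas_simple.
Qed.

Lemma eq_bochner D f g v : {in D, f =1 g} ->
  bochner_integral mu D f v -> bochner_integral mu D g v.
Proof.
move=> fg [mf [e [me ef ev]]]; split; first exact: eq_smeas mf.
exists e; split => //; apply: cvg_trans ef; apply: near_eq_cvg; near=> n.
by apply: eq_integral => x xD; rewrite fg.
Unshelve. all: by end_near. Qed.

Lemma bochner_comb D f g (a : R) v w : measurable D ->
  bochner_integral mu D f v -> bochner_integral mu D g w ->
  bochner_integral mu D (fun x => a *: f x + g x) (a *: v + w).
Proof.
move=> mD [mf [e [me ef ev]]] [mg [e' [me' eg ew]]].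
have me1 n : msimple (e n) by move=> b /me[].
have me1' n : msimple (e' n) by move=> b /me'[].
split; first by apply: smeasD => //; exact: smeasZ.
exists (fun n => simple_map (fun v => a *: v) (e n) ++ e' n); split.
- move=> n b; rewrite mem_cat => /orP[/mapP[c /me[mc fc] ->]//|/me'//].
- apply: (@squeeze_cvge0 _ _ (fun n => `|a|%:E *
      (\int[mu]_(x in D) `|f x - simple_fun (e n) x|%:E) +
      \int[mu]_(x in D) `|g x - simple_fun (e' n) x|%:E)%E).
  + by move=> n; exact: integral_ge0.
  + move=> n; rewrite -ge0_integralZl//; last exact: measurable_normB.
    rewrite -ge0_integralD//; last 2 first.
    * by apply: measurable_funeM; exact: measurable_normB.
    * exact: measurable_normB.
    apply: le_integral_ge0 => // x Dx; rewrite -EFinM -EFinD lee_fin.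
    rewrite simple_fun_cat simple_fun_map_linear; last first.
      by move=> b u u'; rewrite scalerDr !scalerA mulrC.
    by rewrite opprD addrACA -scalerBr (le_trans (ler_normD _ _))// normrZ.
  + have z : (`|a|%:E * 0 + 0 = 0)%E by rewrite mule0 adde0.
    rewrite -[X in _ --> X]z.
    by apply: cvgeD; [rewrite mule0|apply: cvgeZl|].
- rewrite (_ : (fun _ => _) = (fun n => a *: simple_int mu D (e n) +
      simple_int mu D (e' n))); last first.
    apply/funext => n; rewrite big_cat/= /simple_map big_map/=; congr (_ + _).
    by rewrite scaler_sumr; apply: eq_bigr => b _; rewrite !scalerA mulrC.
  by apply: cvgD => //; exact: cvgZr.
Qed.

Lemma bochnerB D f g v w : measurable D ->
  bochner_integral mu D f v -> bochner_integral mu D g w ->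
  bochner_integral mu D (fun x => f x - g x) (v - w).
Proof.
move=> mD bf bg; rewrite -scaleN1r addrC.
apply: (@eq_bochner _ (fun x => (-1 : R) *: g x + f x)).
  by move=> x _; rewrite scaleN1r addrC.
exact: bochner_comb.
Qed.

Lemma bochner_cst D (c : V) : measurable D -> (mu D < +oo)%E ->
  bochner_integral mu D (fun=> c) (fine (mu D) *: c).
Proof.
move=> mD muD; split; first exact: smeas_cst.
exists (fun=> [:: (setT, c)]); split.
- by move=> n a; rewrite inE => /eqP -> /=; rewrite setTI; split => //; exact: measurableT.
- rewrite (_ : (fun _ => _) = (fun=> 0%E)); first exact: cvg_cst.
  apply/funext => n; apply: integral0_eq => x _.
  by rewrite simple_fun_cons simple_fun_nil indicT scale1r addr0 subrr normr0.
- by rewrite big_seq1 setTI; exact: cvg_cst.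
Qed.

Lemma bochner_linear (L : V -> V) D f v : linear L -> (forall x, `|L x| <= `|x|) ->
  bochner_integral mu D f v -> bochner_integral mu D (L \o f) (L v).
Proof.
move=> linL contrL [mf [e [me ef ev]]].
pose HH := GRing.isLinear.Build _ _ _ _ L linL.
pose Ll : {linear V -> V} := HB.pack L HH.
have LB x y : L x - L y = L (x - y) by rewrite -[L]/(Ll : V -> V) linearB.
have cL : continuous L.
  by apply: (@lipschitz_continuous _ _ _ _ 1) => // x y; rewrite LB mul1r.
split; first exact: smeas_comp.
exists (fun n => simple_map L (e n)); split.
- by move=> n b /mapP[c /me[mc fc] ->].
- apply: squeeze_cvge0 ef => n; first exact: integral_ge0.
  apply: le_integral_ge0 => // x Dx; rewrite lee_fin simple_fun_map_linear//.
  by rewrite /= LB.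
- rewrite (_ : (fun _ => _) = L \o (fun n => simple_int mu D (e n))).
    by apply: (cvg_comp _ _ ev); exact: cL.
  apply/funext => n /=; rewrite -[L]/(Ll : V -> V) /simple_int linear_sum.
  by rewrite /simple_map big_map; apply: eq_bigr => a _; rewrite linearZ_LR.
Qed.

Lemma bochner_extend D D' f v : measurable D -> measurable D' -> D' `<=` D ->
  bochner_integral mu D' f v ->
  bochner_integral mu D (fun x => (\1_D' x : R) *: f x) v.
Proof.
move=> mD mD' D'D [mf [e [me ef ev]]]; split.
  exact: smeas_subset (smeas_extend mD' mf).
exists (fun n => simple_restrict D' (e n)); split.
- move=> n b /mapP[c /me[mc fc] ->] /=; split; first exact: measurableI.
  by rewrite -setIA (setIidl D'D).
- rewrite (_ : (fun _ => _) = (fun n => \int[mu]_(x in D') `|f x - simple_fun (e n) x|%:E)%E) //.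
  apply/funext => n; rewrite -[in RHS](setIidr D'D) integral_mkcondr.
  apply: eq_integral => x _; rewrite patchE simple_fun_restrict indicE.
  case: (x \in D'); first by rewrite !scale1r.
  by rewrite !scale0r subrr normr0.
- rewrite (_ : (fun _ => _) = (fun n => simple_int mu D' (e n)))//.
  apply/funext => n; rewrite /simple_restrict big_map; apply: eq_bigr => a _ /=.
  by rewrite -setIA (setIidl D'D).
Qed.

Lemma bochner_norm D f v : measurable D -> (mu D < +oo)%E ->
  bochner_integral mu D f v -> (`|v|%:E <= \int[mu]_(x in D) `|f x|%:E)%E.
Proof.
move=> mD muD [mf [e [me ef ev]]]; apply/lee_addgt0Pr => eps eps0.
have me1 n : msimple (e n) by move=> b /me[].
have e20 : 0 < eps / 2 by rewrite divr_gt0.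
have I0 n : (0 <= \int[mu]_(x in D) `|f x - simple_fun (e n) x|%:E)%E.
  exact: integral_ge0.
have [N HN] := (ge0_cvge0P I0).1 ef _ e20.
have /cvgrPdist_le/(_ _ e20)[M _ HM] := ev.
pose n := maxn N M.
have /= vn := HM n (leq_maxr _ _).
apply: (@le_trans _ _ ((eps / 2)%:E + `|simple_int mu D (e n)|%:E)%E).
  rewrite -EFinD lee_fin -(subrK (simple_int mu D (e n)) v).
  by rewrite (le_trans (ler_normD _ _))// lerD2r.
have -> : (eps%:E = (eps / 2)%:E + (eps / 2)%:E)%E by rewrite -EFinD -splitr.
rewrite addeA [leRHS]addeC; apply: leeD2l.
have /le_trans : (`|simple_int mu D (e n)|%:E <=
    \int[mu]_(x in D) `|simple_fun (e n) x|%:E)%E.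
  have := norm_simple_int 0 mD muD (me1 n).
  rewrite scaler0 add0r => /le_trans; apply.
  by apply: le_integral_ge0 => // x _; rewrite add0r.
apply; apply: le_trans (leeD2l _ (HN n (leq_maxl _ _))).
rewrite -ge0_integralD//; last 2 first.
- exact: smeas_normE.
- exact: measurable_normB.
apply: le_integral_ge0 => // x Dx; rewrite -EFinD lee_fin.
by rewrite -lerBlDl (le_trans (lerB_dist _ _))// distrC.
Qed.

(** A diagonal choice: for each [n] a list is taken whose errors, both in the integral norm and in
    the value, are at most [n.+1%:R^-1] relative to [fn n]. *)
Lemma bochner_limit D (fn : nat -> X -> V) f (vn : nat -> V) v : measurable D ->
  (forall n, bochner_integral mu D (fn n) (vn n)) -> smeas D f ->
  (\int[mu]_(x in D) `|fn n x - f x|%:E)%E @[n --> \oo] --> 0%E ->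
  vn n @[n --> \oo] --> v -> bochner_integral mu D f v.
Proof.
move=> mD bfn mf fnf vnv; split => //.
have H n : exists e : seq (set X * V), [/\ forall a, a \in e ->
      measurable a.1 /\ (mu (a.1 `&` D) < +oo)%E,
    (\int[mu]_(x in D) `|fn n x - simple_fun e x|%:E <= n.+1%:R^-1%:E)%E &
    `|vn n - simple_int mu D e| <= n.+1%:R^-1].
  have [mfn [e [me ef ev]]] := bfn n.
  have I0 k : (0 <= \int[mu]_(x in D) `|fn n x - simple_fun (e k) x|%:E)%E.
    exact: integral_ge0.
  have n0 : 0 < n.+1%:R^-1 :> R by [].
  have [N HN] := (ge0_cvge0P I0).1 ef _ n0.
  have /cvgrPdist_le/(_ _ n0)[M _ HM] := ev.
  exists (e (maxn N M)); split; [exact: me|exact/HN/leq_maxl|].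
  exact: (HM _ (leq_maxr _ _)).
have [e he] := choice H.
have n1 : n.+1%:R^-1%:E @[n --> \oo] --> (0%E : \bar R).
  by apply: cvg_EFin; [near=> n|exact: cvg_harmonic].
exists e; split.
- by move=> n; have [+ _ _] := he n; exact.
- apply: (@squeeze_cvge0 _ _ (fun n => n.+1%:R^-1%:E +
      \int[mu]_(x in D) `|fn n x - f x|%:E)%E).
  + by move=> n; exact: integral_ge0.
  + move=> n; have [me en _] := he n; apply: le_trans (leeD2r _ en).
    have mfn : smeas D (fn n) by case: (bfn n).
    have me1 : msimple (e n) by move=> a /me[].
    rewrite -ge0_integralD//; last 2 first.
    * exact: measurable_normB.
    * by apply: smeas_normE; exact: smeasB.
    apply: le_integral_ge0 => // x Dx; rewrite -EFinD lee_fin [leRHS]addrC.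
    by rewrite (le_trans (ler_distD (fn n x) _ _))// distrC.
  + by rewrite -[X in _ --> X](adde0 0%E); apply: cvgeD.
- rewrite -[v]subr0.
  rewrite (_ : (fun _ => _) = (fun n => vn n - (vn n - simple_int mu D (e n)))).
    apply: cvgB => //; apply/cvgr0Pnorm_le => eps eps0.
    have [k _ Hk] := near_infty_natSinv_lt (PosNum eps0).
    exists k => // n /= /Hk kn; have [_ _] := he n => /le_trans; apply.
    exact: ltW.
  by apply/funext => n; rewrite subKr.
Unshelve. all: by end_near. Qed.
End bochner_theory.

(** * Convolution with a contraction semigroup *)

Section contraction_semigroups.
Context (R : realType) (V : normedModType R).
Variables (S : R -> V -> V).
Hypothesis HS : contraction_semigroup S.

Lemma semigroup_linear t : 0 <= t -> linear (S t).
Proof. by case: HS => + _ _ _ _; exact. Qed.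

Lemma semigroup_norm t x : 0 <= t -> `|S t x| <= `|x|.
Proof. by case: HS => _ _ _ + _; exact. Qed.

Lemma semigroup_add s t x : 0 <= s -> 0 <= t -> S (s + t) x = S s (S t x).
Proof. by case: HS => _ _ + _ _; exact. Qed.

Lemma semigroupB t x y : 0 <= t -> S t (x - y) = S t x - S t y.
Proof.
move=> t0; pose HH := GRing.isLinear.Build _ _ _ _ (S t) (semigroup_linear t0).
pose L : {linear V -> V} := HB.pack (S t) HH.
by rewrite -[S t]/(L : V -> V) linearB.
Qed.

Lemma semigroupD t x y : 0 <= t -> S t (x + y) = S t x + S t y.
Proof.
move=> t0; pose HH := GRing.isLinear.Build _ _ _ _ (S t) (semigroup_linear t0).
pose L : {linear V -> V} := HB.pack (S t) HH.
by rewrite -[S t]/(L : V -> V) linearD.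
Qed.

Lemma semigroup0 t : 0 <= t -> S t 0 = 0.
Proof. by move=> t0; rewrite -[X in S t X](subrr (0 : V)) semigroupB// subrr. Qed.

Lemma semigroupZ t a x : 0 <= t -> S t (a *: x) = a *: S t x.
Proof.
by move=> t0; rewrite -[a *: x]addr0 (semigroup_linear t0) semigroup0// addr0.
Qed.

Lemma semigroup_small x (eps : R) : 0 < eps -> exists2 del : R, 0 < del &
  forall r, 0 <= r < del -> `|S r x - x| < eps.
Proof.
move=> eps0; have [_ S0 _ _ Sx] := HS.
have /cvgrPdist_lt/(_ _ eps0) := Sx x.
rewrite nearE/= => /nbhs_ballP[del /= del0 Hdel]; exists del => // r.
move=> /andP[]; rewrite le_eqVlt => /orP[/eqP <- _|r0 rdel].
  by rewrite S0 subrr normr0.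
by rewrite distrC; apply: (Hdel r) => //; rewrite /ball/= sub0r normrN gtr0_norm.
Qed.

Lemma semigroup_diff s t x : 0 <= s <= t -> `|S t x - S s x| <= `|S (t - s) x - x|.
Proof.
move=> /andP[s0 st]; have ts : 0 <= t - s by rewrite subr_ge0.
have -> : S t x = S s (S (t - s) x) by rewrite -semigroup_add// addrC subrK.
by rewrite -semigroupB//; exact: semigroup_norm.
Qed.

Lemma semigroup_continuous t : 0 <= t -> continuous (S t).
Proof.
move=> t0; apply: (@lipschitz_continuous _ _ _ _ 1) => // x y.
by rewrite mul1r -semigroupB//; exact: semigroup_norm.
Qed.

Lemma semigroup_orbit_continuous x T : {within `[0, T], continuous (fun t => S t x)}.
Proof.
apply/within_continuous_dist => t /andP[t0 tT] eps eps0.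
have [del del0 Hdel] := semigroup_small x eps0; exists del => // s /andP[s0 sT] st.
wlog : s t s0 sT t0 tT st / s <= t => [wl|le_st].
  have [|/ltW] := leP s t; first exact: wl.
  by move=> ts; rewrite distrC; apply: wl => //; rewrite distrC.
rewrite distrC; apply: le_lt_trans (semigroup_diff _ _) _; first by rewrite s0.
by apply: Hdel; rewrite subr_ge0 le_st/= -(ger0_norm (x := t - s)) ?subr_ge0// distrC.
Qed.

Local Notation leb := (@lebesgue_measure R).

Lemma lebesgue_itv_lty (i : interval R) (a b : R) :
  [set` i] `<=` `[a, b] -> (leb [set` i] < +oo)%E.
Proof.
move=> iab; apply: (@le_lt_trans _ _ (leb `[a, b])).
  by apply: le_measure => //; rewrite inE; exact: measurable_itv.
by rewrite lebesgue_measure_itv/=; case: ifPn => _; rewrite -?EFinB ltry.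
Qed.

(** For s <= t' the integrand [S (t - s) (h s)] is [S (t - t')] applied to the integrand at time t',
    so that subtracting [S (t - t') v'] removes the past exactly and only the integral over []t',
    t]] is left. *)
Lemma conv_increment (h : R -> V) (t' t : R) (v v' c : V) :
  0 <= t' <= t -> conv S h t v -> conv S h t' v' ->
  (`|v - S (t - t') v' - (t - t') *: c|%:E <=
    \int[leb]_(s in `]t', t]) `|S (t - s) (h s) - c|%:E)%E.
Proof.
move=> /andP[t'0 t't] cv cv'.
have ts : 0 <= t - t' by rewrite subr_ge0.
have mI (i : interval R) : measurable ([set` i] : set (measurableTypeR R)).
  exact: measurable_itv.
have sub1 : `[0, t'] `<=` `[0, t].
  by move=> s /=; rewrite !in_itv/= => /andP[-> /le_trans]; apply.
have sub2 : `]t', t] `<=` `[0, t].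
  by move=> s /=; rewrite !in_itv/= => /andP[/ltW/(le_trans t'0) -> ->].
have leb_t : (leb `[0%R, t] < +oo)%E by exact: (@lebesgue_itv_lty _ 0 t).
(* Both corrections are extended by zero to [[0, t]], in order to apply [bochner_norm] to a single
   integral whose integrand vanishes on [[0, t']]. *)
have b1 := bochner_extend (mI _) (mI _) sub1
  (bochner_linear (semigroup_linear ts) (fun x => semigroup_norm x ts) cv').
have b2 := bochner_extend (mI _) (mI _) sub2
  (@bochner_cst _ _ _ _ leb `]t', t] c (mI _) (lebesgue_itv_lty sub2)).
have b := bochnerB (mI _) (bochnerB (mI _) cv b1) b2.
have := bochner_norm (mI _) leb_t b.
have -> : fine (leb `]t', t]) = t - t'.
  rewrite lebesgue_measure_itv/= lte_fin; case: ltP => [_|tt'].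
    by rewrite -EFinB.
  by apply/esym/eqP; rewrite subr_eq0 eq_le tt'.
move=> /le_trans; apply.
rewrite -[in leRHS](setIidr sub2) integral_mkcondr.
apply: le_integral_ge0 => // s st; rewrite patchE !indicE.
have /andP[s0 s_t] : 0 <= s <= t by move: st; rewrite /= in_itv.
case: (leP s t') => st'.
  rewrite mem_set/=; last by rewrite in_itv/= s0.
  rewrite memNset/=; last by rewrite in_itv/= ltNge st'.
  rewrite scale1r scale0r subr0 -semigroup_add ?subr_ge0//.
  by rewrite addrA subrK subrr normr0.
rewrite memNset/=; last by rewrite in_itv/= s0 leNgt st'.
rewrite mem_set/=; last by rewrite in_itv/= st'.
by rewrite scale1r scale0r subr0.
Qed.

Lemma conv0 (h : R -> V) (v : V) : conv S h 0 v -> v = 0.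
Proof.
move=> cv.
have m0 : measurable (`[0, 0]%classic : set (measurableTypeR R)).
  exact: measurable_itv.
have := bochner_norm m0 (@lebesgue_itv_lty _ 0 0 (@subset_refl _ _)) cv.
rewrite set_itv1 integral_set1 lee_fin normr_le0.
by move/eqP.
Qed.

Lemma cvge_eventually_le (u : nat -> \bar R) (a e : R) : 0 < e ->
  u n @[n --> \oo] --> a%:E ->
  exists N, forall n, (N <= n)%N -> (u n <= (a + e)%:E)%E.
Proof.
move=> e0 /fine_cvgP[[N _ fu] /cvgrPdist_le/(_ _ e0)[M _ HM]].
exists (maxn N M) => n; rewrite geq_max => /andP[Nn Mn].
rewrite -[leLHS](fineK (fu _ Nn)) lee_fin -lerBlDl.
by apply: le_trans (ler_norm _) _; rewrite distrC; exact: (HM _ Mn).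
Qed.

(** The intervals to the left of t shrink nicely to t: each is contained in the ball of the same
    radius and has half its length, whence the constant 2. *)
Lemma lebesgue_pt_left (phi : R -> R) :
  locally_integrable setT phi ->
  {ae leb, forall t,
    (n.+1%:R%:E * \int[leb]_(s in `](t - n.+1%:R^-1)%R, t]) (phi s)%:E)%E
      @[n --> \oo] --> (phi t)%:E}.
Proof.
move=> lphi; have := lebesgue_differentiation lphi; apply: ae_lebesgueS => t.
pose E (x : R) (n : nat) := `](x - n.+1%:R^-1), x]%classic : set R.
have lebE x n : leb (E x n) = (n.+1%:R^-1)%:E.
  rewrite /E lebesgue_measure_itv/= lte_fin ltrBlDr ltrDl invr_gt0 ltr0n.
  by rewrite -EFinB subKr.
have nE x : nicely_shrinking x (E x).
  split; first by move=> n; exact: measurable_itv.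
  exists (2, fun n => PosNum (@harmonic_gt0 R n)); split => //=.
  - exact: cvg_harmonic.
  - move=> n y; rewrite /E/= in_itv/= /ball/= => /andP[xy yx].
    by rewrite ger0_norm ?subr_ge0// ltrBlDl -ltrBlDr.
  - move=> n; rewrite lebE lebesgue_measure_ball// -EFinM mulr_natl.
    by rewrite /harmonic.
move=> /(nice_lebesgue_differentiation nE lphi).
apply: cvg_trans; apply: near_eq_cvg; near=> n.
by rewrite lebE inver invr_eq0 pnatr_eq0/= invrK.
Unshelve. all: by end_near. Qed.

(** At almost every t all the real functions [|h - v k|], for [v] dense in the range of [h], have a
    Lebesgue point. Inserting a [v k] close to [h t] bounds [S (t - s) (h s) - h t] by
    [|h s - v k|], the oscillation of the orbit of [v k] and [|v k - h t|]; then [conv_increment]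
    applies with the constant [h t]. *)
Lemma conv_derivative (T : R) (h y : R -> V) :
  smeasI T h ->
  (\int[leb]_(t in `[0%R, T]) `|h t|%:E < +oo)%E ->
  (forall t, 0 <= t <= T -> conv S h t (y t)) ->
  {ae leb, forall t, 0 < t <= T ->
    n.+1%:R *: (y t - S n.+1%:R^-1 (y (Num.max 0 (t - n.+1%:R^-1))))
      @[n --> \oo] --> h t}.
Proof.
move=> mh ih cy; have [v hv] := smeas_dense mh.
have mT : measurable (`[0, T]%classic : set (measurableTypeR R)).
  exact: measurable_itv.
pose phi k := (fun s => `|h s - v k|) \_ `[0, T].
have lphi k : locally_integrable setT (phi k).
  apply: integrable_locally_restrict => //; apply/integrableP; split.
    by apply: smeas_normE; apply: smeasB => //; exact: smeas_cst.
  apply: (@le_lt_trans _ _ (\int[leb]_(t in `[0%R, T]) (`|h t|%:E + `|v k|%:E))%E).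
    apply: le_integral_ge0 => // s _; rewrite /= normr_id -EFinD lee_fin.
    exact: ler_normB.
  rewrite ge0_integralD//; last by exact: smeas_normE.
  rewrite lte_add_pinfty// integral_cst// lte_mul_pinfty//.
  exact: (@lebesgue_itv_lty _ 0 T).
have : {ae leb, forall t, forall k,
    (n.+1%:R%:E * \int[leb]_(s in `](t - n.+1%:R^-1)%R, t]) (phi k s)%:E)%E
      @[n --> \oo] --> (phi k t)%:E}.
  by apply: ae_foralln => k; exact: lebesgue_pt_left.
apply: ae_lebesgueS => t Ht /andP[t0 tT].
have tT' : `[0, T]%classic t by rewrite /= in_itv/= tT ltW.
apply/cvgrPdist_le => eps eps0.
(* Two quarters bound the mean of [|h - v k|] near t, one the orbit of [v k], and one the distance
   from [v k] to [h t]. *)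
have e0 : 0 < eps / 4 by rewrite divr_gt0.
have [k hk] := hv t tT' _ e0.
have [del del0 Hdel] := semigroup_small (v k) e0.
have [N HN] := cvge_eventually_le e0 (Ht k).
have [M _ HM] := near_infty_natSinv_lt (PosNum del0).
have [M' _ HM'] := near_infty_natSinv_lt (PosNum t0).
exists (maxn N (maxn M M')) => // n /=; rewrite !geq_max => /and3P[Nn Mn M'n].
set r := n.+1%:R^-1.
have r0 : 0 < r by rewrite invr_gt0.
have rn : n.+1%:R = r^-1 by rewrite invrK.
have rdel : r < del by exact: (HM _ Mn).
have rt : r < t by exact: (HM' _ M'n).
have -> : Num.max 0 (t - r) = t - r by apply/max_idPr; rewrite subr_ge0 ltW.
have tr0 : 0 <= t - r by rewrite subr_ge0 ltW.
have tr_t : t - r <= t by rewrite gerBl ltW.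
have ctr : conv S h (t - r) (y (t - r)).
  by apply: cy; rewrite tr0 (le_trans tr_t tT).
have ct : conv S h t (y t) by apply: cy; rewrite ltW.
have := @conv_increment h (t - r) t _ _ (h t) _ ct ctr.
rewrite tr0 tr_t subKr => /(_ isT) inc.
rewrite distrC.
have -> : n.+1%:R *: (y t - S r (y (t - r))) - h t =
    r^-1 *: (y t - S r (y (t - r)) - r *: h t).
  by rewrite [RHS]scalerBr scalerA mulVf ?gt_eqF// scale1r rn.
rewrite normrZ gtr0_norm ?invr_gt0// -lee_fin EFinM.
have rE0 : (0 <= r^-1%:E)%E by rewrite lee_fin invr_ge0 ltW.
apply: le_trans (lee_wpmul2l rE0 inc) _.
have sub : `](t - r), t] `<=` `[0, T].
  move=> s /=; rewrite !in_itv/= => /andP[trs st].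
  by rewrite (le_trans st tT) ltW// (le_lt_trans tr0 trs).
have mtr : measurable (`](t - r), t]%classic : set (measurableTypeR R)).
  exact: measurable_itv.
have mphi : measurable_fun `](t - r), t] (fun s => (phi k s)%:E).
  by apply/measurable_EFinP; case: (lphi k) => + _ _; exact: measurable_funTS.
have phi0 s : (0 <= (phi k s)%:E)%E by rewrite lee_fin /phi patchE; case: ifPn.
have : (\int[leb]_(s in `](t - r)%R, t]) `|S (t - s) (h s) - h t|%:E <=
   \int[leb]_(s in `](t - r)%R, t]) ((phi k s)%:E + (eps / 2)%:E))%E.
  apply: le_integral_ge0 => // s str; rewrite -EFinD lee_fin /phi patchE.
  rewrite mem_set; last exact: sub.
  move: str; rewrite /= in_itv/= => /andP[trs st].
  have ts0 : 0 <= t - s by rewrite subr_ge0.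
  have -> : S (t - s) (h s) - h t = S (t - s) (h s - v k) +
      ((S (t - s) (v k) - v k) + (v k - h t)).
    by rewrite semigroupB// !subrKA.
  apply: le_trans (ler_normD _ _) _; apply: lerD; first exact: semigroup_norm.
  apply: le_trans (ler_normD _ _) _; rewrite [leRHS](_ : _ = eps / 4 + eps / 4); last by field.
  apply: lerD; last by rewrite distrC ltW.
  by apply/ltW/Hdel; rewrite ts0/= (lt_trans _ rdel)// ltrBlDl -ltrBlDr.
move=> /(lee_wpmul2l rE0) => /le_trans; apply.
rewrite ge0_integralD//; last by rewrite lee_fin divr_ge0// ltW.
have lebtr : leb `](t - r)%R, t] = r%:E.
  by rewrite lebesgue_measure_itv/= lte_fin ltrBlDr ltrDl r0 -EFinB subKr.
rewrite integral_cst// [X in ((eps / 2)%:E * X)%E]lebtr ge0_muleDr//; last 2 first.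
- exact: integral_ge0.
- by rewrite mule_ge0// lee_fin ?divr_ge0// ltW.
rewrite -!EFinM mulrCA mulVf ?gt_eqF// mulr1.
have := HN _ Nn; rewrite -/r rn => /(leeD2r (eps / 2)%:E) /le_trans; apply.
rewrite -EFinD lee_fin /phi patchE mem_set//.
by move: hk; lra.
Qed.

End contraction_semigroups.

(** * Lower limits and integrals of increments *)

Lemma limn_einf_ge (R : realType) (u : nat -> \bar R) (l : R) :
  (forall eps : R, 0 < eps -> exists N, forall n, (N <= n)%N ->
    ((l - eps)%:E <= u n)%E) -> (l%:E <= limn_einf u)%E.
Proof.
move=> Hu; apply/lee_addgt0Pr => eps eps0; rewrite -leeBlDr// -EFinB.
have [N HN] := Hu _ eps0; rewrite limn_einf_lim.
have /cvg_lim -> // := ereal_nondecreasing_cvgn (nondecreasing_einfs u).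
apply: (@le_trans _ _ (einfs u N)); last by apply: ereal_sup_ubound; exists N.
by apply: le_ereal_inf_tmp => _ [n /= Nn <-]; exact: HN.
Qed.

Lemma limn_einf_le (R : realType) (u : nat -> \bar R) (c : \bar R) :
  (exists N, forall n, (N <= n)%N -> (u n <= c)%E) -> (limn_einf u <= c)%E.
Proof.
move=> [N HN]; rewrite limn_einf_lim.
have /cvg_lim -> // := ereal_nondecreasing_cvgn (nondecreasing_einfs u).
apply: ge_ereal_sup => _ [n _ <-]; apply: le_trans (HN (maxn n N) (leq_maxr _ _)).
by apply: ereal_inf_lbound; exists (maxn n N) => //=; exact: leq_maxl.
Qed.

Lemma measurable_limn_einf d (X : measurableType d) (R : realType) (D : set X)
    (F : nat -> X -> \bar R) : (forall n, measurable_fun D (F n)) ->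
  measurable_fun D (fun x => limn_einf (F ^~ x)).
Proof.
move=> mF; apply: (eq_measurable_fun (fun x => - limn_esup (fun n => - F n x))%E).
  by move=> x _; rewrite (limn_esupN (F ^~ x)) oppeK.
apply: measurableT_comp => //; apply: measurable_fun_limn_esup => n.
exact: (measurableT_comp (@oppe_measurable R setT) (mF n)).
Qed.

Section real_integrals.
Context (R : realType).
Local Notation leb := (@lebesgue_measure R).

Lemma lebesgue_measure_shift (r : R) (A : set R) : measurable A ->
  pushforward leb ((fun t => t - r) : _ -> measurableTypeR R) A = leb A.
Proof.
have mshift : measurable_fun setT ((fun t => t - r) : measurableTypeR R -> measurableTypeR R).
  by apply: measurable_funB => //; exact: measurable_cst.
move=> mA; apply/esym/lebesgue_measure_unique => //= _ [[a b]] _ <-.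
rewrite /pushforward.
rewrite (_ : _ @^-1` _ = `](a + r), (b + r)]%classic).
  rewrite !lebesgue_measure_itv/= !lte_fin ltrD2r.
  by case: ifP => // _; rewrite -!EFinB opprD addrACA subrr addr0.
by apply/seteqP; split=> x /=; rewrite !in_itv/= ltrBrDr lerBlDr.
Qed.

Lemma integral_shift (r a b : R) (f : R -> \bar R) :
  measurable_fun setT f -> (forall t, 0 <= f t)%E ->
  (\int[leb]_(t in `[(a + r)%R, (b + r)%R]) f (t - r)%R =
   \int[leb]_(t in `[a, b]) f t)%E.
Proof.
move=> mf f0.
have mshift : measurable_fun setT ((fun t => t - r) : measurableTypeR R -> measurableTypeR R).
  by apply: measurable_funB => //; exact: measurable_cst.
rewrite (_ : `[a + r, b + r]%classic =
    ((fun t => t - r) : _ -> measurableTypeR R) @^-1` `[a, b]); last first.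
  by apply/seteqP; split=> x /=; rewrite !in_itv/= lerBrDr lerBlDr.
rewrite -(ge0_integral_pushforward mshift leb)//=; last first.
  exact: measurable_funS mf.
by apply: eq_measure_integral => //= A mA AS; exact/lebesgue_measure_shift.
Qed.

(** By translation the integral telescopes to that of [M] over the last interval of length r minus
    that over [[- r, 0]], and monotonicity estimates both. *)
Lemma nondecreasing_increment_integral (M : R -> R) (b r : R) :
  {homo M : s t / s <= t} -> 0 < r -> r <= b ->
  (\int[leb]_(t in `[0%R, b]) (M t - M (t - r))%:E <=
   (r * (M b - M (- r)))%:E)%E.
Proof.
move=> Mnd r0 rb; have b0 : 0 < b by exact: lt_le_trans rb.
(* [N] is nonnegative and nondecreasing on the whole line and equals [M - M (- r)] on [[- r, b]],
   which is all that the integrals see. *)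
pose N t := Num.max 0 (Num.min (M t) (M b) - M (- r)).
have NE t : `[(- r), b]%classic t -> N t = M t - M (- r).
  rewrite /= in_itv/= => /andP[rt tb]; rewrite /N (min_idPl (Mnd _ _ tb)).
  by apply/max_idPr; rewrite subr_ge0; exact: Mnd.
have N0 t : 0 <= N t by rewrite le_max lexx.
have Nnd : {homo N : s t / s <= t}.
  move=> s t st; rewrite /N ge_max le_max lexx/= le_max lerD2r; apply/orP; right.
  by rewrite le_min !ge_min lexx orbT andbT Mnd.
have mN : measurable_fun setT (fun t => (N t)%:E).
  by apply/measurable_EFinP; exact: nondecreasing_measurable.
have mI (i : interval R) : measurable ([set` i] : set (measurableTypeR R)).
  exact: measurable_itv.
have Nb : (\int[leb]_(t in `[0%R, (b - r)%R]) (N t)%:E <= (b * N b)%:E)%E.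
  apply: (@le_trans _ _ (\int[leb]_(t in `[0%R, (b - r)%R]) (N b)%:E)%E).
    apply: le_integral_ge0 => [t _|t /=]; first by rewrite lee_fin.
    rewrite in_itv/= => /andP[_ tb]; rewrite lee_fin; apply: Nnd.
    by rewrite (le_trans tb)// gerBl ltW.
  rewrite integral_cst// [X in (_ * X)%E]lebesgue_measure_itv/= lte_fin.
  case: ltP => [_|_]; last by rewrite mule0 lee_fin mulr_ge0// ltW.
  by rewrite -EFinM lee_fin mulrC ler_wpM2r// subr0 gerBl ltW.
have Nfin : (\int[leb]_(t in `[0%R, (b - r)%R]) (N t)%:E \is a fin_num)%E.
  rewrite ge0_fin_numE; first by rewrite (le_lt_trans Nb)// ltry.
  by apply: integral_ge0 => t _; rewrite lee_fin.
have -> : (\int[leb]_(t in `[0%R, b]) (M t - M (t - r))%:E =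
    \int[leb]_(t in `[0%R, b]) (N t - N (t - r))%:E)%E.
  apply: eq_integral => t /set_mem /=; rewrite in_itv/= => /andP[t0 tb].
  rewrite !NE/= ?in_itv/= ?tb ?(le_trans _ t0) ?oppr_le0 ?(ltW r0)//.
    by rewrite opprB addrA subrK.
  by rewrite lerNl opprB gerBl t0/= (le_trans _ tb)// gerBl ltW.
(* The finite integral of [N] over [[0, b - r]] is added on both sides, which replaces a difference
   of integrals by sums of nonnegative ones. *)
rewrite -(leeD2rE _ _ Nfin).
apply: (@le_trans _ _ (\int[leb]_(t in `[0%R, b]) (N t)%:E)%E).
  apply: (@le_trans _ _ (\int[leb]_(t in `[0%R, b]) (N t - N (t - r))%:E +
      \int[leb]_(t in `[0%R, b]) (N (t - r))%:E)%E).
    apply: leeD2l.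
    have N0E t : (0 <= (N t)%:E)%E by rewrite lee_fin.
    have /= := integral_shift r (0 - r) (b - r) mN N0E; rewrite !subrK => ->.
    apply: ge0_subset_integral => //.
    - exact: measurable_funTS.
    - move=> t /=; rewrite !in_itv/= => /andP[t0 ->]; rewrite andbT.
      by rewrite (le_trans _ t0)// sub0r oppr_le0 ltW.
  rewrite -ge0_integralD//.
  - by apply: le_integral_ge0 => t _; rewrite -EFinD lee_fin subrK.
  - by move=> t _; rewrite lee_fin subr_ge0; apply: Nnd; rewrite gerBl ltW.
  - apply/measurable_EFinP; apply: measurable_funB; apply: nondecreasing_measurable => //.
    by move=> s t st; apply: Nnd; rewrite lerD2r.
  - by move=> t _; rewrite lee_fin.
  - apply/measurable_EFinP; apply: nondecreasing_measurable => //.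
    by move=> s t st; apply: Nnd; rewrite lerD2r.
rewrite (_ : `[0, b]%classic = `[0, b - r] `|` `](b - r), b]); last first.
  apply/seteqP; split=> t /=; rewrite !in_itv/=.
    by move=> /andP[-> ->]/=; rewrite andbT; case: leP; [left|right].
  by move=> [/andP[-> /le_trans]|/andP[brt ->]]; [apply; rewrite gerBl ltW|rewrite ltW// (le_lt_trans _ brt)// subr_ge0].
rewrite ge0_integral_setU//; last 3 first.
- exact: measurable_funTS.
- by move=> t _; rewrite lee_fin.
- by apply/disj_setPS => t /=; rewrite !in_itv/= => -[/andP[_ tb] /andP[+ _]]; rewrite ltNge tb.
rewrite addeC leeD2r//.
apply: (@le_trans _ _ (\int[leb]_(t in `](b - r)%R, b]) (N b)%:E)%E).
  apply: le_integral_ge0 => [t _|t /=]; first by rewrite lee_fin.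
  by rewrite in_itv/= => /andP[_ tb]; rewrite lee_fin; exact: Nnd.
rewrite integral_cst// [X in (_ * X)%E]lebesgue_measure_itv/= lte_fin ltrBlDr ltrDl r0.
rewrite -EFinB subKr -EFinM lee_fin mulrC; apply: ler_wpM2l; first exact: ltW.
rewrite NE// /= in_itv/= lexx andbT.
by rewrite (le_trans _ (ltW b0))// oppr_le0 ltW.
Qed.

End real_integrals.

Lemma cvge_eventually_ge (R : realType) (u : nat -> \bar R) (a e : R) : 0 < e ->
  u n @[n --> \oo] --> a%:E ->
  exists N, forall n, (N <= n)%N -> ((a - e)%:E <= u n)%E.
Proof.
move=> e0 /fine_cvgP[[N _ fu] /cvgrPdist_le/(_ _ e0)[M _ HM]].
exists (maxn N M) => n; rewrite geq_max => /andP[Nn Mn].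
rewrite -[leRHS](fineK (fu _ Nn)) lee_fin lerBlDl -lerBlDr.
by apply: le_trans (ler_norm _) _; exact: (HM _ Mn).
Qed.

(** * A comparison principle for convolutions with a contraction semigroup *)

Section comparison.
Context (R : realType) (V : normedModType R).
Variables (S : R -> V -> V) (HS : contraction_semigroup S).
Local Notation leb := (@lebesgue_measure R).

Lemma conv_increment_norm (h : R -> V) (t' t : R) (v v' : V) :
  0 <= t' <= t -> conv S h t v -> conv S h t' v' ->
  (`|v - S (t - t') v'|%:E <= \int[leb]_(s in `]t', t]) `|h s|%:E)%E.
Proof.
move=> tt' cv cv'; have := conv_increment HS 0 tt' cv cv'.
rewrite scaler0 subr0 => /le_trans; apply.
apply: le_integral_ge0 => // s /=; rewrite in_itv/= => /andP[_ st].
by rewrite subr0 lee_fin (semigroup_norm HS)// subr_ge0.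
Qed.

(* The function [int_0^t |h| - Psi (- y t)] is nondecreasing; the claim is
   Fatou's lemma for its difference quotients. *)
Lemma conv_comparison (T : R) (h y : R -> V) (Psi : V -> R) (k : R -> \bar R) :
  smeasI T h ->
  (\int[leb]_(t in `[0%R, T]) `|h t|%:E < +oo)%E ->
  (forall t, 0 <= t <= T -> conv S h t (y t)) ->
  Psi 0 = 0 -> (forall u v, Psi u <= Psi v + `|u - v|) ->
  (forall t v, 0 <= t -> Psi (S t v) <= Psi v) ->
  (forall t, 0 <= k t)%E ->
  measurable_fun (`[0, T] : set (measurableTypeR R)) k ->
  {ae leb, forall t, 0 < t <= T -> forall eps : R, 0 < eps ->
    ((Psi (- y t))%:E <= (Psi (- y t + eps *: h t))%:E + eps%:E * k t)%E} ->
  forall b, 0 <= b <= T -> ((Psi (- y b))%:E <= \int[leb]_(t in `[0%R, b]) k t)%E.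
Proof.
move=> mh ih cy Psi0 PsiL PsiS k0 mk hk b /andP[].
have y0 : 0 <= T -> y 0 = 0.
  by move=> T0; apply: (@conv0 _ _ S h); apply: cy; rewrite lexx.
rewrite le_eqVlt => /orP[/eqP <- bT|b0 bT].
  by rewrite y0// oppr0 Psi0 integral_ge0.
have T0 : 0 < T by exact: lt_le_trans bT.
have mI (i : interval R) : measurable ([set` i] : set (measurableTypeR R)).
  exact: measurable_itv.
have mnh : measurable_fun (`[0, T] : set (measurableTypeR R)) (fun t => `|h t|%:E).
  exact: smeas_normE.
have subT (i : interval R) : [set` i] `<=` `[0, T] ->
    measurable_fun ([set` i] : set (measurableTypeR R)) (fun t => `|h t|%:E).
  by move=> iT; exact: measurable_funS mnh.
have ihS (i : interval R) : [set` i] `<=` `[0, T] ->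
    (\int[leb]_(t in [set` i]) `|h t|%:E \is a fin_num)%E.
  move=> iT; rewrite ge0_fin_numE; last exact: integral_ge0.
  by apply: le_lt_trans ih; exact: ge0_subset_integral.
have s0T t : t <= T -> `[0, t] `<=` `[0, T].
  by move=> tT s /=; rewrite !in_itv/= => /andP[-> /le_trans]; apply.
pose H t := fine (\int[leb]_(s in `[0%R, t]) `|h s|%:E).
have HE t : t <= T -> (H t)%:E = (\int[leb]_(s in `[0%R, t]) `|h s|%:E)%E.
  by move=> tT; rewrite fineK//; apply: ihS; exact: s0T.
have HI s t : 0 <= s <= t -> t <= T ->
    (\int[leb]_(r in `]s, t]) `|h r|%:E)%E = (H t - H s)%:E.
  move=> /andP[s0 st] tT.
  have st_sub : `]s, t] `<=` `[0, T].
    move=> r /=; rewrite !in_itv/= => /andP[sr rt].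
    by rewrite ltW ?(le_lt_trans s0)// (le_trans rt).
  rewrite EFinB !HE//; last exact: le_trans tT.
  rewrite (_ : `[0, t]%classic = `[0, s] `|` `]s, t]); last first.
    apply/seteqP; split=> r /=; rewrite !in_itv/=.
      by move=> /andP[-> ->]/=; rewrite andbT; case: leP; [left|right].
    by move=> [/andP[-> /le_trans]|/andP[sr ->]]; [apply|rewrite ltW// (le_lt_trans s0)].
  rewrite ge0_integral_setU//; last 2 first.
  - by apply: (measurable_funS _ _ mnh) => // r [/(s0T _ (le_trans st tT))|/st_sub].
  - by apply/disj_setPS => r /=; rewrite !in_itv/= => -[/andP[_ rs] /andP[+ _]]; rewrite ltNge rs.
  by rewrite [X in (_ = X - _)%E]addeC addeK//; apply: ihS; apply: s0T; exact: le_trans tT.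
pose m t := H t - Psi (- y t).
have yinc s t : 0 <= s <= t -> t <= T -> Psi (- y t) - Psi (- y s) <= H t - H s.
  move=> st tT; have /andP[s0 s_t] := st; rewrite lerBlDl.
  have ts0 : 0 <= t - s by rewrite subr_ge0.
  apply: le_trans (PsiL _ (S (t - s) (- y s))) _; apply: lerD; first exact: PsiS.
  rewrite -lee_fin -HI// -[- y s]sub0r semigroupB// semigroup0// sub0r opprK [X in `|X|]addrC distrC.
  apply: conv_increment_norm => //; apply: cy; first by rewrite (le_trans s0).
  by rewrite s0 (le_trans s_t).
(* Freezing [m] outside [[0, b]] gives a function that is nondecreasing on the whole line and zero
   on the left, as [m 0 = 0]. *)
pose M t := m (Num.max 0 (Num.min t b)).
have Mb0 t : 0 <= Num.max 0 (Num.min t b) <= b.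
  by rewrite le_max lexx/= ge_max (ltW b0)/= ge_min lexx orbT.
have Mnd : {homo M : s t / s <= t}.
  move=> s t st; rewrite /M; have /andP[t0 tb] := Mb0 t; have /andP[s0 _] := Mb0 s.
  have st' : Num.max 0 (Num.min s b) <= Num.max 0 (Num.min t b).
    rewrite ge_max le_max lexx/= le_max; apply/orP; right.
    by rewrite le_min !ge_min lexx orbT andbT st.
  rewrite /m lerBrDr -addrA -lerBrDl.
  have := yinc _ _ _ (le_trans tb bT); move=> /(_ (Num.max 0 (Num.min s b))).
  by rewrite s0 st' => /(_ isT); lra.
have ME t : 0 <= t <= b -> M t = m t.
  by move=> /andP[t0 tb]; rewrite /M (min_idPl tb) (max_idPr t0).
have M0 t : t <= 0 -> M t = 0.
  move=> t0; rewrite /M (max_idPl _) ?ge_min ?t0// /m y0 ?ltW// oppr0 Psi0 subr0.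
  by rewrite /H set_itv1 integral_set1.
pose F n t : \bar R := (n.+1%:R * (M t - M (t - n.+1%:R^-1)))%:E.
have F0 n t : (0 <= F n t)%E.
  by rewrite lee_fin mulr_ge0// subr_ge0 Mnd// gerBl.
have mF n : measurable_fun setT (F n : measurableTypeR R -> \bar R).
  apply/measurable_EFinP; apply: measurable_funM => //; apply: measurable_funB.
    exact: nondecreasing_measurable.
  by apply: nondecreasing_measurable => // s t st; apply: Mnd; rewrite lerD2r.
have intF : (\int[leb]_(t in `[0%R, b]) limn_einf (F ^~ t) <= (M b)%:E)%E.
  apply: le_trans (fatou _ _ _ _) _ => //.
  - by move=> n; exact: measurable_funTS.
  - apply: limn_einf_le; have [N _ HN] := near_infty_natSinv_lt (PosNum b0).
    exists N => n /HN /= nb; rewrite /F.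
    under eq_integral do rewrite EFinM.
    rewrite ge0_integralZl//=.
    + have r0 : 0 < n.+1%:R^-1 :> R by [].
      have := nondecreasing_increment_integral Mnd r0 (ltW nb).
      rewrite (M0 (- _)) ?oppr_le0// subr0 => /(lee_wpmul2l (x := n.+1%:R%:E)).
      by rewrite lee_fin -EFinM mulrA mulfV// mul1r; apply.
    + apply/measurable_EFinP; apply: measurable_funB; apply: nondecreasing_measurable => //.
      by move=> s t st; apply: Mnd; rewrite lerD2r.
    + by move=> t _; rewrite lee_fin subr_ge0 Mnd// gerBl.
have mk' : measurable_fun (`[0, b] : set (measurableTypeR R)) k.
  by apply: measurable_funS mk => //; exact: s0T.
have mliminf : measurable_fun (`[0, b] : set (measurableTypeR R)) (fun t => limn_einf (F ^~ t)).
  by apply: measurable_limn_einf => n; exact: measurable_funTS.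
have liminf0 t : (0 <= limn_einf (F ^~ t))%E.
  apply: limn_einf_ge => eps eps0; exists 0%N => n _.
  by apply: le_trans (F0 n t); rewrite lee_fin sub0r oppr_le0 ltW.
(* At almost every t the quotients of [H] tend to [|h t|], while those of [Psi (- y t)] are
   asymptotically at most [k t]. Hence [|h t|] is at most the lower limit of the quotients of [M]
   plus [k t]. *)
have key : (\int[leb]_(t in `[0%R, b]) `|h t|%:E <=
    \int[leb]_(t in `[0%R, b]) (limn_einf (F ^~ t) + k t))%E.
  have hloc : locally_integrable setT ((fun t => `|h t|) \_ `[0, T]).
    apply: integrable_locally_restrict => //; apply/integrableP; split => //.
    by apply: le_lt_trans ih; apply: le_integral_ge0 => // t _; rewrite /= normr_id.
  apply: ae_ge0_le_integral => //.
  - by apply: subT; exact: s0T.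
  - by move=> t _; exact: adde_ge0.
  - exact: emeasurable_funD.
  have faeI := @filterI _ _ (ae_filter_ringOfSetsType leb).
  apply: (ae_lebesgueS _
    (faeI _ _ (faeI _ _ (ae_lebesgue_neq0 R) hk) (faeI _ _ (conv_derivative HS mh ih cy) (lebesgue_pt_left hloc)))).
  move=> t [[t_neq0' hkt] [dht pht]] /=; rewrite in_itv/= => /andP[t_ge0 tb].
  have t0 : 0 < t by rewrite lt_neqAle eq_sym t_ge0 andbT; apply/eqP.
  have tT : t <= T by exact: le_trans bT.
  have t0T : 0 < t <= T by rewrite t0.
  have /(_ t0T) {}hkt := hkt; have /(_ t0T) {}dht := dht.
  have := k0 t; case: (k t) hkt => [kt hkt _|_ _|_]; last 2 first.
  - by rewrite addey ?leey// gt_eqF// (lt_le_trans _ (liminf0 t)).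
  - by rewrite leNgt ltNye.
  rewrite -leeBlDr// -EFinB; apply: limn_einf_ge => eps eps0.
  have e0 : 0 < eps / 2 by rewrite divr_gt0.
  have [N1 HN1] := cvge_eventually_ge e0 pht.
  have /cvgrPdist_le/(_ _ e0)[N2 _ HN2] := dht.
  have [N3 _ HN3] := near_infty_natSinv_lt (PosNum t0).
  exists (maxn N1 (maxn N2 N3)) => // n; rewrite !geq_max => /and3P[n1 n2 n3].
  move: (HN1 _ n1) (HN2 _ n2) (HN3 _ n3) => /=; rewrite /F.
  set r := n.+1%:R^-1.
  have r0 : 0 < r by rewrite invr_gt0.
  have -> : n.+1%:R = r^-1 by rewrite invrK.
  move=> I1 I2 rt.
  have tr0 : 0 <= t - r by rewrite subr_ge0 ltW.
  have tr_t : t - r <= t by rewrite gerBl ltW.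
  have tr_b : t - r <= b by exact: le_trans tb.
  rewrite ME ?t_ge0// ME ?tr0//.
  have trt : 0 <= t - r <= t by rewrite tr0.
  move: I1; rewrite (_ : (\int[leb]_(s in _) _)%E = (H t - H (t - r))%:E); last first.
    rewrite -HI//; apply: eq_integral => s /set_mem/=; rewrite in_itv/= => /andP[trs st].
    by rewrite patchE mem_set//= in_itv/= (le_trans st tT) ltW// (le_lt_trans tr0).
  rewrite patchE mem_set/=; last by rewrite in_itv/= t_ge0.
  rewrite -EFinM !lee_fin => I1.
  have := hkt r r0; rewrite -EFinM -EFinD lee_fin => I3.
  (* By [conv_derivative], [- y t + r *: h t] is [S r (- y (t - r))] up to o(r), and [Psi] decreases
     along [S]. This turns the hypothesis on [k], taken with step r, into a bound on the quotient of
     [Psi]. *)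
  have I4 : Psi (- y t + r *: h t) <= Psi (- y (t - r)) + r * (eps / 2).
    apply: le_trans (PsiL _ (S r (- y (t - r)))) _; apply: lerD.
      by apply: PsiS; exact: ltW.
    move: I2; rewrite (max_idPr tr0) => I2.
    have -> : - y t + r *: h t - S r (- y (t - r)) =
        r *: (h t - r^-1 *: (y t - S r (y (t - r)))).
      rewrite -[- y (t - r)]sub0r (semigroupB HS) ?(ltW r0)// (semigroup0 HS) ?(ltW r0)//.
      rewrite scalerBr scalerA mulfV ?gt_eqF// scale1r sub0r opprK opprB.
      by rewrite -addrA addrC addrA.
    by rewrite normrZ gtr0_norm// ler_pM2l.
  rewrite /m.
  have -> : H t - Psi (- y t) - (H (t - r) - Psi (- y (t - r))) =
    (H t - H (t - r)) - (Psi (- y t) - Psi (- y (t - r))) by lra.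
  rewrite mulrBr.
  have : r^-1 * (Psi (- y t) - Psi (- y (t - r))) <= kt + eps / 2.
    by rewrite ler_pdivrMl// mulrDr; lra.
  lra.
(* Now [H b <= M b + int k] with [M b = H b - Psi (- y b)], and [H b] cancels. *)
move: key; rewrite -HE// ge0_integralD//.
move=> /le_trans/(_ (leeD2r _ intF)).
rewrite ME; last by rewrite lexx ltW.
have := @integral_ge0 _ _ _ leb `[0, b]%classic k (fun t _ => k0 t).
case: (\int[leb]_(t in _) k t)%E => [K _|_ _|].
- by rewrite -EFinD !lee_fin /m; lra.
- exact: leey.
- by rewrite leNgt ltNye.
Qed.

End comparison.

(** * The space L^1 *)

Lemma ae_summable d (Y : measurableType d) (R : realType) (nu : {measure set Y -> \bar R})
    (D : set Y) (q : nat -> Y -> \bar R) : measurable D ->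
  (forall n, measurable_fun D (q n)) -> (forall n x, 0 <= q n x)%E ->
  (\sum_(0 <= n <oo) \int[nu]_(x in D) q n x < +oo)%E ->
  [/\ measurable_fun D (fun x => \sum_(0 <= n <oo) q n x)%E,
      (\int[nu]_(x in D) \sum_(0 <= n <oo) q n x < +oo)%E
    & {ae nu, forall x, D x -> (\sum_(0 <= n <oo) q n x < +oo)%E}].
Proof.
move=> mD mq q0 sq; pose Q x := (\sum_(0 <= n <oo) q n x)%E.
have mQ : measurable_fun D Q.
  by apply: ge0_emeasurable_sum => [k x _ _|k _]; [exact: q0|exact: mq].
have Q0 x : (0 <= Q x)%E by apply: nneseries_ge0 => n _ _; exact: q0.
have iQ : (\int[nu]_(x in D) Q x < +oo)%E by rewrite integral_nneseries.
split => //; have /(integrable_ae mD) : nu.-integrable D Q.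
  apply/integrableP; split => //.
  by under eq_integral do rewrite gee0_abs//.
by apply: filterS => x /[apply]; rewrite ge0_fin_numE.
Qed.

Lemma dominating_subsequence (N : nat -> nat) : exists p : nat -> nat,
  [/\ forall k, (N k <= p k)%N, forall k, (p k < p k.+1)%N & forall k, (k <= p k)%N].
Proof.
pose p := fix p k := if k is k'.+1 then maxn (p k').+1 (N k) else N 0%N.
have pS k : (p k < p k.+1)%N by exact: leq_maxl.
exists p; split => // k; first by case: k => [|k] //=; exact: leq_maxr.
by elim: k => // k IH; exact: leq_ltn_trans (pS k).
Qed.

Lemma real_summable_cvg (R : realType) (a : nat -> R) :
  (\sum_(0 <= n <oo) (`|a n.+1 - a n|)%:E < +oo)%E -> cvgn a.
Proof.
move=> sa.
have bnd n : (\sum_(0 <= k < n) (`|a k.+1 - a k|)%:E <=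
    \sum_(0 <= n <oo) (`|a n.+1 - a n|)%:E)%E.
  by apply: nneseries_lim_ge => k _; rewrite lee_fin.
have sfin : (\sum_(0 <= n <oo) (`|a n.+1 - a n|)%:E \is a fin_num)%E.
  by rewrite ge0_fin_numE// nneseries_ge0.
have : cvgn (series (fun k => a k.+1 - a k)).
  apply: normed_cvg; apply: nondecreasing_is_cvgn.
    by apply: nondecreasing_series => n _ _ /=.
  exists (fine (\sum_(0 <= n <oo) (`|a n.+1 - a n|)%:E)%E) => _ [n _ <-].
  by rewrite -lee_fin fineK// /series/= -sumEFin; exact: bnd.
move=> cs; have -> : a = (fun n => a 0%N + series (fun k => a k.+1 - a k) n).
  by apply/funext => n; rewrite /series/= telescope_sumr// addrC subrK.
by apply: is_cvgD => //; exact: is_cvg_cst.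
Qed.

Section L1_theory.
Context d (X : measurableType d) (R : realType) (mu : {measure set X -> \bar R}).
Local Notation L1 := (L1 mu).

Lemma L1_measurable (u : L1) : measurable_fun setT (u : X -> R).
Proof. exact: measurable_funPT. Qed.

Lemma L1_norm (u : L1) : (`|u|)%:E = (\int[mu]_x `|u x|%:E)%E.
Proof.
have finu := @Lfunction_finite _ _ _ _ _ (lexx 1%E) (repr u).
rewrite -[`|u|]/(fine ('N[mu]_1[EFin \o u])%E) fineK; last first.
  by rewrite ge0_fin_numE ?Lnorm_ge0//; exact: finu.
by rewrite Lnorm1.
Qed.

Lemma L1_integrable (u : L1) : (\int[mu]_x `|u x|%:E < +oo)%E.
Proof. by rewrite -L1_norm ltry. Qed.

Lemma L1D (u v : L1) : {ae mu, forall x, (u + v : L1) x = u x + v x}.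
Proof. exact: (Lp_classE (repr u + repr v)). Qed.

Lemma L1N (u : L1) : {ae mu, forall x, (- u : L1) x = - u x}.
Proof. exact: (Lp_classE (- repr u)). Qed.

Lemma L1Z (a : R) (u : L1) : {ae mu, forall x, (a *: u : L1) x = a * u x}.
Proof. exact: (Lp_classE (a *: repr u)). Qed.

Lemma L10 : {ae mu, forall x, (0 : L1) x = 0}.
Proof. exact: (Lp_classE 0). Qed.

Lemma L1B (u v : L1) : {ae mu, forall x, (u - v : L1) x = u x - v x}.
Proof. by apply: filterS2 (L1D u (- v)) (L1N v) => x -> ->. Qed.

Definition L1_of (h : X -> R) : L1 := to_Lp mu (lexx 1%E) h.

Lemma L1_ofE (h : X -> R) : measurable_fun setT h ->
  (\int[mu]_x `|h x|%:E < +oo)%E -> {ae mu, forall x, L1_of h x = h x}.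
Proof.
move=> mh ih; rewrite /L1_of /to_Lp; case: pselect => [hL|].
  by apply: filterS (Lp_classE (Lfun_Sub (lexx 1%E) hL)) => x ->.
case; apply/andP; split; rewrite inE/=; first exact: mh.
by rewrite /finite_norm Lnorm1.
Qed.

Lemma ae_integral_eq (f g : X -> \bar R) :
  measurable_fun setT f -> measurable_fun setT g ->
  {ae mu, forall x, f x = g x} -> (\int[mu]_x f x = \int[mu]_x g x)%E.
Proof.
move=> mf mg fg; apply: ae_eq_integral => //.
by apply: filterS fg => x ->.
Qed.

Lemma L1_norm_ae (u : L1) (h : X -> R) : measurable_fun setT h ->
  {ae mu, forall x, u x = h x} -> (`|u|)%:E = (\int[mu]_x `|h x|%:E)%E.
Proof.
move=> mh uh; rewrite L1_norm; apply: ae_integral_eq.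
- by apply: measurable_absE; exact: L1_measurable.
- exact: measurable_absE.
- by apply: filterS uh => x ->.
Qed.

Lemma L1_normB (u v : L1) : (`|u - v|)%:E = (\int[mu]_x `|u x - v x|%:E)%E.
Proof.
apply: L1_norm_ae; last exact: L1B.
by apply: measurable_funB; exact: L1_measurable.
Qed.

Lemma L1_norm_le (u : L1) (h : X -> \bar R) : measurable_fun setT h ->
  {ae mu, forall x, `|u x|%:E <= h x}%E -> (`|u|%:E <= \int[mu]_x h x)%E.
Proof.
move=> mh uh; rewrite L1_norm.
have mu' := L1_measurable u.
(* On a null set [h] may be negative; its positive part has the same integral. *)
rewrite (_ : (\int[mu]_x h x = \int[mu]_x maxe 0 (h x))%E); last first.
  apply: ae_integral_eq => //; first exact: measurable_maxe.
  apply: filterS uh => x uh; rewrite max_r//.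
  by apply: le_trans uh; rewrite lee_fin.
apply: ae_ge0_le_integral => //.
- exact: measurable_absE.
- by move=> x _; rewrite le_max lexx.
- exact: measurable_maxe.
- by apply: filterS uh => x uh _; rewrite le_max uh orbT.
Qed.

(* Riesz-Fischer *)
Lemma L1_summable_cvg (u : nat -> L1) :
  (\sum_(0 <= n <oo) (`|u n.+1 - u n|)%:E < +oo)%E ->
  exists v : L1, u n @[n --> \oo] --> v /\
    {ae mu, forall x, u n x @[n --> \oo] --> v x}.
Proof.
move=> su.
pose g n x := (`|u n.+1 x - u n x|)%:E.
have mg n : measurable_fun setT (g n).
  by apply: measurable_absE; apply: measurable_funB; exact: L1_measurable.
pose G x := (\sum_(0 <= n <oo) g n x)%E.
have g0 n x : (0 <= g n x)%E by rewrite lee_fin.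
have [|mG intG Gfin] := @ae_summable _ _ _ mu setT g measurableT mg g0.
  rewrite (@eq_eseriesr _ _ (fun n => (`|u n.+1 - u n|)%:E) xpredT)// => n _.
  by rewrite L1_normB.
have G0 x : (0 <= G x)%E by apply: nneseries_ge0 => n _ _; exact: g0.
have cvgu : {ae mu, forall x, cvgn (fun n => u n x)}.
  apply: filterS Gfin => x /(_ I) Gx.
  exact: (@real_summable_cvg _ (fun n => u n x)).
(* Multiplication by the indicator of [A] makes the sequences converge at every point, so that the
   limit is measurable on the whole space. *)
pose A := [set x | (G x < +oo)%E].
have mA : measurable A.
  by rewrite -[A]setTI; exact: emeasurable_fun_infty_o.
pose v0 x := limn (fun n => (\1_A x : R) * u n x).
have cvgv0 x : (fun n => (\1_A x : R) * u n x) @ \oo --> v0 x.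
  rewrite /v0 indicE; case: (boolP (x \in A)) => /= [/set_mem Ax|_].
    under eq_fun do rewrite mul1r.
    exact: (@real_summable_cvg _ (fun n => u n x)).
  by under eq_fun do rewrite mul0r; exact: is_cvg_cst.
have mv0 : measurable_fun setT v0.
  apply: (@measurable_fun_cvg _ _ _ _ (fun n x => (\1_A x : R) * u n x)) => //.
  by move=> n; apply: measurable_funM; [exact: measurable_indic|exact: L1_measurable].
have cvgu0 : {ae mu, forall x, (fun n => u n x) @ \oo --> v0 x}.
  apply: filterS Gfin => x /(_ I) Gx.
  by have := cvgv0 x; rewrite indicE mem_set//; under eq_fun do rewrite mul1r.
have ig : mu.-integrable setT (fun x => `|u 0%N x|%:E + G x)%E.
  apply/integrableP; split.
    by apply: emeasurable_funD => //; apply: measurable_absE; exact: L1_measurable.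
  under eq_integral do rewrite gee0_abs ?adde_ge0//.
  rewrite ge0_integralD//; last by apply: measurable_absE; exact: L1_measurable.
  by rewrite lte_add_pinfty//; exact: L1_integrable.
have dom x n : (`|(u n x)%:E| <= `|u 0%N x|%:E + G x)%E.
  rewrite abse_EFin; apply: (@le_trans _ _ (`|u 0%N x|%:E + \sum_(0 <= k < n) g k x)%E).
    rewrite sumEFin -EFinD lee_fin -lerBlDl.
    rewrite (le_trans (lerB_dist _ _))// -(telescope_sumr (fun k => u k x))//.
    exact: ler_norm_sum.
  by apply: leeD2l; exact: nneseries_lim_ge.
have mu_n n : measurable_fun setT (EFin \o u n).
  by apply/measurable_EFinP; exact: L1_measurable.
have mv0E : measurable_fun setT (EFin \o v0) by exact/measurable_EFinP.
have cvguE : {ae mu, forall x, setT x ->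
    (fun n => (EFin \o u n) x) @ \oo --> (EFin \o v0) x}.
  by apply: filterS cvgu0 => x H _; apply: cvg_EFin => //; near=> n.
have domE : {ae mu, forall x n, setT x ->
    (`|(EFin \o u n) x| <= `|u 0%N x|%:E + G x)%E}.
  by apply: aeW => x n _; exact: dom.
have [iv0 cv0 _] := dominated_convergence measurableT mu_n mv0E cvguE ig domE.
have v0fin : (\int[mu]_x `|v0 x|%:E < +oo)%E by case/integrableP: iv0.
have v0E := L1_ofE mv0 v0fin.
exists (L1_of v0); split; last by apply: filterS2 v0E cvgu0 => x ->.
apply/cvgrPdist_le => eps eps0.
have I0 n : (0 <= \int[mu]_x `|(EFin \o u n) x - (EFin \o v0) x|)%E.
  exact: integral_ge0.
have [N HN] := (ge0_cvge0P I0).1 cv0 _ eps0.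
exists N => // n /= /HN; rewrite -lee_fin; apply: le_trans.
rewrite (@L1_norm_ae _ (fun x => v0 x - u n x)); last 2 first.
- by apply: measurable_funB; [exact: mv0|exact: L1_measurable].
- by apply: filterS2 (L1B (L1_of v0) (u n)) v0E => x -> ->.
apply: le_integral_ge0 => // x _.
by rewrite /= lee_fin distrC.
Unshelve. all: by end_near. Qed.

Lemma L1_complete (u : nat -> L1) : cauchy_seq u -> exists v : L1, u n @[n --> \oo] --> v.
Proof.
move=> cu.
have g0 k : 0 < 1 / (2 ^ (k + 1))%:R :> R by rewrite divr_gt0// ltr0n expn_gt0.
have H k : exists N, forall n m, (N <= n)%N -> (N <= m)%N ->
    `|u n - u m| < 1 / (2 ^ (k + 1))%:R.
  have e0 := divr_gt0 (g0 k) (ltr0n _ 2).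
  have [N HN] := cu _ e0; exists N => n m Nn Nm.
  rewrite (le_lt_trans (ler_distD (u N) _ _))// [ltRHS]splitr ltrD//; last exact: HN.
  by rewrite distrC; exact: HN.
have [N HN] := choice H.
have [p [pN pS kp]] := dominating_subsequence N.
have [|v [uv _]] := @L1_summable_cvg (u \o p).
  apply: (@le_lt_trans _ _ (\sum_(0 <= k <oo) (1 / (2 ^ (k + 1))%:R)%:E)%E).
    apply: lee_nneseries => [k _ _|k _]; first by rewrite lee_fin.
    rewrite lee_fin /=; apply/ltW/HN; last exact: pN.
    by apply: leq_trans (pN k) _; exact: ltnW.
  have /cvg_lim -> // := @cvg_geometric_eseries_half R 1 0.
  exact: ltry.
exists v; apply/cvgrPdist_lt => eps eps0.
have e20 : 0 < eps / 2 by rewrite divr_gt0.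
have e40 : 0 < eps / 2 / 2 by rewrite divr_gt0.
have [M HM] := cu _ e40.
have /cvgrPdist_lt/(_ _ e20)[K _ HK] := uv.
exists M => // n /= Mn.
pose q := p (maxn M K).
have Hq : `|v - u q| < eps / 2 by exact: (HK (maxn M K) (leq_maxr _ _)).
have Mq : (M <= q)%N by exact: leq_trans (leq_maxl M K) (kp _).
rewrite (le_lt_trans (ler_distD (u q) _ _))// [ltRHS]splitr ltrD//.
rewrite (le_lt_trans (ler_distD (u M) _ _))// [ltRHS]splitr ltrD//; last exact: HM.
by rewrite distrC; exact: HM.
Qed.

Lemma L1_nemytskiiE (phi : R -> R) (u : L1) (L : R) : (mu setT < +oo)%E ->
  (forall x y, `|phi x - phi y| <= L * `|x - y|) ->
  {ae mu, forall x, nemytskii phi u x = phi (u x)}.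
Proof.
move=> muT phiL.
have L0 : 0 <= L.
  by have := phiL 0 1; rewrite sub0r normrN normr1 mulr1; apply: le_trans.
have cphi : continuous phi by exact: (@lipschitz_continuous _ R^o R^o _ L).
apply: L1_ofE.
  by apply: measurableT_comp; [exact: continuous_measurable_fun|exact: L1_measurable].
apply: (@le_lt_trans _ _ (\int[mu]_x (`|phi 0|%:E + (L%:E * `|u x|%:E)))%E).
  apply: le_integral_ge0 => // x _; rewrite -EFinM -EFinD lee_fin -lerBlDl.
  by rewrite (le_trans (lerB_dist _ _))// (le_trans (phiL _ _))// subr0.
have mu1 := measurable_absE (L1_measurable u).
rewrite ge0_integralD//; last 2 first.
- by move=> x _; rewrite mule_ge0// lee_fin.
- exact: measurable_funeM.
rewrite integral_cst// ge0_integralZl// lte_add_pinfty// lte_mul_pinfty// ?lee_fin//.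
exact: L1_integrable.
Qed.

Lemma L1_nemytskii_lipschitz (phi : R -> R) (u v : L1) (L : R) : (mu setT < +oo)%E ->
  (forall x y, `|phi x - phi y| <= L * `|x - y|) ->
  `|nemytskii phi u - nemytskii phi v| <= L * `|u - v|.
Proof.
move=> muT phiL.
have L0 : 0 <= L.
  by have := phiL 0 1; rewrite sub0r normrN normr1 mulr1; apply: le_trans.
rewrite -lee_fin EFinM [in leRHS]L1_normB -ge0_integralZl//; last first.
  apply: measurable_absE; apply: measurable_funB; exact: L1_measurable.
apply: L1_norm_le.
  apply: measurable_funeM; apply: measurable_absE; apply: measurable_funB; exact: L1_measurable.
apply: filterS3 (L1B (nemytskii phi u) (nemytskii phi v)) (L1_nemytskiiE u muT phiL)
  (L1_nemytskiiE v muT phiL) => x -> -> ->.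
by rewrite -EFinM lee_fin.
Qed.

End L1_theory.

(** * The excess functional *)

Section excess.
Context d (X : measurableType d) (R : realType) (mu : {measure set X -> \bar R}).
Hypothesis muT : (mu setT < +oo)%E.
Variables (delta : R) (delta0 : 0 < delta).
Local Notation L1 := (L1 mu).

(* The distance, in L^1, from v to the ball of radius delta of L^oo. *)
Definition excess (v : L1) : R :=
  fine (\int[mu]_x (Num.max 0 (`|v x| - delta))%:E)%E.

Lemma measurable_excess (h : X -> R) : measurable_fun setT h ->
  measurable_fun setT (fun x => (Num.max 0 (`|h x| - delta))%:E).
Proof.
move=> mh; apply/measurable_EFinP; apply: measurable_maxr => //.
by apply: measurable_funB => //; exact: measurableT_comp.
Qed.

Lemma excess_ge0_real (x : R) : 0 <= Num.max 0 (`|x| - delta).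
Proof. by rewrite le_max lexx. Qed.

Lemma excessE (v : L1) :
  ((excess v)%:E = \int[mu]_x (Num.max 0 (`|v x| - delta))%:E)%E.
Proof.
rewrite fineK// ge0_fin_numE; last first.
  by apply: integral_ge0 => x _; rewrite lee_fin excess_ge0_real.
apply: le_lt_trans (L1_integrable v); apply: le_integral_ge0 => x _.
  by rewrite lee_fin excess_ge0_real.
by rewrite lee_fin ge_max normr_ge0/= gerBl ltW.
Qed.

Lemma excess0 (v : L1) : {ae mu, forall x, `|v x| <= delta} -> excess v = 0.
Proof.
move=> vd; apply: EFin_inj; rewrite excessE.
rewrite (@ae_integral_eq _ _ _ _ _ (fun=> 0%E))//; first exact: integral0.
- by apply: measurable_excess; exact: L1_measurable.
- by apply: filterS vd => x vx; rewrite max_l// subr_le0.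
Qed.

Lemma excess_lipschitz (u v : L1) : excess u <= excess v + `|u - v|.
Proof.
rewrite -lee_fin EFinD !excessE L1_normB -ge0_integralD//; last 3 first.
- by move=> x _; rewrite lee_fin excess_ge0_real.
- by apply: measurable_excess; exact: L1_measurable.
- by apply: measurable_absE; apply: measurable_funB; exact: L1_measurable.
apply: le_integral_ge0 => x _; first by rewrite lee_fin excess_ge0_real.
rewrite -EFinD lee_fin ge_max addr_ge0 ?excess_ge0_real//=.
rewrite lerBlDr -(subrK (v x) (u x)) (le_trans (ler_normD _ _))//.
rewrite subrK addrC -addrA [X in _ <= _ + X]addrC addrA lerD2r.
by rewrite -lerBlDr le_max lexx orbT.
Qed.

Lemma norm_excess (v : L1) : `|v| <= excess v + delta * fine (mu setT).
Proof.
rewrite -lee_fin L1_norm EFinD excessE EFinM fineK ?ge0_fin_numE//.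
rewrite -integral_cst// -ge0_integralD//; last 3 first.
- by move=> x _; rewrite lee_fin excess_ge0_real.
- by apply: measurable_excess; exact: L1_measurable.
- by move=> x _; rewrite lee_fin ltW.
apply: le_integral_ge0 => x _; first by rewrite lee_fin.
by rewrite -EFinD lee_fin -lerBlDr le_max lexx orbT.
Qed.

Lemma submarkovian_ge0 (S : R -> L1 -> L1) t (b : L1) : 0 <= t ->
  contraction_semigroup S -> submarkovian S ->
  {ae mu, forall x, 0 <= b x <= delta} -> {ae mu, forall x, 0 <= S t b x <= delta}.
Proof.
move=> t0 HS sS hb.
have h1 : {ae mu, forall x, 0 <= (delta^-1 *: b : L1) x <= 1}.
  apply: filterS2 (L1Z delta^-1 b) hb => x -> /andP[b0 bd].
  by rewrite mulr_ge0 ?invr_ge0 ?(ltW delta0)//= mulrC ler_pdivrMr// mul1r.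
have := sS t _ t0 h1; rewrite (semigroupZ HS)// => h2.
apply: filterS2 (L1Z delta^-1 (S t b)) h2 => x -> /andP[].
by rewrite pmulr_rge0 ?invr_gt0// => ->/=; rewrite mulrC ler_pdivrMr// mul1r.
Qed.

(** The excess of v is its L^1 distance to its truncation [p - m] at the levels [delta] and
    [- delta]. As [S t] contracts this distance, it remains to see that [S t (p - m)] is bounded by
    [delta]; the two signs are treated separately because the subMarkovian property concerns
    functions between 0 and 1. *)
Lemma excess_semigroup (S : R -> L1 -> L1) t (v : L1) : 0 <= t ->
  contraction_semigroup S -> submarkovian S -> excess (S t v) <= excess v.
Proof.
move=> t0 HS sS.
pose bp x := Num.min delta (Num.max 0 (v x)).
pose bm x := Num.min delta (Num.max 0 (- v x)).
have mbp : measurable_fun setT bp.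
  by apply: measurable_minr => //; apply: measurable_maxr => //; exact: L1_measurable.
have mbm : measurable_fun setT bm.
  apply: measurable_minr => //; apply: measurable_maxr => //.
  by apply: measurableT_comp => //; exact: L1_measurable.
have Hp x : 0 <= bp x <= delta.
  by rewrite le_min ltW//= le_max lexx/= ge_min lexx.
have Hm x : 0 <= bm x <= delta.
  by rewrite le_min ltW//= le_max lexx/= ge_min lexx.
have fin_of (h : X -> R) : (forall x, 0 <= h x <= delta) ->
    (\int[mu]_x `|h x|%:E < +oo)%E.
  move=> hd; apply: (@le_lt_trans _ _ (\int[mu]_x (delta%:E))%E).
    apply: le_integral_ge0 => // x _; have /andP[h0 h1] := hd x.
    by rewrite lee_fin ger0_norm.
  by rewrite integral_cst// lte_mul_pinfty// lee_fin ltW.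
have Ep := L1_ofE mbp (fin_of _ Hp); have Em := L1_ofE mbm (fin_of _ Hm).
set p := L1_of mu bp in Ep *; set m := L1_of mu bm in Em *.
have Sp := @submarkovian_ge0 S t p t0 HS sS.
have Sm := @submarkovian_ge0 S t m t0 HS sS.
have /Sp {}Sp : {ae mu, forall x, 0 <= p x <= delta} by apply: filterS Ep => x ->.
have /Sm {}Sm : {ae mu, forall x, 0 <= m x <= delta} by apply: filterS Em => x ->.
have Sb : excess (S t (p - m)) = 0.
  apply: excess0; rewrite (semigroupB HS)//.
  apply: filterS3 (L1B (S t p) (S t m)) Sp Sm => x -> /andP[p0 p1] /andP[m0 m1].
  by rewrite ler_norml; lra.
have -> : excess v = `|v - (p - m)|.
  apply: EFin_inj; rewrite excessE L1_normB; apply: ae_integral_eq.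
  - by apply: measurable_excess; exact: L1_measurable.
  - by apply: measurable_absE; apply: measurable_funB; exact: L1_measurable.
  apply: filterS3 (L1B p m) Ep Em => x -> -> ->; congr EFin; rewrite /bp /bm.
  case: (leP 0 (v x)) => v0.
    rewrite (max_idPl (_ : - v x <= 0)) ?oppr_le0// (min_idPr (ltW delta0)) subr0 ger0_norm//.
    case: (leP delta (v x)) => vd.
      by rewrite max_r ?subr_ge0// ger0_norm// subr_ge0.
    by rewrite subrr normr0 max_l// subr_le0 ltW.
  rewrite (min_idPr (ltW delta0)) sub0r opprK ltr0_norm//.
  rewrite [X in Num.min _ X]max_r ?oppr_ge0 ?(ltW v0)//; case: (leP delta (- v x)) => vd.
    by rewrite max_r ?subr_ge0// ler0_norm ?opprD// -lerBrDr sub0r lerNr.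
  by rewrite subrr normr0 max_l// subr_le0 ltW.
apply: le_trans (excess_lipschitz _ (S t (p - m))) _; rewrite Sb add0r.
by rewrite -(semigroupB HS)//; exact: (semigroup_norm HS).
Qed.

(** Where [|r| < delta < |w|], [w - r] has the sign of [w], hence so has [h] when it is not 0, and a
    move along [h] does not decrease [|w|]. Where [|w| <= delta] the excess is already zero. Only
    where [|r| >= delta] can the excess drop, by at most [eps |h|], which [k] pays for. *)
Lemma excess_step (w h : L1) (r : X -> R) (k : X -> \bar R) (eps : R) : 0 < eps ->
  measurable_fun setT k -> (forall x, 0 <= k x)%E ->
  {ae mu, forall x, 0 <= (w x - r x) * h x /\
    (delta <= `|r x| -> (`|h x|%:E <= k x)%E)} ->
  ((excess w)%:E <= (excess (w + eps *: h))%:E + eps%:E * \int[mu]_x k x)%E.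
Proof.
move=> eps0 mk k0 hw; rewrite !excessE -ge0_integralZl//; last by rewrite lee_fin ltW.
have epsk0 x : (0 <= eps%:E * k x)%E by rewrite mule_ge0// lee_fin ltW.
have mepsk : measurable_fun setT (fun x => eps%:E * k x)%E by exact: measurable_funeM.
rewrite -ge0_integralD//; last 2 first.
- by move=> x _; rewrite lee_fin excess_ge0_real.
- by apply: measurable_excess; exact: L1_measurable.
apply: ae_ge0_le_integral => //.
- by move=> x _; rewrite lee_fin excess_ge0_real.
- by apply: measurable_excess; exact: L1_measurable.
- by move=> x _; rewrite adde_ge0// lee_fin excess_ge0_real.
- apply: emeasurable_funD => //; apply: measurable_excess; exact: L1_measurable.
apply: filterS3 (L1D w (eps *: h)) (L1Z eps h) hw => x -> -> [wr rk] _.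
set y := w x + eps * h x.
have lip : Num.max 0 (`|w x| - delta) <= Num.max 0 (`|y| - delta) + eps * `|h x|.
  rewrite ge_max addr_ge0 ?excess_ge0_real ?mulr_ge0 ?(ltW eps0)//=.
  have : `|w x| <= `|y| + eps * `|h x|.
    by rewrite -[w x](addrK (eps * h x)) (le_trans (ler_normB _ _))// normrM (gtr0_norm eps0).
  have : `|y| - delta <= Num.max 0 (`|y| - delta) by rewrite le_max lexx orbT.
  lra.
case: (leP delta `|r x|) => [/rk hk|rd].
  apply: (@le_trans _ _ ((Num.max 0 (`|y| - delta))%:E + eps%:E * `|h x|%:E)%E).
    by rewrite -EFinM -EFinD lee_fin.
  by apply: leeD2l; apply: lee_wpmul2l => //; rewrite lee_fin ltW.
apply: (@le_trans _ _ (Num.max 0 (`|y| - delta))%:E); last by rewrite leeDl.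
rewrite lee_fin ge_max excess_ge0_real/= le_max.
case: (leP (`|w x|) delta) => wd; first by rewrite subr_le0 wd.
apply/orP; right; rewrite lerD2r.
move: rd; rewrite ltr_norml => /andP[r1 r2].
case: (leP 0 (w x)) => w0.
  rewrite ger0_norm// in wd *; apply: le_trans (ler_norm _).
  have h0 : 0 <= h x by rewrite -(pmulr_rge0 _ (_ : 0 < w x - r x)) ?subr_gt0 ?(lt_trans r2).
  by rewrite lerDl mulr_ge0// ltW.
rewrite ltr0_norm// in wd *; rewrite -normrN; apply: le_trans (ler_norm _).
have h0 : h x <= 0.
  rewrite -(nmulr_rge0 _ (_ : w x - r x < 0)) ?subr_lt0//; move: wd r1; lra.
by rewrite opprD lerDl oppr_ge0 mulr_ge0_le0// ltW.
Qed.

End excess.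

(** * Yosida approximation *)

Section monotone_graph_theory.
Context (R : realType) (f : R -> R).
Hypothesis f_incr : {homo f : x y / x <= y}.

Lemma is_cvg_left x : cvg (f z @[z --> x^'-]).
Proof.
apply: nondecreasing_at_left_is_cvgr; apply: nearW => y.
  by move=> a b _ _; exact: f_incr.
exists (f x) => _ [z /= + <-]; rewrite in_itv/= => /andP[_ /ltW zx].
exact: f_incr.
Qed.

Lemma is_cvg_right x : cvg (f z @[z --> x^'+]).
Proof.
apply: nondecreasing_at_right_is_cvgr; apply: nearW => y.
  by move=> a b _ _; exact: f_incr.
exists (f x) => _ [z /= + <-]; rewrite in_itv/= => /andP[/ltW zx _].
exact: f_incr.
Qed.

(** The one-sided limits of a monotone function are its supremum on the left and its infimum on the
    right, so the graph is described by inequalities between values alone. These are stable under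
    limits and averages. *)
Lemma monotone_extensionP x y : monotone_extension f x y <->
  (forall z, z < x -> f z <= y) /\ (forall z, x < z -> y <= f z).
Proof.
split=> [/andP[xy yx]|[xy yx]].
  split=> z zx.
    apply: le_trans xy; apply: limr_ge; first exact: is_cvg_left.
    by near=> t; apply: f_incr; near: t; exact: nbhs_left_ge.
  apply: le_trans yx _; apply: limr_le; first exact: is_cvg_right.
  by near=> t; apply: f_incr; near: t; exact: nbhs_right_le.
apply/andP; split.
  apply: limr_le; first exact: is_cvg_left.
  by near=> t; apply: xy.
apply: limr_ge; first exact: is_cvg_right.
by near=> t; apply: yx.
Unshelve. all: by end_near. Qed.

(** The value of [f] at the midpoint of x and x' separates y from y'. *)
Lemma monotone_extension_mono x y x' y' : monotone_extension f x y ->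
  monotone_extension f x' y' -> 0 <= (x - x') * (y - y').
Proof.
wlog xx' : x x' y y' / x <= x'.
  move=> wl h h'; case/orP: (le_total x x') => [xx'|x'x]; first exact: wl.
  by rewrite -mulrNN !opprB; exact: wl.
move: xx'; rewrite le_eqVlt => /orP[/eqP -> _ _|xx'].
  by rewrite subrr mul0r.
move=> /monotone_extensionP[_ h] /monotone_extensionP[h' _].
have lt1 : x < (x + x') / 2 by lra.
have lt2 : (x + x') / 2 < x' by lra.
have yy' : y <= y' by exact: le_trans (h _ lt1) (h' _ lt2).
by apply: mulr_le0; rewrite subr_le0// ltW.
Qed.

Variables (lam : R) (lam0 : 0 < lam).

(** At the supremum of [A] the function [y + lam * f y] passes the level x, possibly by a jump, and
    the required z is in the interval that fills the jump. *)
Lemma resolvent_exists x : exists y, exists2 z, monotone_extension f y z &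
  x = y + lam * z.
Proof.
pose A := [set y | y + lam * f y <= x].
(* To the left of 0 one has [f a <= f 0], so any such a below [x - lam * f 0] is in [A]; the upper
   bound is the mirror image. *)
have low : A (Num.min 0 (x - lam * f 0)).
  rewrite /A/=; set a := Num.min _ _.
  have a0 : a <= 0 by rewrite /a ge_min lexx.
  have ax : a <= x - lam * f 0 by rewrite /a ge_min lexx orbT.
  have : lam * f a <= lam * f 0 by rewrite ler_pM2l// f_incr.
  lra.
have ubA : ubound A (Num.max 0 (x - lam * f 0)).
  move=> y; rewrite /A/= => Ay; rewrite le_max; case: (leP y 0) => //= y0.
  have : lam * f 0 <= lam * f y by rewrite ler_pM2l// f_incr// ltW.
  lra.
have supA : has_sup A by split; [exists (Num.min 0 (x - lam * f 0))|exists (Num.max 0 (x - lam * f 0))].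
exists (sup A), (lam^-1 * (x - sup A)); last first.
  by rewrite mulrA mulfV ?gt_eqF// mul1r addrC subrK.
apply/monotone_extensionP; split=> z zA.
  rewrite ler_pdivlMl//; apply/ler_addgt0Pr => eps eps0.
  pose d := Num.min eps (sup A - z).
  have d0 : 0 < d by rewrite lt_min eps0 subr_gt0.
  have [y Ay yA] := sup_adherent d0 supA.
  have dz : d <= sup A - z by rewrite ge_min lexx orbT.
  have de : d <= eps by rewrite ge_min lexx.
  have zy : z <= y by lra.
  have : lam * f z <= lam * f y by rewrite ler_pM2l// f_incr.
  move: Ay; rewrite /A/=; lra.
rewrite ler_pdivrMl//; apply/ler_addgt0Pr => eps eps0.
pose y := Num.min z (sup A + eps).
have yz : y <= z by rewrite ge_min lexx.
have yA : sup A < y by rewrite lt_min zA ltrDl.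
have ye : y <= sup A + eps by rewrite ge_min lexx orbT.
have : ~ A y.
  move=> Ay; have := ub_le_sup (proj2 supA) Ay; by rewrite leNgt yA.
rewrite /A/= => /negP; rewrite -ltNge => xy.
have : lam * f y <= lam * f z by rewrite ler_pM2l// f_incr.
lra.
Qed.

(** Existence excludes the default value of [xget], and the equation that defines the resolvent
    forces its witness z to be the Yosida value. *)
Lemma resolventP x : monotone_extension f (resolvent f lam x) (yosida f lam x).
Proof.
have [z hz xE] : [set y | exists2 z, monotone_extension f y z & x = y + lam * z]
    (resolvent f lam x).
  by apply: xgetPex; exact: resolvent_exists.
suff -> : yosida f lam x = z by [].
by rewrite /yosida {1}xE addrC addKr mulrA mulVf ?gt_eqF// mul1r.
Qed.

Lemma resolventE x : x = resolvent f lam x + lam * yosida f lam x.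
Proof. by rewrite /yosida mulrA mulfV ?gt_eqF// mul1r addrC subrK. Qed.

(** In [x - y = (a - b) + lam (c - d)], with a, b the resolvents and c, d the Yosida values, the
    cross product is nonnegative by monotonicity, so each summand is at most the sum in absolute
    value. *)
Lemma yosida_lipschitz x y :
  `|yosida f lam x - yosida f lam y| <= lam^-1 * `|x - y|.
Proof.
have := monotone_extension_mono (resolventP x) (resolventP y).
have Ex := resolventE x; have Ey := resolventE y.
move: (resolvent f lam x) (resolvent f lam y) (yosida f lam x) (yosida f lam y) Ex Ey.
move=> a b c d -> -> h; rewrite ler_pdivlMl//.
rewrite (_ : lam * `|c - d| = `|lam * (c - d)|); last by rewrite normrM gtr0_norm.
rewrite (_ : a + lam * c - (b + lam * d) = (a - b) + lam * (c - d)); last by ring.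
rewrite -ler_sqr ?nnegrE// !real_normK ?num_real//.
have : 0 <= (a - b) ^+ 2 by exact: sqr_ge0.
have : 0 <= lam * ((a - b) * (c - d)) by rewrite mulr_ge0// ltW.
rewrite sqrrD; lra.
Qed.

End monotone_graph_theory.

(** * Convex combinations of an equiintegrable sequence *)

Section convex_combinations.
Context (R : realType).

(** All sums start at 0, with zero weights before n, so that combinations of different tails can be
    added weight by weight. *)
Definition tail_weights (n N : nat) (c : nat -> R) : Prop :=
  [/\ forall m, 0 <= c m, forall m, c m != 0 -> (n <= m < N)%N
    & \sum_(0 <= m < N) c m = 1].

Lemma sum_weights_widen (V : lmodType R) n N N' c (a : nat -> V) : (N <= N')%N ->
  tail_weights n N c -> \sum_(0 <= m < N') c m *: a m = \sum_(0 <= m < N) c m *: a m.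
Proof.
move=> NN' [_ cN _]; rewrite (big_cat_nat (leq0n N) NN')/=.
suff -> : \sum_(N <= m < N') c m *: a m = 0 by rewrite addr0.
rewrite big_nat_cond big1// => m /andP[/andP[Nm _] _].
have [->|/cN/andP[_]] := eqVneq (c m) 0; first by rewrite scale0r.
by rewrite ltnNge Nm.
Qed.

Lemma tail_weights_widen n N N' c : (N <= N')%N ->
  tail_weights n N c -> tail_weights n N' c.
Proof.
move=> NN' [c0 cN c1]; split => //.
  by move=> m /cN/andP[-> /leq_trans]; apply.
rewrite (big_cat_nat (leq0n N) NN')/= c1.
suff -> : \sum_(N <= m < N') c m = 0 by rewrite addr0.
rewrite big_nat_cond big1// => m /andP[/andP[Nm _] _].
have [//|/cN/andP[_]] := eqVneq (c m) 0.
by rewrite ltnNge Nm.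
Qed.

Lemma tail_weights_mid n k N c c' : (n <= k)%N ->
  tail_weights n N c -> tail_weights k N c' ->
  tail_weights n N (fun m => (c m + c' m) / 2).
Proof.
move=> nk [c0 cN c1] [c0' cN' c1']; split.
- by move=> m; rewrite divr_ge0// addr_ge0.
- move=> m; have [cm0|/cN//] := eqVneq (c m) 0.
  have [cm0'|/cN'/andP[km ->]] := eqVneq (c' m) 0.
    by rewrite cm0 cm0' addr0 mul0r eqxx.
  by rewrite (leq_trans nk km).
- by rewrite -mulr_suml big_split/= c1 c1'; lra.
Qed.

(** Strict convexity is combined with linear growth: the integral stays finite on L^1, where that of
    a square may be infinite. *)
Definition hyp (a : R) : R := Num.sqrt (1 + a ^+ 2).

Lemma hyp_sqr a : hyp a ^+ 2 = 1 + a ^+ 2.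
Proof. by rewrite sqr_sqrtr// addr_ge0// sqr_ge0. Qed.

Lemma hyp_ge1 a : 1 <= hyp a.
Proof.
rewrite -ler_sqr ?nnegrE ?sqrtr_ge0// hyp_sqr expr1n lerDl; exact: sqr_ge0.
Qed.

Lemma hyp_le a : hyp a <= 1 + `|a|.
Proof.
rewrite -ler_sqr ?nnegrE ?sqrtr_ge0// ?addr_ge0// hyp_sqr sqrrD real_normK ?num_real//.
by rewrite expr1n mul1r lerD2r lerDl mulrn_wge0.
Qed.

Lemma measurable_hyp : measurable_fun setT hyp.
Proof.
apply: measurableT_comp; first (apply: continuous_measurable_fun; exact: sqrt_continuous).
apply: measurable_funD => //; exact: measurable_funX.
Qed.

(* With P = hyp a, Q = hyp b and M = hyp ((a + b) / 2) one has
   (P + Q)^2 - (2 M)^2 = 2 (P Q - 1 - a b) and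
   (P Q)^2 - (1 + a b)^2 = (a - b)^2. *)
Lemma hyp_gap a b :
  (a - b) ^+ 2 <= 2 * hyp a * hyp b * (hyp a + hyp b) *
    (hyp a + hyp b - 2 * hyp ((a + b) / 2)).
Proof.
move: (hyp_sqr a) (hyp_sqr b) (hyp_sqr ((a + b) / 2)).
move: (hyp_ge1 a) (hyp_ge1 b) (hyp_ge1 ((a + b) / 2)).
move: (hyp a) (hyp b) (hyp ((a + b) / 2)) => p q r p1 q1 r1 pE qE rE.
have pq1 : 1 + a * b <= p * q.
  have [ab|ab] := leP (1 + a * b) 0; first by rewrite (le_trans ab)// mulr_ge0; lra.
  rewrite -ler_sqr ?nnegrE ?(ltW ab)//; last by rewrite mulr_ge0; lra.
  rewrite exprMn pE qE; have := sqr_ge0 (a - b).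
  by rewrite sqrrB !sqrrD !mulr2n; nra.
have E1 : (p + q - 2 * r) * (p + q + 2 * r) = 2 * (p * q - (1 + a * b)).
  have -> : (p + q - 2 * r) * (p + q + 2 * r) = p ^+ 2 + q ^+ 2 + 2 * p * q - 4 * r ^+ 2 by ring.
  by rewrite pE qE rE; field.
have E2 : (p * q - (1 + a * b)) * (p * q + (1 + a * b)) = (a - b) ^+ 2.
  have -> : (p * q - (1 + a * b)) * (p * q + (1 + a * b)) = p ^+ 2 * q ^+ 2 - (1 + a * b) ^+ 2 by ring.
  by rewrite pE qE; ring.
have g0 : 0 <= p + q - 2 * r.
  rewrite -(@pmulr_lge0 _ (p + q + 2 * r)); last by lra.
  by rewrite E1 mulr_ge0// subr_ge0.
have r_le : 2 * r <= p + q by lra.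
have pq0 : 0 <= p * q by rewrite mulr_ge0; lra.
have ab_le : (p * q - (1 + a * b)) * (p * q + (1 + a * b)) <=
    (p * q - (1 + a * b)) * (2 * (p * q)).
  by rewrite ler_wpM2l ?subr_ge0//; lra.
have ge2 : 2 * (p * q - (1 + a * b)) <= (p + q - 2 * r) * (2 * (p + q)).
  by rewrite -E1 ler_wpM2l//; lra.
rewrite -E2; apply: le_trans ab_le _.
have : (2 * (p * q - (1 + a * b))) * (p * q) <= (p + q - 2 * r) * (2 * (p + q)) * (p * q).
  by rewrite ler_wpM2r.
lra.
Qed.

Lemma hyp_midpoint a b : 0 <= hyp a + hyp b - 2 * hyp ((a + b) / 2).
Proof.
have h := hyp_gap a b.
have p1 := hyp_ge1 a; have q1 := hyp_ge1 b.
have c0 : 0 < 2 * hyp a * hyp b * (hyp a + hyp b).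
  by rewrite !mulr_gt0//; lra.
by rewrite -(pmulr_rge0 _ c0); exact: le_trans (sqr_ge0 _) h.
Qed.

(* [|a - b| <= eta + (a - b)^2 / eta] and the gap controls (a - b)^2 where hyp
   is bounded by K. *)
Lemma hyp_gap_norm a b K eta : 0 < eta -> hyp a <= K -> hyp b <= K ->
  `|a - b| <= eta + 4 * K ^+ 3 / eta * (hyp a + hyp b - 2 * hyp ((a + b) / 2)).
Proof.
move=> eta0 aK bK.
have g0 := hyp_midpoint a b; have h := hyp_gap a b.
have p1 := hyp_ge1 a; have q1 := hyp_ge1 b.
move: g0 h; set g := hyp a + hyp b - _ => g0 h.
have hK : (a - b) ^+ 2 <= 4 * K ^+ 3 * g.
  apply: le_trans h _; apply: ler_wpM2r => //.
  have -> : 4 * K ^+ 3 = 2 * K * K * (K + K) by ring.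
  have p0 : 0 <= hyp a by lra.
  have q0 : 0 <= hyp b by lra.
  apply: ler_pM; [by rewrite !mulr_ge0|by rewrite addr_ge0| |exact: lerD].
  by apply: ler_pM => //; [rewrite mulr_ge0|rewrite ler_pM2l].
have sq : `|a - b| * eta <= eta ^+ 2 + (a - b) ^+ 2.
  rewrite -(real_normK (num_real (a - b))); move: `|a - b| => t.
  by have := sqr_ge0 (t - eta); have := sqr_ge0 t; have := sqr_ge0 eta; rewrite sqrrB mulr2n; lra.
have -> : eta + 4 * K ^+ 3 / eta * g = (eta ^+ 2 + 4 * K ^+ 3 * g) / eta.
  by field; rewrite gt_eqF.
by rewrite ler_pdivlMr// (le_trans sq)// lerD2l.
Qed.

Context d (Y : measurableType d) (nu : {measure set Y -> \bar R}) (D : set Y).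
Hypotheses (mD : measurable D) (nuD : (nu D < +oo)%E).
Variable gam : nat -> Y -> R.
Hypothesis mgam : forall m, measurable_fun D (gam m).
Hypothesis equi : equiintegrable nu D setT gam.

Definition combination (N : nat) (c : nat -> R) (x : Y) : R :=
  \sum_(0 <= m < N) c m * gam m x.

Lemma measurable_combination N c : measurable_fun D (combination N c).
Proof.
rewrite /combination; elim: (index_iota 0 N) => [|m s IH].
  by under eq_fun do rewrite big_nil; exact: measurable_cst.
under eq_fun do rewrite big_cons.
by apply: measurable_funD => //; apply: measurable_funM.
Qed.

(** A convex combination inherits, on every set, a bound shared by the whole family, and therefore
    its equiintegrability. *)
Lemma integral_combination_le n N c (E : set Y) (M : R) : measurable E -> E `<=` D ->
  tail_weights n N c -> (forall m, (\int[nu]_(x in E) `|gam m x|%:E <= M%:E)%E) ->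
  (\int[nu]_(x in E) `|combination N c x|%:E <= M%:E)%E.
Proof.
move=> mE ED [c0 _ c1] gM.
have mgE m : measurable_fun E (fun x => `|gam m x|%:E).
  apply: measurable_absE.
  exact: measurable_funS (mgam m).
apply: (@le_trans _ _ (\int[nu]_(x in E) (\sum_(0 <= m < N) (c m)%:E * `|gam m x|%:E))%E).
  apply: le_integral_ge0 => // x _; under eq_bigr do rewrite -EFinM.
  rewrite sumEFin lee_fin (le_trans (ler_norm_sum _ _ _))//.
  by apply: ler_sum => m _; rewrite normrM ger0_norm.
rewrite ge0_integral_sum//; last 2 first.
- by move=> m; exact: measurable_funeM.
- by move=> m x _; rewrite mule_ge0// lee_fin.
apply: (@le_trans _ _ (\sum_(0 <= m < N) (c m)%:E * M%:E)%E).
  apply: lee_sum => m _; rewrite ge0_integralZl ?lee_fin//.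
  by apply: lee_wpmul2l; rewrite ?lee_fin.
under eq_bigr do rewrite -EFinM.
by rewrite sumEFin -mulr_suml c1 mul1r.
Qed.

(** This plays the role of weak compactness followed by Mazur's lemma. The infima [dd n] over the
    tails increase to a finite limit. For n <= k the midpoint of the two near-minimisers is
    admissible for the tail n, so the integrated midpoint gap is small; [hyp_gap_norm] turns this
    into closeness where both are bounded, and the rest is a small set. *)
Lemma convex_tail_cauchy : exists (N : nat -> nat) (c : nat -> nat -> R),
  (forall n, tail_weights n (N n) (c n)) /\
  forall eps : R, 0 < eps -> exists n0, forall n k, (n0 <= n)%N -> (n0 <= k)%N ->
    (\int[nu]_(x in D) `|combination (N n) (c n) x - combination (N k) (c k) x|%:E
      <= eps%:E)%E.
Proof.
have [[M HM] equiM] := equi.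
have {}HM m : (\int[nu]_(x in D) `|gam m x|%:E <= M%:E)%E by exact: HM.
have M0 : 0 <= M.
  by rewrite -lee_fin (le_trans _ (HM 0%N))// integral_ge0.
pose V0 := fine (nu D).
have V0E : (V0%:E = nu D)%E by rewrite fineK// ge0_fin_numE.
have V00 : 0 <= V0 by exact: fine_ge0.
pose I N c := (\int[nu]_(x in D) (hyp (combination N c x))%:E)%E.
have mhyp N c : measurable_fun D (fun x => (hyp (combination N c x))%:E).
  apply/measurable_EFinP; apply: measurableT_comp; first exact: measurable_hyp.
  exact: measurable_combination.
have hyp0 a : 0 <= hyp a :> R by exact: le_trans (hyp_ge1 a).
have I0 N c : (0 <= I N c)%E by apply: integral_ge0 => x _; rewrite lee_fin.
have IM n N c : tail_weights n N c -> (I N c <= (V0 + M)%:E)%E.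
  move=> w; apply: (@le_trans _ _ (\int[nu]_(x in D) (1%:E + `|combination N c x|%:E))%E).
    by apply: le_integral_ge0 => x _; rewrite lee_fin ?hyp_le.
  rewrite ge0_integralD//; last first.
    by apply: measurable_absE; exact: measurable_combination.
  rewrite integral_cst// mul1e -V0E EFinD leeD2l//.
  exact: integral_combination_le w HM.
have If n N c : tail_weights n N c -> (I N c \is a fin_num)%E.
  by move=> w; rewrite ge0_fin_numE// (le_lt_trans (IM _ _ _ w))// ltry.
pose A n := [set r | exists N c, tail_weights n N c /\ r = fine (I N c)].
have delta_w n : tail_weights n n.+1 (fun m => (m == n)%:R).
  split => [m|m|]; first by rewrite ler0n.
    by case: (eqVneq m n) => [->|_]; rewrite ?leqnn ?ltnS ?leqnn// eqxx.
  rewrite big_nat_recr//= eqxx big_nat_cond big1 ?add0r// => m /andP[/andP[_ mn] _].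
  by rewrite lt_eqF.
have A_lb n : lbound (A n) 0 by move=> r [N [c [_ ->]]]; exact: fine_ge0.
have infA n : has_inf (A n).
  by split; [exists (fine (I n.+1 (fun m => (m == n)%:R))), n.+1, (fun m => (m == n)%:R)|exists 0].
pose dd n := inf (A n).
have dd_lb n N c : tail_weights n N c -> dd n <= fine (I N c).
  by move=> w; apply: ge_inf; [exists 0|exists N, c].
have dd_ub n : dd n <= V0 + M.
  by apply: le_trans (dd_lb _ _ _ (delta_w n)) _; rewrite -lee_fin fineK; [exact: IM (delta_w n)|exact: If (delta_w n)].
have near_min n : exists Nc : nat * (nat -> R), tail_weights n Nc.1 Nc.2 /\
    fine (I Nc.1 Nc.2) < dd n + n.+1%:R^-1.
  have n0 : 0 < n.+1%:R^-1 :> R by [].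
  by have [_ [N [c [w ->]]] h] := inf_adherent n0 (infA n); exists (N, c).
have [Nc HNc] := choice near_min.
exists (fun n => (Nc n).1), (fun n => (Nc n).2).
split=> [n|eps eps0]; first by have [] := HNc n.
have w n := (HNc n).1; have wI n := (HNc n).2.
have dd_nd n k : (n <= k)%N -> dd n <= dd k.
  move=> nk; apply: lb_le_inf; first by case: (infA k).
  move=> _ [N [c [[c0 cN c1] ->]]]; apply: (dd_lb _ _ _ _); split => // m /cN.
  by move=> /andP[km ->]; rewrite (leq_trans nk).
have e4 : 0 < eps / 4 by rewrite divr_gt0.
have [del del0 Hdel] := equiM _ e4.
(* Outside [{hyp y_n <= K} `&` {hyp y_k <= K}], a set of measure less than
   delta, equiintegrability applies. *)
pose K := Num.max 1 (3 * (V0 + M) / del).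
have K1 : 1 <= K by rewrite le_max lexx.
have K0 : 0 < K by exact: lt_le_trans K1.
have Kdel : 3 * (V0 + M) / del <= K by rewrite le_max lexx orbT.
(* The error is made of four quarters of eps: [eta] integrated over [D], the gap weighted by [Ck],
   and the two integrals over [EE]. The factor 3 in [e] is that of [gapE], and [V0 + 1] is positive
   even when [D] is null. *)
pose eta := eps / 4 / (V0 + 1).
have eta0 : 0 < eta by rewrite !divr_gt0// ltr_wpDl.
have etaV : eta * V0 <= eps / 4.
  rewrite /eta mulrAC ler_pdivrMr ?ltr_wpDl// ler_wpM2l ?(ltW e4)//.
  by rewrite lerDl.
pose Ck := 4 * K ^+ 3 / eta.
have Ck0 : 0 < Ck by rewrite divr_gt0// mulr_gt0// exprn_gt0.
pose e := eps / 4 / Ck / 3.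
have e0 : 0 < e by rewrite divr_gt0// divr_gt0.
have supd : has_sup (range dd).
  by split; [exists (dd 0%N), 0%N|exists (V0 + M) => _ [n _ <-]; exact: dd_ub].
have [_ [n1 _ <-] Hn1] := sup_adherent e0 supd.
have [n2 _ Hn2] := near_infty_natSinv_lt (PosNum e0).
have Hdd n k : (n1 <= n)%N -> dd k - dd n < e.
  move=> n1n; have : dd k <= sup (range dd) by apply: ub_le_sup; [case: supd|exists k].
  by have := dd_nd _ _ n1n; move: Hn1; lra.
exists (maxn n1 n2).
suff main n k : (n <= k)%N -> (maxn n1 n2 <= n)%N ->
    (\int[nu]_(x in D) `|combination (Nc n).1 (Nc n).2 x -
       combination (Nc k).1 (Nc k).2 x|%:E <= eps%:E)%E.
  move=> n k hn hk; case/orP: (leq_total n k) => nk; first exact: main.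
  rewrite (eq_integral (fun x => `|combination (Nc k).1 (Nc k).2 x -
    combination (Nc n).1 (Nc n).2 x|%:E)); first exact: main.
  by move=> x _; rewrite distrC.
move=> nk; rewrite geq_max => /andP[n1n n2n].
set Nn := (Nc n).1; set Nk := (Nc k).1; set cn := (Nc n).2; set ck := (Nc k).2.
set yn := combination Nn cn; set yk := combination Nk ck.
pose NN := maxn Nn Nk; pose cm m := (cn m + ck m) / 2.
have wm : tail_weights n NN cm.
  apply: (tail_weights_mid nk).
    by apply: tail_weights_widen (w n); exact: leq_maxl.
  by apply: tail_weights_widen (w k); exact: leq_maxr.
have midE x : combination NN cm x = (yn x + yk x) / 2.
  rewrite /yn /yk /combination.
  have := sum_weights_widen (gam^~ x : nat -> R^o) (leq_maxl Nn Nk) (w n).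
  have := sum_weights_widen (gam^~ x : nat -> R^o) (leq_maxr Nn Nk) (w k).
  move=> <- <-; rewrite -big_split/= mulr_suml; apply: eq_bigr => m _.
  by rewrite /cm -mulrDl mulrAC.
pose gap x := hyp (yn x) + hyp (yk x) - 2 * hyp ((yn x + yk x) / 2).
have mgap : measurable_fun D (fun x => (gap x)%:E).
  have mh N c : measurable_fun D (fun x => hyp (combination N c x)).
    by apply/measurable_EFinP; exact: mhyp.
  apply/measurable_EFinP; apply: measurable_funB.
    by apply: measurable_funD; exact: mh.
  apply: measurable_funM => //.
  by apply: (eq_measurable_fun (fun x => hyp (combination NN cm x))) => // x _; rewrite midE.
have gap0 x : (0 <= (gap x)%:E)%E by rewrite lee_fin hyp_midpoint.
have gapE : (\int[nu]_(x in D) (gap x)%:E <= (3 * e)%:E)%E.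
  have H : (\int[nu]_(x in D) (gap x)%:E + 2%:E * I NN cm = I Nn cn + I Nk ck)%E.
    have h0 N c x : (0 <= (hyp (combination N c x))%:E)%E by rewrite lee_fin.
    have h20 x : (0 <= 2%:E * (hyp (combination NN cm x))%:E)%E by rewrite mule_ge0.
    have mh2 : measurable_fun D (fun x => 2%:E * (hyp (combination NN cm x))%:E)%E.
      by apply: measurable_funeM; exact: mhyp.
    have E1 : (2%:E * I NN cm = \int[nu]_(x in D) (2%:E * (hyp (combination NN cm x))%:E))%E.
      rewrite ge0_integralZl ?lee_fin//; exact: mhyp.
    have E2 : (I Nn cn + I Nk ck = \int[nu]_(x in D) ((hyp (yn x))%:E + (hyp (yk x))%:E))%E.
      by rewrite ge0_integralD//; [move=> x _; exact: h0|exact: mhyp|move=> x _; exact: h0|exact: mhyp].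
    rewrite E1 E2 -ge0_integralD//.
    apply: eq_integral => x _; rewrite midE -EFinM -!EFinD; congr EFin.
    by rewrite /gap subrK.
  have hI : (\int[nu]_(x in D) (gap x)%:E = (fine (I Nn cn) + fine (I Nk ck) - 2 * fine (I NN cm))%:E)%E.
    have fm : (2%:E * I NN cm \is a fin_num)%E by rewrite fin_numM// (If _ _ _ wm).
    have -> : ((fine (I Nn cn) + fine (I Nk ck) - 2 * fine (I NN cm))%:E =
       (fine (I Nn cn))%:E + (fine (I Nk ck))%:E - 2%:E * (fine (I NN cm))%:E)%E by [].
    rewrite -[LHS](addeK _ fm) H !fineK//.
    - exact: If wm.
    - exact: If (w k).
    - exact: If (w n).
  rewrite hI lee_fin.
  have i1 : dd n <= fine (I NN cm) by exact: dd_lb wm.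
  have i2 : fine (I Nn cn) < dd n + n.+1%:R^-1 by exact: wI.
  have i3 : fine (I Nk ck) < dd k + k.+1%:R^-1 by exact: wI.
  have i4 : dd k - dd n < e by exact: Hdd.
  have i5 : n.+1%:R^-1 < e by exact: (Hn2 _ n2n).
  have i6 : k.+1%:R^-1 < e by apply: (Hn2 k); exact: leq_trans nk.
  move: i1 i2 i3 i4 i5 i6.
  move: (fine (I Nn cn)) (fine (I Nk ck)) (fine (I NN cm)) (dd n) (dd k) => x1 x2 x3 x4 x5.
  move: (n.+1%:R^-1) (k.+1%:R^-1) => x6 x7; lra.
pose E z : set Y := D `&` [set x | K < hyp (z x)].
have mE N c : measurable (E (combination N c)).
  exact: emeasurable_fun_o_infty mD (mhyp N c) K%:E.
pose EE := E yn `|` E yk.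
have mEE : measurable EE by apply: measurableU; exact: mE.
have EED : EE `<=` D by move=> x [[]|[]].
(* Chebyshev's inequality; the 3 in [K] gives [del / 3] for each of the two sets, so their union has
   measure less than [del]. *)
have nuE m N c : tail_weights m N c -> (nu (E (combination N c)) <= (del / 3)%:E)%E.
  move=> wc; have := IM _ _ _ wc.
  have : (K%:E * nu (E (combination N c)) <= I N c)%E.
    rewrite -integral_cst//.
    apply: (@le_trans _ _ (\int[nu]_(x in E (combination N c)) (hyp (combination N c x))%:E)%E).
      apply: le_integral_ge0 => x; first by rewrite lee_fin ltW.
      by rewrite lee_fin => -[_ /ltW].
    apply: ge0_subset_integral; [exact: mE|exact: mD|exact: mhyp| |by move=> x []].
    by move=> x _; rewrite lee_fin.
  move=> h1 h2; have := le_trans h1 h2; rewrite -lee_pdivlMl// -EFinM.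
  move=> /le_trans; apply; rewrite lee_fin ler_pdivrMl//.
  by move: Kdel; rewrite ler_pdivrMr//; lra.
have nuEE : (nu EE < del%:E)%E.
  apply: (@le_lt_trans _ _ (nu (E yn) + nu (E yk))%E).
    by apply: measureU2; exact: mE.
  apply: (@le_lt_trans _ _ ((del / 3)%:E + (del / 3)%:E)%E).
    by apply: leeD; [exact: nuE (w n)|exact: nuE (w k)].
  by rewrite -EFinD lte_fin; lra.
have intE m N c : tail_weights m N c -> (\int[nu]_(x in EE) `|combination N c x|%:E <= (eps / 4)%:E)%E.
  by move=> wc; apply: (integral_combination_le mEE EED wc) => j; exact: Hdel.
have myabs N c F : F `<=` D -> measurable F -> measurable_fun F (fun x => `|combination N c x|%:E).
  move=> FD mF; apply: measurable_absE.
  by apply: measurable_funS (measurable_combination N c).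
pose g1 x := (eta%:E + Ck%:E * (gap x)%:E)%E.
pose g2 := (fun x => `|yn x|%:E + `|yk x|%:E)%E \_ EE.
have g10 x : (0 <= g1 x)%E by rewrite adde_ge0 ?mule_ge0// lee_fin ltW.
have g20 x : (0 <= g2 x)%E by rewrite /g2 patchE; case: ifPn => // _; rewrite adde_ge0.
have mCk : measurable_fun D (fun x => Ck%:E * (gap x)%:E)%E by exact: measurable_funeM.
have mg1 : measurable_fun D g1 by exact: emeasurable_funD.
have msum F : F `<=` D -> measurable F -> measurable_fun F (fun x => `|yn x|%:E + `|yk x|%:E)%E.
  by move=> FD mF; apply: emeasurable_funD; exact: myabs.
have mg2 : measurable_fun D g2.
  apply/(measurable_restrict _ mEE mD).1; rewrite (setIidr EED).
  exact: msum.
pose g x := (g1 x + g2 x)%E.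
apply: (@le_trans _ _ (\int[nu]_(x in D) g x)%E).
  apply: le_integral_ge0 => // x Dx.
  rewrite /g /g2 patchE; case: ifPn => [_|xEE].
    rewrite (le_trans _ (leeDr _ (g10 x)))// -EFinD lee_fin.
    exact: ler_normB.
  rewrite adde0 /g1 -EFinM -EFinD lee_fin; apply: hyp_gap_norm => //.
    rewrite leNgt; apply/negP => h; move/negP: xEE; apply; rewrite inE; left; split => //.
  rewrite leNgt; apply/negP => h; move/negP: xEE; apply; rewrite inE; right; split => //.
rewrite /g ge0_integralD//.
have -> : (eps%:E = (eps / 4 + eps / 4)%:E + (eps / 4 + eps / 4)%:E)%E.
  by rewrite -EFinD; congr EFin; field.
apply: leeD.
  rewrite /g1 ge0_integralD//; last 2 first.
  - by move=> x _; rewrite lee_fin ltW.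
  - by move=> x _; rewrite mule_ge0// lee_fin ltW.
  rewrite EFinD; apply: leeD.
    by rewrite integral_cst// -V0E -EFinM lee_fin.
  rewrite ge0_integralZl ?lee_fin ?(ltW Ck0)//.
  have Ck0E : (0 <= Ck%:E)%E by rewrite lee_fin ltW.
  apply: le_trans (lee_wpmul2l Ck0E gapE) _; rewrite -EFinM lee_fin /e.
  by rewrite le_eqVlt; apply/orP; left; apply/eqP; field; rewrite gt_eqF.
rewrite /g2 -integral_mkcondr (setIidr EED) ge0_integralD//; last 2 first.
- exact: myabs.
- exact: myabs.
by rewrite EFinD; apply: leeD; [exact: intE (w n)|exact: intE (w k)].
Qed.

End convex_combinations.

(** * Comparison and limits along a path *)

Section finite_measure_of.
Context d (X : measurableType d) (R : realType) (mu : {measure set X -> \bar R}).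
Hypothesis muT : (mu setT < +oo)%E.

(** The proof of finiteness is an argument of this copy of [mu], which lets the finite measure
    structure demanded by Tonelli's theorem be attached to it. *)
Definition finite_measure_of of (mu setT < +oo)%E : set X -> \bar R := mu.

HB.instance Definition _ := Measure.on (finite_measure_of muT).

Let finite_measure_of_fin : fin_num_fun (finite_measure_of muT).
Proof. exact: lty_fin_num_fun. Qed.

HB.instance Definition _ := Measure_isFinite.Build _ _ _ (finite_measure_of muT)
  finite_measure_of_fin.

End finite_measure_of.

Section product_with_lebesgue.
Context d (X : measurableType d) (R : realType) (mu : {measure set X -> \bar R}).
Hypothesis muT : (mu setT < +oo)%E.
Local Notation leb := (@lebesgue_measure R).

(** Tonelli's theorem concerns [\x] rather than [\x^]; uniqueness of the product measure identifies
    the two once [mu] is replaced by its finite copy. *)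
Lemma lebesgue_prod_tonelli (f : measurableTypeR R * X -> \bar R) :
  measurable_fun setT f -> (forall z, 0 <= f z)%E ->
  measurable_fun setT (fun t : measurableTypeR R => \int[mu]_x f (t, x))%E /\
  (\int[leb \x^ mu]_z f z = \int[leb]_t \int[mu]_x f (t, x))%E.
Proof.
move=> mf f0.
pose mu' := [the {finite_measure set X -> \bar R} of finite_measure_of muT].
have mu'E A : mu A = mu' A by [].
have inner t : (\int[mu]_x f (t, x) = \int[mu']_x f (t, x))%E.
  by apply: eq_measure_integral => A mA _; rewrite mu'E.
split.
  under eq_fun do rewrite inner.
  exact: (@measurable_fun_fubini_tonelli_F _ _ _ _ _ mu' f).
under [RHS]eq_integral do rewrite inner.
rewrite -(@fubini_tonelli1 _ _ _ _ _ [the sigma_finite_measure _ _ of leb] mu')//.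
apply: eq_measure_integral => A mA _.
have E1 : (leb \x^ mu)%E A = (leb \x^ mu')%E A.
  by apply: eq_measure_integral => B mB _; rewrite mu'E.
have E2 : ([the sigma_finite_measure _ _ of leb] \x mu')%E A = (leb \x^ mu')%E A.
  by apply: product_measure_unique => //= A1 A2 mA1 mA2; rewrite product_measure2E.
by first [exact: (etrans E1 (esym E2))|exact: (etrans E2 (esym E1))].
Qed.

Variable (T : R).
Local Notation D := (`[0, T]%classic `*` [set: X] : set (measurableTypeR R * X)).

Lemma measurable_itv_prod : measurable D.
Proof. by apply: measurableX => //; exact: measurable_itv. Qed.

Lemma lebesgue_prod_tonelli_itv (f : measurableTypeR R * X -> \bar R) :
  measurable_fun D f -> (forall z, 0 <= f z)%E ->
  measurable_fun (`[0, T]%classic : set (measurableTypeR R))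
    (fun t => \int[mu]_x f (t, x))%E /\
  (\int[leb \x^ mu]_(z in D) f z = \int[leb]_(t in `[0%R, T]) \int[mu]_x f (t, x))%E.
Proof.
move=> mf f0; pose g := f \_ D.
have mg : measurable_fun setT g.
  exact: ((measurable_restrictT f measurable_itv_prod).1 mf).
have g0 z : (0 <= g z)%E by rewrite /g patchE; case: ifPn.
have [mG GE] := lebesgue_prod_tonelli mg g0.
have gE t : `[0, T]%classic t -> (\int[mu]_x g (t, x) = \int[mu]_x f (t, x))%E.
  move=> tT; apply: eq_integral => x _.
  have Dtx : D (t, x) by split; [exact: tT|].
  by rewrite /g patchE mem_set.
split.
  apply: (eq_measurable_fun (fun t => \int[mu]_x g (t, x))%E); last exact: measurable_funTS.
  by move=> t /set_mem tT; rewrite gE.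
rewrite integral_mkcond GE [RHS]integral_mkcond; apply: eq_integral => t _.
rewrite patchE; case: ifPn => [/set_mem /gE//|tT].
apply: integral0_eq => x _; rewrite /g patchE memNset// => -[/= ? _].
by move/negP: tT; apply; exact: mem_set.
Qed.

End product_with_lebesgue.

(** * Comparison in L^1 and uniqueness along a path *)

Section pathwise.
Context d (X : measurableType d) (R : realType) (mu : {measure set X -> \bar R}).
Hypothesis muT : (mu setT < +oo)%E.
Local Notation V := (L1 mu).
Local Notation leb := (@lebesgue_measure R).
Variables (S : R -> V -> V) (HS : contraction_semigroup S) (sS : submarkovian S).
Variable T : R.
Local Notation D := (`[0, T]%classic `*` [set: X] : set (measurableTypeR R * X)).

(** The excess satisfies the requirements of [conv_comparison] on [Psi], and [excess_step] at fixed
    t supplies the rate, namely the integral of [k (t, x)] in x. *)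
Lemma excess_comparison (delta : R) (h y : R -> V)
    (r : measurableTypeR R * X -> R) (k : measurableTypeR R * X -> \bar R) :
  0 < delta ->
  smeasI T h ->
  (\int[leb]_(t in `[0%R, T]) `|h t|%:E < +oo)%E ->
  (forall t, 0 <= t <= T -> conv S h t (y t)) ->
  measurable_fun setT k -> (forall tx, 0 <= k tx)%E ->
  {ae leb, forall t, 0 <= t <= T -> {ae mu, forall x,
    0 <= ((- y t : V) x - r (t, x)) * h t x /\
    (delta <= `|r (t, x)| -> (`|h t x|%:E <= k (t, x))%E)}} ->
  forall b, 0 <= b <= T ->
  ((excess delta (- y b))%:E <= \int[leb \x^ mu]_(tx in D) k tx)%E.
Proof.
move=> delta0 mh ih cy mk k0 hk b bT.
have [mK KE] := lebesgue_prod_tonelli_itv muT (T := T) (measurable_funTS mk) k0.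
have /andP[b0 b_T] := bT.
apply: (@le_trans _ _ (\int[leb]_(t in `[0%R, b]) \int[mu]_x k (t, x))%E); last first.
  rewrite KE; apply: ge0_subset_integral => //.
  - by move=> t _; exact: integral_ge0.
  - by move=> t /=; rewrite !in_itv/= => /andP[-> /le_trans]; apply.
apply: (conv_comparison HS mh ih cy (Psi := excess delta)) => //.
- apply: (excess0 delta0); apply: filterS (L10 mu) => x ->.
  by rewrite normr0 ltW.
- by move=> u v; exact: (excess_lipschitz delta0).
- by move=> t v t0; exact: (excess_semigroup muT delta0).
- by move=> t; exact: integral_ge0.
apply: (ae_lebesgueS _ hk).
move=> t ht /andP[t0 tT] eps eps0.
apply: (excess_step delta0 (r := fun x => r (t, x))) => //.
  exact: (measurableT_comp mk (pair1_measurable (t : measurableTypeR R))).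
by apply: ht; rewrite (ltW t0).
Qed.

Lemma conv_difference (g1 g2 u1 u2 z : R -> V) : smeasI T g1 -> smeasI T g2 ->
  (\int[leb]_(t in `[0%R, T]) `|g1 t|%:E < +oo)%E ->
  (\int[leb]_(t in `[0%R, T]) `|g2 t|%:E < +oo)%E ->
  (forall t, 0 <= t <= T -> conv S g1 t (z t - u1 t)) ->
  (forall t, 0 <= t <= T -> conv S g2 t (z t - u2 t)) ->
  [/\ smeasI T (fun t => g1 t - g2 t),
      (\int[leb]_(t in `[0%R, T]) `|g1 t - g2 t|%:E < +oo)%E
    & forall t, 0 <= t <= T -> conv S (fun t => g1 t - g2 t) t (u2 t - u1 t)].
Proof.
move=> m1 m2 i1 i2 c1 c2; have mI := @measurable_itvcc R 0 T.
split; first exact: smeasB.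
  apply: (@le_lt_trans _ _ (\int[leb]_(t in `[0%R, T]) (`|g1 t|%:E + `|g2 t|%:E))%E).
    by apply: le_integral_ge0 => // t _; rewrite -EFinD lee_fin ler_normB.
  rewrite ge0_integralD//; last 2 first.
  - exact: smeas_normE.
  - exact: smeas_normE.
  exact: lte_add_pinfty.
move=> t tT; have -> : u2 t - u1 t = (z t - u1 t) - (z t - u2 t).
  by rewrite opprB [RHS]addrC subrKA.
apply: (eq_bochner _ (bochnerB (@measurable_itvcc R 0 t) (c1 _ tT) (c2 _ tT))).
move=> s /set_mem /=; rewrite in_itv/= => /andP[_ st].
by rewrite (semigroupB HS)// subr_ge0.
Qed.

(** With r = 0 and k = 0 the sign condition of [excess_comparison] is exactly the monotonicity of
    the graph. Every excess of [u1 - u2] is thus zero, and the height [delta] is arbitrary. *)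
Lemma mild_pathwise_unique (f : R -> R) (g1 g2 u1 u2 z : R -> V) :
  {homo f : x y / x <= y} ->
  smeasI T g1 ->
  smeasI T g2 ->
  (\int[leb]_(t in `[0%R, T]) `|g1 t|%:E < +oo)%E ->
  (\int[leb]_(t in `[0%R, T]) `|g2 t|%:E < +oo)%E ->
  (forall t, 0 <= t <= T -> conv S g1 t (z t - u1 t)) ->
  (forall t, 0 <= t <= T -> conv S g2 t (z t - u2 t)) ->
  {ae leb, forall t, 0 <= t <= T ->
    {ae mu, forall x, monotone_extension f (u1 t x) (g1 t x)}} ->
  {ae leb, forall t, 0 <= t <= T ->
    {ae mu, forall x, monotone_extension f (u2 t x) (g2 t x)}} ->
  forall t, 0 <= t <= T -> u1 t = u2 t.
Proof.
move=> f_incr m1 m2 i1 i2 c1 c2 h1 h2 b bT.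
pose h t := g1 t - g2 t; pose y t := u2 t - u1 t.
have [mh ih cy] := conv_difference m1 m2 i1 i2 c1 c2.
have ex0 (delta : R) : 0 < delta -> excess delta (- y b) <= 0.
  move=> delta0; rewrite -lee_fin.
  have := @excess_comparison delta h y (fun=> 0) (fun=> 0%E) delta0 mh ih cy
    (measurable_cst _) (fun=> lexx _).
  move=> /(_ _ b bT); rewrite integral0; apply.
  apply: (ae_lebesgueS2 _ h1 h2) => t t1 t2 tT.
  apply: filterS3 (filterI (L1N (y t)) (L1B (u2 t) (u1 t))) (L1B (g1 t) (g2 t))
    (filterI (t1 tT) (t2 tT)) => x [-> ->] -> [e1 e2]; split.
    by rewrite subr0 opprB; exact: (monotone_extension_mono f_incr).
  by rewrite normr0 leNgt delta0.
apply/eqP; rewrite eq_sym -subr_eq0 -normr_eq0 eq_le normr_ge0 andbT.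
rewrite -normrN; apply/ler_addgt0Pr => eps eps0; rewrite add0r.
have V0 : 0 <= fine (mu setT) by exact: fine_ge0.
pose delta := eps / (fine (mu setT) + 1).
have delta0 : 0 < delta by rewrite divr_gt0// ltr_wpDl.
apply: le_trans (norm_excess muT delta0 _) _.
rewrite -[eps]add0r lerD//; first exact: ex0.
by rewrite /delta mulrAC ler_pdivrMr ?ltr_wpDl// ler_wpM2l ?(ltW eps0)// lerDl.
Qed.

End pathwise.

Section represented.
Context d (X : measurableType d) (R : realType) (mu : {measure set X -> \bar R}).
Hypothesis muT : (mu setT < +oo)%E.
Local Notation V := (L1 mu).
Local Notation leb := (@lebesgue_measure R).
Variables (T : R).
Local Notation D := (`[0, T]%classic `*` [set: X] : set (measurableTypeR R * X)).

Lemma measurable_section (gam : measurableTypeR R * X -> R) t : 0 <= t <= T ->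
  measurable_fun D gam -> measurable_fun setT (fun x => gam (t, x)).
Proof.
move=> tT mgam; have mg := (measurable_restrictT gam (@measurable_itv_prod _ X _ T)).1 mgam.
apply: (eq_measurable_fun (fun x => (gam \_ D) (t, x))).
  move=> x _; have Dtx : D (t, x) by split => //=; rewrite in_itv.
  by rewrite patchE mem_set.
exact: (measurableT_comp mg (pair1_measurable (t : measurableTypeR R))).
Qed.

Lemma represented_integral (gam : measurableTypeR R * X -> R) (phi : R -> V) :
  measurable_fun D gam ->
  smeasI T phi ->
  {ae leb, forall t, 0 <= t <= T -> {ae mu, forall x, gam (t, x) = phi t x}} ->
  (\int[leb]_(t in `[0%R, T]) `|phi t|%:E = \int[leb \x^ mu]_(z in D) `|gam z|%:E)%E.
Proof.
move=> mgam mphi hgam.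
have mabs : measurable_fun D (fun z => `|gam z|%:E).
  exact: measurable_absE.
have abs0 z : (0 <= `|gam z|%:E)%E by rewrite lee_fin.
have [mK ->] := lebesgue_prod_tonelli_itv muT mabs abs0.
apply: ae_eq_integral => //.
- exact: smeas_normE.
apply: (ae_lebesgueS _ hgam) => t ht.
rewrite /= in_itv/= => tT; apply: L1_norm_ae; first exact: measurable_section.
by apply: filterS (ht tT) => x ->.
Qed.

End represented.

(** * Completeness of L^1(0,T; L^1) *)

Section bochner_completeness.
Context d (X : measurableType d) (R : realType) (mu : {measure set X -> \bar R}).
Local Notation V := (L1 mu).
Local Notation leb := (@lebesgue_measure R).
Variables (T : R).
Local Notation smeasT := (smeasI T).

(** Riesz-Fischer in time and again in space, along a fast subsequence. On [C] the increments are
    summable in L^1, which also gives convergence for a.e. x, as the passage to the limit in the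
    graph requires. Fatou's lemma then gives the convergence of the integrals. *)
Lemma bochner_L1_complete (Y : nat -> R -> V) : (forall n, smeasT (Y n)) ->
  (forall eps : R, 0 < eps -> exists n0, forall n k, (n0 <= n)%N -> (n0 <= k)%N ->
    (\int[leb]_(t in `[0%R, T]) `|Y n t - Y k t|%:E <= eps%:E)%E) ->
  exists (p : nat -> nat) (gh : R -> V) (C : set (measurableTypeR R)),
  [/\ (forall j, (j <= p j)%N),
     smeasT gh /\ (measurable C /\ (forall t, (\1_C t : R) *: Y (p j) t @[j --> \oo] --> gh t)),
     (\int[leb]_(t in `[0%R, T]) `|Y (p j) t - gh t|%:E)%E @[j --> \oo] --> 0%E,
     {ae leb, forall t, 0 <= t <= T -> C t}
   & forall t, C t -> Y (p j) t @[j --> \oo] --> gh t /\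
       {ae mu, forall x, Y (p j) t x @[j --> \oo] --> gh t x}].
Proof.
move=> mY cY.
have g0 k : 0 < 1 / (2 ^ (k + 1))%:R :> R by rewrite divr_gt0// ltr0n expn_gt0.
have [N HN] := choice (fun k => cY _ (g0 k)).
have [p [pN pS kp]] := dominating_subsequence N.
have mI := @measurable_itvcc R 0 T.
pose q j t := `|Y (p j.+1) t - Y (p j) t|%:E.
have mB n k : measurable_fun (`[0, T]%classic : set (measurableTypeR R))
    (fun t => `|Y n t - Y k t|%:E).
  by apply: smeas_normE; exact: smeasB.
have mq j : measurable_fun (`[0, T]%classic : set (measurableTypeR R)) (q j) by exact: mB.
have q0 j t : (0 <= q j t)%E by rewrite lee_fin.
pose Q t := (\sum_(0 <= j <oo) q j t)%E.
have [|mQ intQ Qfin] := @ae_summable _ _ _ leb _ q mI mq q0.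
  apply: (@le_lt_trans _ _ (\sum_(0 <= k <oo) (1 / (2 ^ (k + 1))%:R)%:E)%E).
    apply: lee_nneseries => [k _ _|k _]; first exact: integral_ge0.
    by apply: HN; [exact: leq_trans (pN k) (ltnW (pS k))|exact: pN].
  have /cvg_lim -> // := @cvg_geometric_eseries_half R 1 0.
  exact: ltry.
pose C : set (measurableTypeR R) := `[0, T]%classic `&` [set t | (Q t < +oo)%E].
have mC : measurable C by exact: (emeasurable_fun_infty_o mI mQ +oo%E).
have CT t : C t -> 0 <= t <= T by move=> [] /=; rewrite in_itv.
have aeC : {ae leb, forall t, 0 <= t <= T -> C t}.
  apply: (ae_lebesgueS _ Qfin) => t h tT.
  have tT' : `[0, T]%classic t by rewrite /= in_itv.
  by split=> //=; exact: h.
have HC t : exists v : V, C t -> Y (p j) t @[j --> \oo] --> v /\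
       {ae mu, forall x, Y (p j) t x @[j --> \oo] --> v x}.
  have [[tT Qt]|nC] := pselect (C t); last by exists 0.
  by have [v vP] := @L1_summable_cvg _ _ _ _ (fun j => Y (p j) t) Qt; exists v.
have [gh0 Hgh0] := choice HC.
pose gh t := (\1_C t : R) *: gh0 t.
have ghC t : C t -> gh t = gh0 t by move=> Ct; rewrite /gh indicE mem_set// scale1r.
have cvgC t : (\1_C t : R) *: Y (p j) t @[j --> \oo] --> gh t.
  rewrite /gh indicE; case: (boolP (t \in C)) => [/set_mem Ct|_].
    by apply: cvgZr; have [] := Hgh0 t Ct.
  rewrite scale0r; under eq_fun do rewrite scale0r.
  exact: cvg_cst.
have mgh : smeasT gh.
  apply: (@smeas_cvg _ _ _ _ _ (fun j t => (\1_C t : R) *: Y (p j) t)) => //.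
  by move=> j; exact: smeas_indic.
exists p, gh, C; split => //; last by move=> t Ct; rewrite ghC//; exact: Hgh0.
apply/ge0_cvge0P => [j|eps eps0]; first exact: integral_ge0.
have [n0 Hn0] := cY _ eps0; exists n0 => j n0j.
pose F k t := `|Y (p j) t - Y (p k) t|%:E.
apply: (@le_trans _ _ (\int[leb]_(t in `[0%R, T]) limn_einf (F ^~ t))%E).
  apply: ae_ge0_le_integral => //.
  - by apply: smeas_normE; exact: smeasB.
  - move=> t _; apply: limn_einf_ge => e e0; exists 0%N => n _.
    by rewrite lee_fin sub0r (@le_trans _ _ 0)// oppr_le0 ltW.
  - by apply: measurable_limn_einf => k; exact: mB.
  apply: (ae_lebesgueS _ aeC) => t Ct tT.
  have {}Ct : C t by apply: Ct; move: tT; rewrite /= in_itv.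
  apply: limn_einf_ge => e e0.
  have [+ _] := Hgh0 t Ct; rewrite -ghC// => /cvgrPdist_le/(_ _ e0)[k0 _ Hk0].
  exists k0 => k k0k; rewrite lee_fin lerBlDr.
  rewrite (le_trans (ler_distD (Y (p k) t) _ _))// lerD2l distrC.
  exact: (Hk0 k k0k).
have mF k : measurable_fun (`[0, T]%classic : set (measurableTypeR R)) (F k).
  exact: mB.
have F0 k t : `[0, T]%classic t -> (0 <= F k t)%E by rewrite lee_fin.
apply: le_trans (fatou leb mI mF F0) _.
apply: limn_einf_le; exists n0 => k n0k; apply: Hn0.
  exact: leq_trans n0j (kp j).
exact: leq_trans n0k (kp k).
Qed.

Lemma L1_sum (I : Type) (s : seq I) (c : I -> R) (a : I -> V) :
  {ae mu, forall x, (\sum_(i <- s) c i *: a i : V) x = \sum_(i <- s) c i * a i x}.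
Proof.
elim: s => [|i s IH]; first by rewrite big_nil; apply: filterS (L10 mu) => x ->; rewrite big_nil.
rewrite big_cons.
apply: filterS3 (L1D (c i *: a i) (\sum_(i <- s) c i *: a i)) (L1Z (c i) (a i)) IH.
by move=> x -> -> ->; rewrite big_cons.
Qed.

Lemma bochner_sum d' (Y : measurableType d') (nu : {measure set Y -> \bar R})
    (E : set Y) (I : Type) (s : seq I) (c : I -> R) (h : I -> Y -> V) (v : I -> V) :
  measurable E -> (nu E < +oo)%E -> (forall i, bochner_integral nu E (h i) (v i)) ->
  bochner_integral nu E (fun y => \sum_(i <- s) c i *: h i y) (\sum_(i <- s) c i *: v i).
Proof.
move=> mE nuE hv; elim: s => [|i s IH].
  rewrite big_nil; have := bochner_cst (0 : V) mE nuE; rewrite scaler0.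
  by apply: eq_bochner => y _; rewrite big_nil.
rewrite big_cons; apply: (eq_bochner _ (bochner_comb (c i) mE (hv i) IH)) => y _.
by rewrite big_cons.
Qed.

End bochner_completeness.

(** * Monotone graphs and limits of averages *)

Section monotone_limit.
Context (R : realType) (f : R -> R).
Hypothesis f_incr : {homo f : x y / x <= y}.

Lemma weighted_ge n N (c G : nat -> R) (a : R) : tail_weights n N c ->
  (forall m, (n <= m)%N -> a <= G m) -> a <= \sum_(0 <= m < N) c m * G m.
Proof.
move=> [c0 cN c1] aG; rewrite -[a]mul1r -c1 mulr_suml; apply: ler_sum => m _.
have [->|/cN/andP[nm _]] := eqVneq (c m) 0; first by rewrite !mul0r.
by rewrite ler_wpM2l// aG.
Qed.

Lemma weighted_le n N (c G : nat -> R) (a : R) : tail_weights n N c ->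
  (forall m, (n <= m)%N -> G m <= a) -> \sum_(0 <= m < N) c m * G m <= a.
Proof.
move=> w Ga; rewrite -lerN2 -sumrN; under eq_bigr do rewrite -mulrN.
by apply: (weighted_ge w) => m /Ga; rewrite lerN2.
Qed.

(** For y < U one has y < J m, hence [f y <= G m], for all m in a tail. An inequality with a fixed
    bound survives averaging over the tail, so it is enough that averages of [G] converge. *)
Lemma monotone_extension_limit (J G : nat -> R) (U Gl : R)
    (N : nat -> nat) (c : nat -> nat -> R) (p : nat -> nat) :
  (forall m, monotone_extension f (J m) (G m)) -> J m @[m --> \oo] --> U ->
  (forall n, tail_weights n (N n) (c n)) -> (forall j, (j <= p j)%N) ->
  (\sum_(0 <= m < N (p j)) c (p j) m * G m) @[j --> \oo] --> Gl ->
  monotone_extension f U Gl.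
Proof.
move=> JG JU w jp cG; apply/(monotone_extensionP f_incr); split=> y yU.
  have d0 : 0 < U - y by rewrite subr_gt0.
  have /cvgrPdist_lt/(_ _ d0)[M _ HM] := JU.
  rewrite -(cvg_lim (@Rhausdorff R) cG); apply: limr_ge; first by apply/cvg_ex; exists Gl.
  exists M => // j /= Mj; apply: (weighted_ge (w _)) => m pm.
  have := HM m (leq_trans Mj (leq_trans (jp j) pm)).
  rewrite /= => /(le_lt_trans (ler_norm _)) h.
  have [+ _] := (monotone_extensionP f_incr _ _).1 (JG m); apply.
  by move: h; rewrite ltrD2l ltrN2.
have d0 : 0 < y - U by rewrite subr_gt0.
have /cvgrPdist_lt/(_ _ d0)[M _ HM] := JU.
rewrite -(cvg_lim (@Rhausdorff R) cG); apply: limr_le; first by apply/cvg_ex; exists Gl.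
exists M => // j /= Mj; apply: (weighted_le (w _)) => m pm.
have := HM m (leq_trans Mj (leq_trans (jp j) pm)).
rewrite /= distrC => /(le_lt_trans (ler_norm _)) h.
have [_] := (monotone_extensionP f_incr _ _).1 (JG m); apply.
by move: h; rewrite ltrD2r.
Qed.

End monotone_limit.

Lemma weighted_cvg (R : realType) (V : normedModType R) (N : nat -> nat) (c : nat -> nat -> R) (p : nat -> nat)
    (v : nat -> V) (w : V) :
  (forall n, tail_weights n (N n) (c n)) -> (forall j, (j <= p j)%N) ->
  v n @[n --> \oo] --> w ->
  \sum_(0 <= m < N (p j)) c (p j) m *: v m @[j --> \oo] --> w.
Proof.
move=> wc jp vw; apply/cvgrPdist_le => eps eps0.
have /cvgrPdist_le/(_ _ eps0)[M _ HM] := vw.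
exists M => // j /= Mj.
have [c0 cN c1] := wc (p j).
have wE : w = \sum_(0 <= m < N (p j)) c (p j) m *: w.
  by rewrite -scaler_suml c1 scale1r.
have epsE : eps = \sum_(0 <= m < N (p j)) c (p j) m * eps.
  by rewrite -mulr_suml c1 mul1r.
rewrite {1}wE [leRHS]epsE -sumrB (le_trans (ler_norm_sum _ _ _))//.
apply: ler_sum => m _.
have [->|/cN/andP[nm _]] := eqVneq (c (p j) m) 0.
  by rewrite !scale0r subrr normr0 mul0r.
rewrite -scalerBr normrZ ger0_norm// ler_wpM2l//.
exact: (HM m (leq_trans Mj (leq_trans (jp j) nm))).
Qed.

(** * Convergence of the regularised paths *)

Section approximation.
Context d (X : measurableType d) (R : realType) (mu : {measure set X -> \bar R}).
Hypothesis muT : (mu setT < +oo)%E.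
Local Notation V := (L1 mu).
Local Notation leb := (@lebesgue_measure R).
Variables (S : R -> V -> V) (HS : contraction_semigroup S) (sS : submarkovian S).
Variables (T : R) (T0 : 0 < T).
Local Notation D := (`[0, T]%classic `*` [set: X] : set (measurableTypeR R * X)).
Variables (f : R -> R) (f_incr : {homo f : x y / x <= y}).
Variables (lam : nat -> R) (lam_gt0 : forall n, 0 < lam n).
Variables (u : nat -> R -> V) (z : R -> V).
Variables (gam : nat -> measurableTypeR R * X -> R).
Local Notation g n t := (nemytskii (yosida f (lam n)) (u n t)).
Hypothesis cu : forall n, {within `[0, T], continuous (u n)}.
Hypothesis convu : forall n t, 0 <= t <= T -> conv S (fun s => g n s) t (z t - u n t).
Hypothesis mgam : forall n, measurable_fun D (gam n).
Hypothesis gamE : forall n, {ae leb, forall t, 0 <= t <= T ->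
  {ae mu, forall x, gam n (t, x) = g n t x}}.
Hypothesis equi_gam : equiintegrable (leb \x^ mu)%E D setT gam.

Lemma yosida_path_continuous n : {within `[0, T], continuous (fun t => g n t)}.
Proof.
apply/within_continuous_dist => t tT eps eps0.
have [del del0 Hdel] := (within_continuous_dist _ _).1 (@cu n) t tT _ (mulr_gt0 (lam_gt0 n) eps0).
exists del => // s sT st; have := Hdel s sT st.
rewrite mulrC -ltr_pdivrMr// mulrC; apply: le_lt_trans.
exact: (L1_nemytskii_lipschitz _ _ muT (yosida_lipschitz f_incr (lam_gt0 n))).
Qed.

Lemma yosida_path_smeas n :
  smeasI T (fun t => g n t).
Proof. by apply: (smeas_continuous T0); exact: yosida_path_continuous. Qed.

Lemma yosida_path_integral n : (\int[leb]_(t in `[0%R, T]) `|g n t|%:E =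
  \int[leb \x^ mu]_(tx in D) `|gam n tx|%:E)%E.
Proof.
by apply: represented_integral => //; exact: yosida_path_smeas.
Qed.

Lemma yosida_path_bound : exists2 M : R, 0 <= M & forall n,
  (\int[leb]_(t in `[0%R, T]) `|g n t|%:E <= M%:E)%E.
Proof.
have [[M HM] _] := equi_gam; exists M.
  by rewrite -lee_fin (le_trans _ (HM 0%N I))// integral_ge0.
by move=> n; rewrite yosida_path_integral; exact: HM.
Qed.

(** As [lam n * gam n] tends to 0 in L^1, Chebyshev's inequality brings the measure of the domain of
    integration below the threshold of equiintegrability. *)
Lemma gam_large_small (delta eps : R) : lam n @[n --> \oo] --> 0 -> 0 < delta -> 0 < eps ->
  exists N, forall n m, (N <= n)%N -> (N <= m)%N ->
  (\int[leb \x^ mu]_(tx in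
      D `&` [set tx | delta <= `|lam n * gam n tx - lam m * gam m tx|]%R)
     `|gam n tx - gam m tx|%:E <= eps%:E)%E.
Proof.
move=> lam_cvg delta0 eps0; have [[M HM] equi] := equi_gam.
have M0 : 0 <= M by rewrite -lee_fin (le_trans _ (HM 0%N I))// integral_ge0.
have e2 : 0 < eps / 2 by rewrite divr_gt0.
have [del del0 Hdel] := equi _ e2.
have M1 : 0 < M + 1 by rewrite ltr_wpDl.
(* With this choice each of the two terms [lam * M] is less than a third of [del * delta], so their
   sum stays strictly below it; [M + 1] covers [M = 0]. *)
have e0 : 0 < del * delta / 3 / (M + 1) by rewrite !divr_gt0// mulr_gt0.
have /cvgrPdist_lt/(_ _ e0)[N _ HN] := lam_cvg.
have lamN n : (N <= n)%N -> lam n * M < del * delta / 3.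
  move=> Nn; have := HN _ Nn; rewrite /= sub0r normrN gtr0_norm// => h.
  have : lam n * (M + 1) < del * delta / 3 by rewrite -ltr_pdivlMr.
  by apply: le_lt_trans; rewrite ler_pM2l// lerDl.
exists N => n m Nn Nm.
set E := D `&` _.
have mr : measurable_fun D (fun tx => lam n * gam n tx - lam m * gam m tx).
  by apply: measurable_funB; apply: measurable_funM.
have mD := @measurable_itv_prod _ X _ T.
have mE : measurable E.
  have mrE : measurable_fun D (fun tx => `|lam n * gam n tx - lam m * gam m tx|%:E).
    exact: measurable_absE.
  exact: (emeasurable_fun_c_infty mD mrE delta%:E).
have ED : E `<=` D by move=> tx [].
have mabs k F : measurable F -> F `<=` D -> measurable_fun F (fun tx => `|gam k tx|%:E).
  move=> mF FD; apply: measurable_absE.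
  exact: measurable_funS (@mgam k).
have nuE : ((leb \x^ mu) E < del%:E)%E.
  have : (delta%:E * (leb \x^ mu) E <= (lam n * M + lam m * M)%:E)%E.
    rewrite -integral_cst//.
    apply: (@le_trans _ _ (\int[leb \x^ mu]_(tx in D)
        ((lam n)%:E * `|gam n tx|%:E + (lam m)%:E * `|gam m tx|%:E))%E).
      apply: (@le_trans _ _ (\int[leb \x^ mu]_(tx in E)
        ((lam n)%:E * `|gam n tx|%:E + (lam m)%:E * `|gam m tx|%:E))%E).
        apply: le_integral_ge0 => tx; first by rewrite lee_fin ltW.
        move=> [_ /= h]; rewrite -!EFinM -EFinD lee_fin (le_trans h)//.
        rewrite (le_trans (ler_normB _ _))//.
        by rewrite !normrM !(gtr0_norm (lam_gt0 _)).
      apply: ge0_subset_integral => //.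
        by apply: emeasurable_funD; apply: measurable_funeM; exact: mabs.
      by move=> tx _; rewrite adde_ge0// mule_ge0// lee_fin ltW.
    rewrite ge0_integralD//; last 4 first.
    - by move=> tx _; rewrite mule_ge0// lee_fin ltW.
    - by apply: measurable_funeM; exact: mabs.
    - by move=> tx _; rewrite mule_ge0// lee_fin ltW.
    - by apply: measurable_funeM; exact: mabs.
    rewrite EFinD !EFinM; apply: leeD.
      rewrite ge0_integralZl ?lee_fin ?(ltW (lam_gt0 _))//; last exact: mabs.
      by apply: lee_wpmul2l; [rewrite lee_fin ltW|exact: HM].
    rewrite ge0_integralZl ?lee_fin ?(ltW (lam_gt0 _))//; last exact: mabs.
    by apply: lee_wpmul2l; [rewrite lee_fin ltW|exact: HM].
  rewrite -lee_pdivlMl// -EFinM => /le_lt_trans; apply.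
  rewrite lte_fin ltr_pdivrMl//.
  have := lamN n Nn; have := lamN m Nm; have : 0 < del * delta by rewrite mulr_gt0.
  by rewrite [delta * del]mulrC; move: (del * delta) (lam n * M) (lam m * M) => a b c; lra.
apply: (@le_trans _ _ (\int[leb \x^ mu]_(tx in E) (`|gam n tx|%:E + `|gam m tx|%:E))%E).
  by apply: le_integral_ge0 => // tx _; rewrite -EFinD lee_fin ler_normB.
rewrite ge0_integralD//; last 2 first.
- exact: mabs.
- exact: mabs.
by rewrite (splitr eps) EFinD; apply: leeD; exact: Hdel.
Qed.

(** Here [excess_comparison] is used with [r = lam n * gam n - lam m * gam m]: subtracting it from
    [u n - u m] leaves the difference of the resolvents, whose product with [g n - g m] is
    nonnegative. So [k] is [|gam n - gam m|] on the set where [|r| >= delta], and zero elsewhere. *)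
Lemma approx_uniform_cauchy (eps : R) : lam n @[n --> \oo] --> 0 -> 0 < eps ->
  exists N, forall n m, (N <= n)%N -> (N <= m)%N ->
  forall t, 0 <= t <= T -> `|u n t - u m t| <= eps.
Proof.
move=> lam_cvg eps0.
have V0 : 0 <= fine (mu setT) by exact: fine_ge0.
pose delta := eps / 2 / (fine (mu setT) + 1).
have delta0 : 0 < delta by rewrite !divr_gt0// ltr_wpDl.
have e2 : 0 < eps / 2 by rewrite divr_gt0.
have [N HN] := gam_large_small lam_cvg delta0 e2.
exists N => n m Nn Nm b bT.
pose h t := g n t - g m t; pose y t := u m t - u n t.
pose r tx := lam n * gam n tx - lam m * gam m tx.
have mD := @measurable_itv_prod _ X _ T.
have mr : measurable_fun D r by apply: measurable_funB; apply: measurable_funM.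
pose E := D `&` [set tx | delta <= `|r tx|].
have mE : measurable E.
  have mrE : measurable_fun D (fun tx => `|r tx|%:E).
    exact: measurable_absE.
  exact: (emeasurable_fun_c_infty mD mrE delta%:E).
have ED : E `<=` D by move=> tx [].
have mdiff : measurable_fun D (fun tx => `|gam n tx - gam m tx|%:E).
  apply: measurable_absE; exact: measurable_funB.
pose k := (fun tx => `|gam n tx - gam m tx|%:E) \_ E.
have mk : measurable_fun setT k.
  by apply: (measurable_restrictT _ mE).1; exact: measurable_funS mdiff.
have k0 tx : (0 <= k tx)%E by rewrite /k patchE; case: ifPn.
have ig j : (\int[leb]_(t in `[0%R, T]) `|g j t|%:E < +oo)%E.
  by have [M _ HM] := yosida_path_bound; apply: le_lt_trans (HM j) _; rewrite ltry.
have [mh ih cy] := conv_difference HS (yosida_path_smeas n) (yosida_path_smeas m)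
  (ig n) (ig m) (@convu n) (@convu m).
have exc : excess delta (- y b) <= eps / 2.
  rewrite -lee_fin.
  apply: le_trans (excess_comparison muT HS sS (r := r) delta0 mh ih cy mk k0 _ bT) _.
    apply: (ae_lebesgueS2 _ (@gamE n) (@gamE m)) => t tn tm tT.
    have Yn := yosida_lipschitz f_incr (lam_gt0 n).
    have Ym := yosida_lipschitz f_incr (lam_gt0 m).
    apply: filterS3 (filterI (filterI (L1N (y t)) (L1B (u m t) (u n t))) (L1B (g n t) (g m t)))
      (filterI (tn tT) (tm tT)) (filterI (L1_nemytskiiE (u n t) muT Yn) (L1_nemytskiiE (u m t) muT Ym)).
    move=> x [[-> ->] ->] [e1 e2'] [e3 e4]; split.
      rewrite opprB /r e1 e2' e3 e4.
      rewrite {1}(resolventE f (lam_gt0 n) (u n t x)) {1}(resolventE f (lam_gt0 m) (u m t x)).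
      have := monotone_extension_mono f_incr (resolventP f_incr (lam_gt0 n) (u n t x))
        (resolventP f_incr (lam_gt0 m) (u m t x)).
      by congr (0 <= _ * _); ring.
    move=> rd; rewrite /k patchE mem_set; first by rewrite e1 e2'.
    by split => //; split => //=; rewrite in_itv.
  rewrite /k -integral_mkcondr (setIidr ED).
  exact: HN.
rewrite -opprB -normrN opprK -[u m b - _]opprK normrN.
apply: le_trans (norm_excess muT delta0 _) _.
rewrite [leRHS]splitr lerD//.
by rewrite /delta mulrAC ler_pdivrMr ?ltr_wpDl// ler_wpM2l ?(ltW e2)// lerDl.
Qed.

Variable uu : R -> V.
Hypothesis cvg_u : forall t, 0 <= t <= T -> u n t @[n --> \oo] --> uu t.
Hypothesis sum_u : forall t, 0 <= t <= T ->
  (\sum_(0 <= n <oo) `|u n.+1 t - u n t|%:E < +oo)%E.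
Hypothesis sum_lam : (\sum_(0 <= n <oo) (lam n)%:E < +oo)%E.

Let gsmeas := yosida_path_smeas.

(** The resolvent is [u n - lam n *: g n]. Summability of [lam n] and the bound on the integrals of
    [g n] make [lam n * |g n t|] summable for a.e. t; with [sum_u] the resolvents have summable
    increments in L^1, and therefore converge for a.e. x and not only in norm. *)
Lemma resolvent_path_cvg : {ae leb, forall t, 0 <= t <= T -> {ae mu, forall x,
  resolvent f (lam n) (u n t x) @[n --> \oo] --> uu t x}}.
Proof.
have [M M0 HM] := yosida_path_bound.
have mI := @measurable_itvcc R 0 T.
pose q n t := ((lam n)%:E * `|g n t|%:E)%E.
have mq n : measurable_fun (`[0, T]%classic : set (measurableTypeR R)) (q n).
  by apply: measurable_funeM; exact: smeas_normE.
have q0 n t : (0 <= q n t)%E by rewrite mule_ge0// lee_fin ltW.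
pose Q t := (\sum_(0 <= n <oo) q n t)%E.
have [|_ _] := @ae_summable _ _ _ leb _ q mI mq q0.
  apply: (@le_lt_trans _ _ (\sum_(0 <= k <oo) M%:E * (lam k)%:E)%E).
    apply: lee_nneseries => [k _ _|k _]; first exact: integral_ge0.
    rewrite /q ge0_integralZl ?lee_fin ?(ltW (lam_gt0 _))//; last exact: smeas_normE.
    by rewrite muleC; apply: lee_wpmul2r; [rewrite lee_fin ltW|exact: HM].
  rewrite nneseriesZl; last by move=> n _; rewrite lee_fin ltW.
  by rewrite lte_mul_pinfty// lee_fin.
apply: ae_lebesgueS => t h tT.
have Qt : (Q t < +oo)%E by apply: h; rewrite /= in_itv.
pose J n : V := u n t - lam n *: g n t.
have nlamg n : `|lam n *: g n t| = lam n * `|g n t| by rewrite normrZ gtr0_norm.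
have [|v [Jv Jvx]] := @L1_summable_cvg _ _ _ mu J.
  apply: (@le_lt_trans _ _ (\sum_(0 <= n <oo) `|u n.+1 t - u n t|%:E +
      (\sum_(0 <= n <oo) q n.+1 t + \sum_(0 <= n <oo) q n t))%E).
    rewrite -nneseriesD//; [|by move=> *; exact: q0..].
    rewrite -nneseriesD//; last by move=> n _ _; apply: adde_ge0; exact: q0.
    apply: lee_nneseries => [n _ _|n _]; first by rewrite lee_fin.
    rewrite /q -!EFinM -!EFinD lee_fin /J.
    rewrite (_ : u n.+1 t - lam n.+1 *: g n.+1 t - (u n t - lam n *: g n t) =
      (u n.+1 t - u n t) + (- (lam n.+1 *: g n.+1 t) + lam n *: g n t)); last first.
      by rewrite opprD opprK addrACA.
    rewrite (le_trans (ler_normD _ _))// lerD2l (le_trans (ler_normD _ _))//.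
    by rewrite normrN !nlamg.
  have shift : (\sum_(0 <= n <oo) q n.+1 t <= Q t)%E.
    have -> : (\sum_(0 <= n <oo) q n.+1 t = \sum_(1 <= n <oo) q n t)%E.
      rewrite -(@nneseries_addn R (fun n => q n t) 1)//.
      by apply: eq_eseriesr => n _; rewrite addn1.
    rewrite /Q (@nneseries_recl _ xpredT (fun n => q n t))//.
    by rewrite leeDr.
  rewrite lte_add_pinfty ?sum_u// lte_add_pinfty//.
  exact: le_lt_trans shift Qt.
have lamg0 : lam n *: g n t @[n --> \oo] --> (0 : V).
  have q_cvg : q n t @[n --> \oo] --> 0%E.
    apply: (@squeeze_cvge0 _ _ (fun n => \sum_(n <= k <oo) q k t)%E).
    - by move=> n; exact: q0.
    - move=> n; have <- : (\sum_(n <= k < n.+1) q k t = q n t)%E by rewrite big_nat1.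
      by apply: nneseries_lim_ge => *; exact: q0.
    - by apply: nneseries_tail_cvg => // k _; exact: q0.
  apply/cvgr0Pnorm_le => eps eps0.
  have [N HN] := (ge0_cvge0P (fun n => q0 n t)).1 q_cvg _ eps0.
  by exists N => // n /= /HN; rewrite /q -EFinM lee_fin nlamg.
have Juu : J n @[n --> \oo] --> uu t.
  by rewrite -[uu t]subr0; apply: cvgB => //; exact: cvg_u.
have <- : v = uu t by apply: (cvg_unique _ Jv Juu); exact: norm_hausdorff.
have aeN : {ae mu, forall x n, J n x = resolvent f (lam n) (u n t x)}.
  apply/ae_foralln => n.
  have Yn := yosida_lipschitz f_incr (lam_gt0 n).
  apply: filterS3 (L1B (u n t) (lam n *: g n t)) (L1Z (lam n) (g n t)) (L1_nemytskiiE (u n t) muT Yn).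
  move=> x -> -> ->.
  by rewrite {1}(resolventE f (lam_gt0 n) (u n t x)) addrK.
apply: filterS2 Jvx aeN => x h1 h2; apply: cvg_trans h1; apply: near_eq_cvg.
by apply: nearW => n; rewrite h2.
Qed.

Lemma prod_itv_finite : ((leb \x^ mu) D < +oo)%E.
Proof.
have mI := @measurable_itvcc R 0 T.
have -> : ((leb \x^ mu) D = leb `[0%R, T]%classic * mu setT)%E.
  by rewrite product_measure2E.
by rewrite lte_mul_pinfty// ?ge0_fin_numE//; exact: (@lebesgue_itv_lty _ _ 0 T).
Qed.

Lemma limit_solution : exists gh : R -> V,
  [/\ smeasI T gh, (\int[leb]_(t in `[0%R, T]) `|gh t|%:E < +oo)%E,
      forall t, 0 <= t <= T -> conv S gh t (z t - uu t)
    & {ae leb, forall t, 0 <= t <= T ->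
        {ae mu, forall x, monotone_extension f (uu t x) (gh t x)}}].
Proof.
have mI := @measurable_itvcc R 0 T.
have mD := @measurable_itv_prod _ X _ T.
have [N [c [wc cauchy_c]]] := convex_tail_cauchy mD prod_itv_finite mgam equi_gam.
pose Y n t : V := \sum_(0 <= m < N n) c n m *: g m t.
have mY n : smeasI T (Y n).
  by apply: smeas_sum => m; apply: smeasZ; exact: yosida_path_smeas.
have aeY n : {ae leb, forall t, 0 <= t <= T ->
    {ae mu, forall x, combination gam (N n) (c n) (t, x) = Y n t x}}.
  have : {ae leb, forall t, forall m, 0 <= t <= T -> {ae mu, forall x, gam m (t, x) = g m t x}}.
    by apply: ae_foralln => m; exact: gamE.
  apply: ae_lebesgueS => t h tT.
  have : {ae mu, forall x, forall m, gam m (t, x) = g m t x}.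
    by apply: ae_foralln => m; exact: h.
  apply: filterS2 (L1_sum (index_iota 0 (N n)) (c n) (fun m => g m t : V)) => x E1 E2.
  by rewrite /combination E1; apply: eq_bigr => m _; rewrite E2.
have cY (eps : R) : 0 < eps -> exists n0, forall n k, (n0 <= n)%N -> (n0 <= k)%N ->
    (\int[leb]_(t in `[0%R, T]) `|Y n t - Y k t|%:E <= eps%:E)%E.
  move=> eps0; have [n0 Hn0] := cauchy_c eps eps0; exists n0 => n k n0n n0k.
  rewrite (@represented_integral _ _ _ _ muT _ (fun tx =>
    combination gam (N n) (c n) tx - combination gam (N k) (c k) tx) (fun t => Y n t - Y k t)).
  - exact: Hn0.
  - by apply: measurable_funB; exact: measurable_combination.
  - exact: smeasB.
  - apply: (ae_lebesgueS2 _ (aeY n) (aeY k)) => t tn tk tT.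
    by apply: filterS3 (L1B (Y n t) (Y k t)) (tn tT) (tk tT) => x -> -> ->.
have [p [gh [C [jp [mgh [mC cvgC]] cvgI aeC HC]]]] := bochner_L1_complete mY cY.
exists gh; split => //.
- have I0 j : (0 <= \int[leb]_(t in `[0%R, T]) `|Y (p j) t - gh t|%:E)%E.
    exact: integral_ge0.
  have [n0 Hn0] := (ge0_cvge0P I0).1 cvgI 1 ltr01.
  have {Hn0} := Hn0 n0 (leqnn _); set n := p n0 => Hn.
  have [[M HM] _] := equi_gam.
  have YM : (\int[leb]_(t in `[0%R, T]) `|Y n t|%:E <= M%:E)%E.
    rewrite (@represented_integral _ _ _ _ muT _ (combination gam (N n) (c n)) (Y n)) //.
      by apply: (integral_combination_le mD mgam mD (@subset_refl _ _) (wc n)) => m; exact: HM.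
    exact: measurable_combination.
  apply: (@le_lt_trans _ _ (\int[leb]_(t in `[0%R, T]) (`|Y n t|%:E + `|Y n t - gh t|%:E))%E).
    apply: le_integral_ge0 => // t _; rewrite -EFinD lee_fin.
    by rewrite -lerBlDl (le_trans (lerB_dist _ _))// distrC.
  rewrite ge0_integralD//; last 2 first.
  - exact: smeas_normE.
  - by apply: smeas_normE; exact: smeasB.
  by apply: lte_add_pinfty; [apply: le_lt_trans YM _|apply: le_lt_trans Hn _]; rewrite ltry.
- move=> t tT; have /andP[t0 t_T] := tT.
  have mt := @measurable_itvcc R 0 t.
  have tsub : `[0, t] `<=` `[0, T].
    by move=> s /=; rewrite !in_itv/= => /andP[-> /le_trans]; apply.
  have lebt : (leb `[0%R, t] < +oo)%E by exact: (@lebesgue_itv_lty _ _ 0 t).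
  (* Convolution is linear, so [Y n] solves the equation averaged with the same weights; the
     averages of [z - u m] over tails have the limit of the sequence. *)
  have convY n : bochner_integral leb `[0, t] (fun s => S (t - s) (Y n s))
      (\sum_(0 <= m < N n) c n m *: (z t - u m t)).
    apply: (eq_bochner _ (bochner_sum (index_iota 0 (N n)) (c n) mt lebt (fun m => @convu m t tT))).
    move=> s /set_mem/=; rewrite in_itv/= => /andP[_ st].
    rewrite /Y; elim: (index_iota 0 (N n)) => [|m l IH].
      by rewrite !big_nil semigroup0// subr_ge0.
    by rewrite !big_cons semigroupD ?subr_ge0// semigroupZ ?subr_ge0// IH.
  apply: (bochner_limit mt (fun j => convY (p j))).
  + apply: (@smeas_cvg _ _ _ _ _ (fun j s => (\1_C s : R) *: S (t - s) (Y (p j) s))) => //.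
      by move=> j; apply: smeas_indic => //; case: (convY (p j)).
    move=> s /=; rewrite in_itv/= => /andP[s0 st].
    have ts0 : 0 <= t - s by rewrite subr_ge0.
    under eq_fun do rewrite -(semigroupZ HS)//.
    by apply: (cvg_comp _ _ (cvgC s)); exact: (semigroup_continuous HS ts0).
  + apply: squeeze_cvge0 cvgI => j; first exact: integral_ge0.
    apply: (@le_trans _ _ (\int[leb]_(s in `[0%R, t]) `|Y (p j) s - gh s|%:E)%E).
      apply: le_integral_ge0 => // s /=; rewrite in_itv/= => /andP[s0 st].
      have ts0 : 0 <= t - s by rewrite subr_ge0.
      by rewrite lee_fin -(semigroupB HS)//; exact: (semigroup_norm HS).
    apply: ge0_subset_integral => //.
    by apply: smeas_normE; exact: smeasB.
  + apply: (weighted_cvg wc jp); apply: cvgB; first exact: cvg_cst.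
    exact: cvg_u.
- have aeR : {ae leb, forall t, 0 <= t <= T -> {ae mu, forall x,
    resolvent f (lam n) (u n t x) @[n --> \oo] --> uu t x}} by exact: resolvent_path_cvg.
  apply: (ae_lebesgueS2 _ aeR aeC) => t hR hC tT.
  have [_ hx] := HC t (hC tT).
  have gY : {ae mu, forall x m, g m t x = yosida f (lam m) (u m t x)}.
    apply: ae_foralln => m; apply: (L1_nemytskiiE (u m t) muT).
    exact: (yosida_lipschitz f_incr (lam_gt0 m)).
  have sY : {ae mu, forall x n, Y n t x = \sum_(0 <= m < N n) c n m * g m t x}.
    by apply: ae_foralln => n; exact: L1_sum.
  apply: filterS3 (hR tT) hx (filterI gY sY) => x h1 h2 [h3 h4].
  apply: (monotone_extension_limit f_incr (J := fun m => resolvent f (lam m) (u m t x))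
    (G := fun m => g m t x) _ h1 wc jp).
    by move=> m; rewrite h3; exact: (resolventP f_incr (lam_gt0 m)).
  by apply: cvg_trans h2; apply: near_eq_cvg; apply: nearW => j; rewrite h4.
Qed.

End approximation.

(** * The Euler scheme *)

Section euler_scheme.
Context (R : realType) (V : normedModType R).
Variables (S : R -> V -> V) (HS : contraction_semigroup S).
Local Notation leb := (@lebesgue_measure R).

(** Near each tau both [g s] and [S (s - s') (g s')] are close to [g tau]; compactness of [[0, T]]
    makes the radius uniform. *)
Lemma semigroup_uniform_modulus (T : R) (g : R -> V) (eps : R) :
  {within `[0, T], continuous g} -> 0 < eps ->
  exists2 del : R, 0 < del & forall s' s, 0 <= s' -> s' <= s -> s <= T ->
    s - s' < del -> `|g s - S (s - s') (g s')| <= eps.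
Proof.
move=> /within_continuous_dist cg eps0.
have /compact_near_coveringP cpt := @segment_compact R 0 T.
pose P (del s' : R) := forall s, 0 <= s' -> s' <= s -> s <= T ->
    s - s' < del -> `|g s - S (s - s') (g s')| <= eps.
have e4 : 0 < eps / 4 by rewrite divr_gt0.
have : \forall del \near 0^'+, `[0, T]%classic `<=` P del.
  apply: cpt => tau tauT.
  have [d1 d10 Hd1] := cg tau tauT _ e4.
  have [d2 d20 Hd2] := semigroup_small HS (g tau) e4.
  exists (ball tau (d1 / 2), [set del | 0 < del < Num.min (d1 / 2) d2]).
    split=> /=; first by apply: nbhsx_ballx; rewrite divr_gt0.
    near=> del; apply/andP; split; first by near: del; exact: nbhs_right_gt.
    by near: del; apply: nbhs_right_lt; rewrite lt_min d20 divr_gt0.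
  move=> [s' del] /= [bs' /andP[del0]]; rewrite lt_min => /andP[dd1 dd2] s s'0 s's sT ss'.
  have r0 : 0 <= s - s' by rewrite subr_ge0.
  have s'T : 0 <= s' <= T by rewrite s'0 (le_trans s's).
  have sT' : 0 <= s <= T by rewrite (le_trans s'0).
  have n1 : `|s' - tau| < d1 / 2 by rewrite distrC.
  have n2 : `|s - tau| < d1.
    rewrite (le_lt_trans (ler_distD s' _ _))// [ltRHS]splitr ltrD//.
    by rewrite ger0_norm// (lt_trans ss').
  have h1 : `|g s - g tau| < eps / 4 by exact: Hd1.
  have h2 : `|g s' - g tau| < eps / 4.
    by apply: Hd1 => //; rewrite (lt_trans n1)// ltr_pdivrMr// ltr_pMr// ltr1n.
  have h3 : `|S (s - s') (g tau) - g tau| < eps / 4.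
    by apply: Hd2; rewrite r0/= (lt_trans ss').
  have h4 : `|S (s - s') (g tau) - S (s - s') (g s')| < eps / 4.
    by rewrite -(semigroupB HS)// (le_lt_trans (semigroup_norm HS _ r0))// distrC.
  have t1 := ler_distD (g tau) (g s) (S (s - s') (g s')).
  have t2 := ler_distD (S (s - s') (g tau)) (g tau) (S (s - s') (g s')).
  rewrite distrC in h3; lra.
move=> H.
have gt0 : \forall del \near (0 : R)^'+, 0 < del by exact: nbhs_right_gt.
have [del [Hdel del0]] : exists del, `[0, T]%classic `<=` P del /\ 0 < del.
  near ((0 : R)^'+) => del; exists del; split; first by near: del; exact: H.
  by near: del; exact: gt0.
exists del => // s' s s'0 s's sT.
by apply: Hdel => //; rewrite /= in_itv/= s'0 (le_trans s's).
Unshelve. all: by end_near. Qed.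

Variables (F : V -> V) (L : R) (L0 : 0 <= L) (FL : forall x y, `|F x - F y| <= L * `|x - y|).

(** An approximation of [z - u = S * F(u)] at time k r, with u replaced by z minus the current
    value. Only values of z at earlier grid times enter, which is what makes the scheme adapted. *)
Fixpoint euler (z : R -> V) (r : R) (k : nat) : V :=
  if k is k'.+1 then S r (euler z r k' + r *: F (z (k'%:R * r) - euler z r k'))
  else 0.

Lemma euler_error_split r (a b c x e : V) : 0 <= r ->
  S r (a + r *: b) - c =
    S r ((a - x) + r *: (b - e)) - (c - S r x - r *: S r e).
Proof.
move=> r0.
rewrite (semigroupD HS _ (r *: b))// (semigroupD HS (a - x))// !(semigroupZ HS)// !(semigroupB HS)//.
move: (S r a) (S r b) (S r x) (S r e) => a' b' d e'; rewrite scalerBr.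
move: (r *: b') (r *: e') => b1 e1.
suff -> : a' - d + (b1 - e1) = (a' + b1) - (d + e1).
  by rewrite -[c - d - e1]addrA -opprD opprB subrKA.
by rewrite addrACA opprD.
Qed.

(** A discrete Gronwall argument: each step adds an error at most [r * (eps / K)] and multiplies the
    previous one by at most [1 + r * L], whose powers along the grid stay below [expR (L * T)]. *)
Lemma euler_cvg (T : R) (u z : R -> V) t : 0 <= t <= T ->
  {within `[0, T], continuous u} ->
  (forall t, 0 <= t <= T -> conv S (fun s => F (u s)) t (z t - u t)) ->
  z t - euler z (t / n.+1%:R) n.+1 @[n --> \oo] --> u t.
Proof.
move=> /andP[t0 tT] cu cz.
have T0 : 0 <= T by exact: le_trans tT.
have cg : {within `[0, T], continuous (fun s => F (u s))}.
  apply/within_continuous_dist => s sT eps eps0.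
  have L1 : 0 < L + 1 by rewrite ltr_wpDl.
  have [del del0 Hdel] := (within_continuous_dist _ _).1 cu s sT _ (divr_gt0 eps0 L1).
  exists del => // s' s'T /(Hdel s' s'T); rewrite ltr_pdivlMr// => h.
  apply: le_lt_trans (FL _ _) _; apply: le_lt_trans h.
  by rewrite mulrC ler_wpM2l// lerDl.
apply/cvgrPdist_le => eps eps0.
(* The first term of [K] is the amplification of the accumulated local errors; the 1 keeps [K]
   positive. *)
pose K := T * expR (L * T) + 1.
have K0 : 0 < K by rewrite ltr_wpDl// mulr_ge0// expR_ge0.
have e0 : 0 < eps / K by rewrite divr_gt0.
have [del del0 Hdel] := semigroup_uniform_modulus cg e0.
have T1 : 0 < T + 1 by rewrite ltr_wpDl.
have [n0 _ Hn0] := near_infty_natSinv_lt (PosNum (divr_gt0 del0 T1)).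
exists n0 => // n /= n0n.
set r := t / n.+1%:R.
have r0 : 0 <= r by rewrite divr_ge0.
have rdel : r < del.
  have := Hn0 n n0n; rewrite /= ltr_pdivlMr// => h.
  apply: le_lt_trans h; rewrite /r mulrC; apply: ler_wpM2l; first by rewrite invr_ge0.
  by rewrite (le_trans tT)// lerDl.
have kr k : (k <= n.+1)%N -> 0 <= k%:R * r <= T.
  move=> kn; rewrite mulr_ge0//= (le_trans _ tT)// /r mulrCA ler_piMr//.
  by rewrite ler_pdivrMr// mul1r ler_nat.
pose y k := z (k%:R * r) - u (k%:R * r).
pose err k := `|euler z r k - y k|.
have err0 : err 0%N = 0.
  rewrite /err /y /= mul0r sub0r normrN.
  have c0 : conv S (fun s => F (u s)) 0 (z 0 - u 0) by apply: cz; rewrite lexx.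
  by rewrite (conv0 c0) normr0.
have errS k : (k < n.+1)%N -> err k.+1 <= (1 + r * L) * err k + r * (eps / K).
  move=> kn.
  have kT := kr k (ltnW kn); have kT' := kr k.+1 kn.
  have kk' : k%:R * r <= k.+1%:R * r by rewrite ler_wpM2r// ler_nat.
  have dk : k.+1%:R * r - k%:R * r = r by rewrite -mulrBl -natrB// subSnn mul1r.
  have /andP[k0 k_T] := kT; have /andP[k0' k_T'] := kT'.
  pose gk := F (u (k%:R * r)).
  have kk : 0 <= k%:R * r <= k.+1%:R * r by rewrite k0.
  (* The scheme applies [S r] to its increment, so the integrand is compared with [S r gk]; by the
     semigroup law their difference is then controlled by the modulus [Hdel]. *)
  have := conv_increment HS (S r gk) kk (cz _ kT') (cz _ kT).
  rewrite dk -/(y k.+1) -/(y k) => inc.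
  have inc' : `|y k.+1 - S r (y k) - r *: S r gk| <= r * (eps / K).
    rewrite -lee_fin; apply: le_trans inc _.
    apply: (@le_trans _ _ (\int[leb]_(s in `](k%:R * r)%R, (k.+1%:R * r)%R]) (eps / K)%:E)%E).
      apply: le_integral_ge0 => // s /=; rewrite in_itv/= => /andP[ks sk].
      have a0 : 0 <= s - k%:R * r by rewrite subr_ge0 ltW.
      have b0 : 0 <= k.+1%:R * r - s by rewrite subr_ge0.
      have -> : S r gk = S (k.+1%:R * r - s) (S (s - k%:R * r) gk).
        by rewrite -(semigroup_add HS)// addrA subrK dk.
      rewrite lee_fin -(semigroupB HS)// (le_trans (semigroup_norm HS _ b0))//.
      apply: Hdel => //; first exact: ltW.
        exact: le_trans k_T'.
      by rewrite (le_lt_trans _ rdel)// -[leRHS]dk lerD2r.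
    rewrite integral_cst; last exact: measurable_itv.
    rewrite [X in (_ * X)%E]lebesgue_measure_itv/= lte_fin.
    case: ltP => _; last by rewrite mule0 lee_fin mulr_ge0// ltW.
    by rewrite -EFinB dk -EFinM lee_fin mulrC.
  rewrite /err /=.
  set ek := euler z r k.
  have -> : S r (ek + r *: F (z (k%:R * r) - ek)) - y k.+1 =
      S r ((ek - y k) + r *: (F (z (k%:R * r) - ek) - gk)) -
      (y k.+1 - S r (y k) - r *: S r gk).
    exact: euler_error_split.
  rewrite (le_trans (ler_normB _ _))// lerD//.
  rewrite (le_trans (semigroup_norm HS _ r0))// (le_trans (ler_normD _ _))//.
  rewrite mulrDl mul1r lerD2l normrZ ger0_norm// -mulrA ler_wpM2l//.
  rewrite (le_trans (FL _ _))// ler_wpM2l// /y.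
  rewrite (_ : z (k%:R * r) - ek - u (k%:R * r) =
    - (ek - (z (k%:R * r) - u (k%:R * r)))) ?normrN//.
  by rewrite opprB addrAC.
have q1 : 1 <= 1 + r * L by rewrite lerDl mulr_ge0.
have errk k : (k <= n.+1)%N -> err k <= k%:R * r * (eps / K) * (1 + r * L) ^+ k.
  elim: k => [|k IH] kn; first by rewrite err0 !mul0r.
  apply: le_trans (errS k kn) _.
  apply: (@le_trans _ _ ((1 + r * L) * (k%:R * r * (eps / K) * (1 + r * L) ^+ k) + r * (eps / K) * (1 + r * L) ^+ k.+1)).
    apply: lerD; first by rewrite ler_wpM2l ?IH ?(ltnW kn)//; exact: le_trans q1.
    by rewrite ler_peMr ?exprn_ege1// mulr_ge0// ltW.
  by rewrite exprS -natr1 le_eqVlt; apply/orP; left; apply/eqP; ring.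
have yn : y n.+1 = z t - u t.
  by rewrite /y /r mulrC divfK.
rewrite opprB addrCA -[u t - z t]opprB -yn.
apply: le_trans (errk n.+1 (leqnn _)) _.
have -> : n.+1%:R * r = t by rewrite /r mulrC divfK.
have expL : (1 + r * L) ^+ n.+1 <= expR (L * T).
  apply: (@le_trans _ _ (expR (r * L) ^+ n.+1)).
    by rewrite lerXn2r ?nnegrE ?expR_ge0 ?expR_ge1Dx// (le_trans _ q1).
  by rewrite -expRM_natl ler_expR mulrA /r mulrC ler_wpM2l// mulrC divfK.
have eK0 : 0 <= eps / K by exact: ltW.
apply: (@le_trans _ _ (T * (eps / K) * expR (L * T))).
  apply: ler_pM => //; first by rewrite mulr_ge0.
    by rewrite exprn_ge0// (le_trans _ q1).
  by rewrite ler_wpM2r.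
rewrite mulrAC mulrA ler_pdivrMr// mulrC ler_wpM2l//; first exact: ltW.
by rewrite lerDl.
Qed.

End euler_scheme.

(** * Canonical representatives *)

Lemma ler_dist_max0 (R : realDomainType) (a b : R) :
  `|Num.max 0 a - Num.max 0 b| <= `|a - b|.
Proof.
have [a0|a0] := leP 0 a; have [b0|b0] := leP 0 b => //.
- by rewrite subr0 (ger0_norm a0) (le_trans _ (ler_norm _))// lerDl oppr_ge0 ltW.
- rewrite sub0r normrN (ger0_norm b0) distrC (le_trans _ (ler_norm _))//.
  by rewrite lerDl oppr_ge0 ltW.
- by rewrite subrr normr0.
Qed.

Section conv_representative.
Context (R : realType) (V : normedModType R).
Variables (S : R -> V -> V) (HS : contraction_semigroup S).
Variables (T : R) (T0 : 0 < T).
Local Notation leb := (@lebesgue_measure R).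

(** For a simple [h] the integrand is a sum of indicators times orbits [S (t - s) v], continuous in
    s; the general case is a limit. The clamp at 0 extends these orbits continuously to [[0, T]]. *)
Lemma conv_smeas (h : R -> V) t : 0 <= t <= T -> smeasI T h ->
  smeasI t (fun s => S (t - s) (h s)).
Proof.
move=> /andP[t0 tT] [e [me eh]].
have mt := @measurable_itvcc R 0 t.
have orbit v : smeasI t (fun s => S (t - s) v).
  have sub : `[0, t] `<=` `[0, T].
    by move=> s /=; rewrite !in_itv/= => /andP[-> /le_trans]; apply.
  apply: (@eq_smeas _ _ _ (measurableTypeR R) _ (fun s => S (Num.max 0 (t - s)) v)).
    by move=> s /set_mem/=; rewrite in_itv/= => /andP[_ st]; rewrite max_r// subr_ge0.
  apply: (smeas_subset sub); apply: (smeas_continuous T0).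
  apply/within_continuous_dist => s sT eps eps0.
  have mT r : 0 <= r <= T -> 0 <= Num.max 0 (t - r) <= T.
    by move=> /andP[r0 rT]; rewrite le_max lexx/= ge_max (ltW T0)/= lerBlDr (le_trans tT)// lerDl.
  have co : {within `[0, T], continuous (fun t => S t v)}.
    exact: semigroup_orbit_continuous.
  have [del del0 Hdel] := (within_continuous_dist _ _).1 co _ (mT s sT) _ eps0.
  exists del => // r rT rs; apply: Hdel; first exact: mT.
  apply: le_lt_trans rs; rewrite -[leRHS]normrN opprB.
  have -> : s - r = (t - r) - (t - s) by ring.
  exact: ler_dist_max0.
apply: (@smeas_cvg _ _ _ (measurableTypeR R) _ (fun n s => S (t - s) (simple_fun (e n) s))) => //.
  move=> n.
  apply: (@eq_smeas _ _ _ (measurableTypeR R) _ (fun s => \sum_(a <- e n) (\1_(a.1) s : R) *: S (t - s) a.2)).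
    move=> s /set_mem/=; rewrite in_itv/= => /andP[_ st].
    rewrite /simple_fun; elim: (e n) => [|a l IH].
      by rewrite !big_nil (semigroup0 HS)// subr_ge0.
    by rewrite !big_cons (semigroupD HS) ?subr_ge0// (semigroupZ HS) ?subr_ge0// IH.
  apply: (@eq_smeas _ _ _ (measurableTypeR R) _ (fun s => \sum_(i < size (e n))
      (\1_((tnth (in_tuple (e n)) i).1) s : R) *: S (t - s) (tnth (in_tuple (e n)) i).2)).
    by move=> s _; rewrite [RHS]big_tnth.
  by apply: smeas_sum => i; apply: smeas_indic (orbit _); apply: (me n); exact: mem_tnth.
move=> s /=; rewrite in_itv/= => /andP[s0 st].
have ts0 : 0 <= t - s by rewrite subr_ge0.
apply: (cvg_comp _ _ (eh s _)); last exact: (semigroup_continuous HS ts0).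
by rewrite /= in_itv/= s0 (le_trans st).
Qed.

(** Strong measurability is a condition at every point, so it comes from [conv_smeas] for the new
    representative; the constant sequence [h] is then at L^1 distance 0 from it. *)
Lemma conv_ae (h g : R -> V) t v : 0 <= t <= T -> conv S h t v ->
  smeasI T g -> {ae leb, forall s, 0 <= s <= T -> h s = g s} ->
  conv S g t v.
Proof.
move=> tT ch mg hg; have /andP[t0 t_T] := tT.
have mt := @measurable_itvcc R 0 t.
have msg := conv_smeas tT mg.
apply: (bochner_limit mt (fun=> ch) msg); last exact: cvg_cst.
rewrite [X in X @ _ --> _](_ : _ = fun=> 0%E); first exact: cvg_cst.
apply/funext => _.
rewrite (@ae_eq_integral _ _ _ leb _ (fun=> 0%E)) ?integral0//.
  by apply: smeas_normE; apply: smeasB => //; case: ch.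
apply: (ae_lebesgueS _ hg) => s hs.
rewrite /= in_itv/= => /andP[s0 st].
by rewrite hs ?s0 ?(le_trans st)// subrr normr0.
Qed.

End conv_representative.

(** * Limits that are measurable without an assumption of convergence *)

Section cauchy_limit.
Context (R : realType) (V : normedModType R).
Hypothesis Vcomplete : forall u : nat -> V, cauchy_seq u -> exists v : V, u n @[n --> \oo] --> v.

(** The value 0 is taken where the sequence is not Cauchy. As the Cauchy set is measurable and the
    space complete, a pointwise limit of strongly measurable functions is strongly measurable in all
    cases. *)
Definition cauchy_lim (u : nat -> V) : V :=
  if pselect (cauchy_seq u) then lim (u @ \oo) else 0.

Lemma cvg_cauchy_lim (u : nat -> V) (v : V) : u n @[n --> \oo] --> v -> cauchy_lim u = v.
Proof.
move=> uv; rewrite /cauchy_lim; case: pselect => [?|[]]; last exact: cvg_cauchy_seq uv.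
by apply: (cvg_lim _ uv); exact: norm_hausdorff.
Qed.

Lemma smeas_cauchy_lim d (X : measurableType d) (D : set X) (fn : nat -> X -> V) :
  measurable D -> (forall n, smeas D (fn n)) -> smeas D (fun x => cauchy_lim (fn^~ x)).
Proof.
move=> mD mfn; pose fD n x := (\1_D x : R) *: fn n x.
have mfD n : smeas setT (fD n) by exact: smeas_extend.
pose C := [set x | cauchy_seq (fD^~ x)].
have mC : measurable C by exact: measurable_cauchy_seq.
have fDE x : D x -> fD^~ x = fn^~ x.
  by move=> Dx; apply/funext => n; rewrite /fD indicE mem_set// scale1r.
apply: (@smeas_cvg _ _ _ _ _ (fun n x => (\1_C x : R) *: fn n x)) => //.
  by move=> n; exact: smeas_indic.
move=> x Dx; rewrite /cauchy_lim; case: pselect => [cx|ncx].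
  have -> : \1_C x = 1 :> R by rewrite indicE mem_set// /C/= fDE.
  under eq_fun do rewrite scale1r.
  have [v fv] := Vcomplete cx.
  by rewrite (cvg_lim _ fv)//; exact: norm_hausdorff.
have -> : \1_C x = 0 :> R by rewrite indicE memNset// /C/= fDE.
by under eq_fun do rewrite scale0r; exact: cvg_cst.
Qed.

End cauchy_limit.

(** * Recovering the integrand of a convolution *)

Section left_derivative.
Context (R : realType) (V : normedModType R).
Variables (S : R -> V -> V) (HS : contraction_semigroup S).
Variables (T : R) (T0 : 0 < T).
Local Notation leb := (@lebesgue_measure R).
Local Notation smeasT := (smeasI T).

(** Only values of y up to time t enter, whence adaptedness. The clamp keeps the earlier time in
    [[0, T]], and has no effect for large n when t > 0. *)
Definition left_quotient (y : R -> V) (n : nat) (t : R) : V :=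
  n.+1%:R *: (y t - S n.+1%:R^-1 (y (Num.max 0 (t - n.+1%:R^-1)))).

Definition left_derivative (y : R -> V) (t : R) : V :=
  cauchy_lim (fun n => left_quotient y n t).

Lemma left_time (r t : R) : 0 <= r -> 0 <= t <= T -> 0 <= Num.max 0 (t - r) <= T.
Proof.
move=> r0 /andP[t0 tT]; rewrite le_max lexx/= ge_max (ltW T0)/= lerBlDr.
by rewrite (le_trans tT)// lerDl.
Qed.

Lemma left_quotient_continuous (y : R -> V) n : {within `[0, T], continuous y} ->
  {within `[0, T], continuous (left_quotient y n)}.
Proof.
move=> /within_continuous_dist cy; apply/within_continuous_dist => t tT eps eps0.
have r0 : (0 : R) <= n.+1%:R^-1 by [].
have e0 : 0 < eps / n.+1%:R / 2 by rewrite !divr_gt0.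
have [d1 d10 H1] := cy t tT _ e0.
have [d2 d20 H2] := cy _ (left_time r0 tT) _ e0.
exists (Num.min d1 d2); first by rewrite lt_min d10.
move=> s sT; rewrite lt_min => /andP[s1 s2].
rewrite /left_quotient -scalerBr normrZ ger0_norm// mulrC -ltr_pdivlMr//.
rewrite (_ : _ - _ - _ = (y s - y t) -
    S n.+1%:R^-1 (y (Num.max 0 (s - n.+1%:R^-1)) - y (Num.max 0 (t - n.+1%:R^-1)))).
  rewrite (le_lt_trans (ler_normB _ _))// [ltRHS]splitr ltrD//; first exact: H1.
  rewrite (le_lt_trans (semigroup_norm HS _ r0))//.
  apply: H2; first exact: left_time.
  apply: le_lt_trans s2; rewrite (_ : s - t = (s - n.+1%:R^-1) - (t - n.+1%:R^-1)); last by ring.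
  exact: ler_dist_max0.
rewrite (semigroupB HS)//; move: (S _ _) (S _ _) => a b.
by rewrite !opprB [LHS]addrACA [RHS]addrACA; congr (_ + _); exact: addrC.
Qed.

Lemma conv_left_derivative (h y : R -> V) : smeasT h ->
  (\int[leb]_(t in `[0%R, T]) `|h t|%:E < +oo)%E ->
  (forall t, 0 <= t <= T -> conv S h t (y t)) ->
  {ae leb, forall t, 0 <= t <= T -> left_derivative y t = h t}.
Proof.
move=> mh ih cy.
apply: (ae_lebesgueS2 _ (ae_lebesgue_neq0 R) (conv_derivative HS mh ih cy)).
move=> t t0 dt /andP[t_ge0 tT]; apply: cvg_cauchy_lim; apply: dt.
by rewrite tT lt_neqAle t_ge0 eq_sym !andbT; apply/eqP.
Qed.

Hypothesis Vcomplete : forall u : nat -> V, cauchy_seq u -> exists v : V, u n @[n --> \oo] --> v.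

Lemma left_derivative_smeas (y : R -> V) : {within `[0, T], continuous y} ->
  smeasT (left_derivative y).
Proof.
move=> cy; apply: (smeas_cauchy_lim Vcomplete); first exact: measurable_itv.
by move=> n; apply: (smeas_continuous T0); exact: left_quotient_continuous.
Qed.

End left_derivative.

(** * Existence along one path *)

Section pathwise_solution.
Context d (X : measurableType d) (R : realType) (mu : {measure set X -> \bar R}).
Hypothesis muT : (mu setT < +oo)%E.
Local Notation V := (L1 mu).
Local Notation leb := (@lebesgue_measure R).
Variables (S : R -> V -> V) (HS : contraction_semigroup S) (sS : submarkovian S).
Variables (T : R) (T0 : 0 < T).
Local Notation D := (`[0, T]%classic `*` [set: X] : set (measurableTypeR R * X)).
Variables (f : R -> R) (f_incr : {homo f : x y / x <= y}).
Variables (lam : nat -> R) (lam_gt0 : forall n, 0 < lam n).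
Variables (u : nat -> R -> V) (z : R -> V).
Variables (gam : nat -> measurableTypeR R * X -> R).
Local Notation g n t := (nemytskii (yosida f (lam n)) (u n t)).
Local Notation uu t := (cauchy_lim (fun n => u n t)).
Local Notation smeasT := (smeasI T).

Lemma regularized_paths_limit :
  (forall n, {within `[0, T], continuous (u n)}) ->
  (forall n t, 0 <= t <= T -> conv S (fun s => g n s) t (z t - u n t)) ->
  (forall n, measurable_fun D (gam n)) ->
  (forall n, {ae leb, forall t, 0 <= t <= T ->
    {ae mu, forall x, gam n (t, x) = g n t x}}) ->
  equiintegrable (leb \x^ mu)%E D setT gam ->
  lam n @[n --> \oo] --> 0 ->
  [/\ forall t, 0 <= t <= T -> u n t @[n --> \oo] --> uu t,
      {within `[0, T], continuous (fun t => uu t)}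
    & exists gh : R -> V,
      [/\ smeasT gh, (\int[leb]_(t in `[0%R, T]) `|gh t|%:E < +oo)%E,
          forall t, 0 <= t <= T -> conv S gh t (z t - uu t)
        & {ae leb, forall t, 0 <= t <= T ->
            {ae mu, forall x, monotone_extension f ((uu t : V) x) (gh t x)}}]].
Proof.
move=> cu convu mgam gamE equi lam0.
have cauchy eps eps0 := @approx_uniform_cauchy _ _ _ _ muT _ HS sS _ T0 _ f_incr _
  lam_gt0 _ _ _ cu convu mgam gamE equi eps lam0 eps0.
have cvg_u t : 0 <= t <= T -> u n t @[n --> \oo] --> uu t.
  move=> tT; have cut : cauchy_seq (fun n => u n t).
    move=> eps eps0; have [N HN] := cauchy _ (divr_gt0 eps0 (ltr0n _ 2)).
    exists N => n Nn; apply: le_lt_trans (HN _ _ (leqnn _) Nn t tT) _.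
    by rewrite ltr_pdivrMr// ltr_pMr// ltr1n.
  by have [v uv] := L1_complete cut; rewrite (cvg_cauchy_lim uv).
have unif (eps : R) : 0 < eps -> exists N, forall n, (N <= n)%N ->
    forall t, 0 <= t <= T -> `|u n t - uu t| <= eps.
  move=> eps0; have [N HN] := cauchy _ eps0; exists N => n Nn t tT.
  have un : `|u n t - u m t| @[m --> \oo] --> `|u n t - uu t|.
    by apply: cvg_norm; apply: cvgB; [exact: cvg_cst|exact: cvg_u].
  rewrite -(cvg_lim (@Rhausdorff R) un); apply: limr_le; first by apply/cvg_ex; exists `|u n t - uu t|.
  by exists N => // m /= Nm; exact: HN.
split => //.
  apply/within_continuous_dist => t tT eps eps0.
  have e3 : 0 < eps / 3 by rewrite divr_gt0.
  have [N HN] := unif _ e3.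
  have [del del0 Hdel] := (within_continuous_dist _ _).1 (cu N) t tT _ e3.
  exists del => // s sT st.
  have h1 := HN N (leqnn _) s sT; have h2 := HN N (leqnn _) t tT.
  have h3 := Hdel s sT st.
  have t1 := ler_distD (u N s) (uu s) (uu t).
  have t2 := ler_distD (u N t) (u N s) (uu t).
  rewrite distrC in h1; lra.
(* A subsequence is extracted along which both [lam] and the increments of [u] are dominated by a
   geometric series. It depends on the path, but [uu] does not depend on it, being the limit of the
   whole sequence. *)
have g0 k : 0 < 1 / (2 ^ (k + 1))%:R :> R by rewrite divr_gt0// ltr0n expn_gt0.
have [N HN] := choice (fun k => cauchy _ (g0 k)).
have lamN k : exists M, forall n, (M <= n)%N -> lam n <= 1 / (2 ^ (k + 1))%:R.
  have /cvgrPdist_le/(_ _ (g0 k))[M _ HM] := lam0.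
  exists M => n /HM /=; rewrite sub0r normrN ger0_norm// ltW//; exact: lam_gt0.
have [M HM] := choice lamN.
have [p [pmax pS kp]] := dominating_subsequence (fun k => maxn (N k) (M k)).
have pN k : (N k <= p k)%N by exact: leq_trans (leq_maxl _ _) (pmax k).
have pM k : (M k <= p k)%N by exact: leq_trans (leq_maxr _ _) (pmax k).
have geom : (\sum_(0 <= k <oo) (1 / (2 ^ (k + 1))%:R : R)%:E < +oo)%E.
  by have /cvg_lim -> // := @cvg_geometric_eseries_half R 1 0; exact: ltry.
have pinf : p n @[n --> \oo] --> \oo.
  by apply/cvgnyPge => A; exists A => // n /= An; exact: leq_trans (kp n).
have equi' : equiintegrable (leb \x^ mu)%E D setT (fun n => gam (p n)).
  have [[B HB] H] := equi; split; first by exists B => i _; exact: HB.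
  move=> eps eps0; have [del del0 Hdel] := H _ eps0.
  by exists del => // i A _; exact: Hdel.
apply: (@limit_solution _ _ _ _ muT _ HS _ T0 _ f_incr (fun n => lam (p n)) (fun n => lam_gt0 _)
  (fun n => u (p n)) z (fun n => gam (p n)) (fun n => cu _) (fun n => convu _)
  (fun n => mgam _) (fun n => gamE _) equi' (fun t => uu t)).
- by move=> t tT; exact: (cvg_comp _ _ pinf (cvg_u t tT)).
- move=> t tT; apply: le_lt_trans geom.
  apply: lee_nneseries => [k _ _|k _]; first by rewrite lee_fin.
  rewrite lee_fin; apply: HN => //; exact: leq_trans (pN k) (ltnW (pS k)).
- apply: le_lt_trans geom; apply: lee_nneseries => [k _ _|k _].
    by rewrite lee_fin ltW.
  by rewrite lee_fin HM.
Qed.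

(* The limit of the left quotients of S * g selects a representative of g which
   depends measurably on the path. *)
Lemma canonical_solution (v y gh : R -> V) :
  {within `[0, T], continuous y} -> smeasT gh ->
  (\int[leb]_(t in `[0%R, T]) `|gh t|%:E < +oo)%E ->
  (forall t, 0 <= t <= T -> conv S gh t (y t)) ->
  {ae leb, forall t, 0 <= t <= T ->
    {ae mu, forall x, monotone_extension f (v t x) (gh t x)}} ->
  [/\ (\int[leb]_(t in `[0%R, T]) `|left_derivative S y t|%:E < +oo)%E,
      forall t, 0 <= t <= T -> conv S (left_derivative S y) t (y t)
    & {ae leb, forall t, 0 <= t <= T ->
        {ae mu, forall x, monotone_extension f (v t x) ((left_derivative S y t : V) x)}}].
Proof.
move=> cy mgh igh cgh incl.
have dE := conv_left_derivative HS mgh igh cgh.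
have md := left_derivative_smeas HS T0 (@L1_complete _ _ _ mu) cy.
have mI := @measurable_itvcc R 0 T.
split.
- rewrite (@ae_eq_integral _ _ _ leb _ (fun t => `|gh t|%:E))//.
  + exact: smeas_normE.
  + exact: smeas_normE.
  + apply: (ae_lebesgueS _ dE) => t tE.
    by rewrite /= in_itv/= => /tE ->.
- move=> t tT; apply: (conv_ae HS T0 tT (cgh t tT) md).
  by apply: (ae_lebesgueS _ dE) => s sE /sE.
- apply: (ae_lebesgueS2 _ dE incl) => t tE ht tT.
  by rewrite tE//; exact: ht.
Qed.

End pathwise_solution.

(** * Processes *)

Lemma strongly_measurable_sub (R : realType) (V : normedModType R) (X : Type)
    (F F' : set (set X)) (D : set X) (h : X -> V) : F `<=` F' ->
  strongly_measurable F D h -> strongly_measurable F' D h.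
Proof. by move=> FF' [e [Fe eh]]; exists e; split => // n a /Fe /FF'. Qed.

Lemma euler_smeas (R : realType) (V : normedModType R) (S : R -> V -> V) (F : V -> V)
    d (Y : measurableType d) (z : R -> Y -> V) (r : R) (k : nat) :
  contraction_semigroup S -> 0 <= r -> continuous F ->
  (forall j, (j <= k)%N -> smeas setT (z (j%:R * r))) ->
  smeas setT (fun w => euler S F (z^~ w) r k).
Proof.
move=> HS r0 cF; elim: k => [|k IH] mz /=; first exact: smeas_cst.
have me : smeas setT (fun w => euler S F (z^~ w) r k).
  by apply: IH => j jk; apply: mz; exact: leqW.
apply: (smeas_comp (semigroup_continuous HS r0)); apply: smeasD => //.
by apply: smeasZ; apply: (smeas_comp cF); apply: smeasB => //; exact: mz.
Qed.

Section mild_solutions.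
Context d (X : measurableType d) (R : realType) (mu : {measure set X -> \bar R}).
Hypothesis muT : (mu setT < +oo)%E.
Local Notation V := (L1 mu).
Local Notation leb := (@lebesgue_measure R).
Variables (S : R -> V -> V) (HS : contraction_semigroup S) (sS : submarkovian S).
Variables (T : R) (T0 : 0 < T).
Context dO (Omega : measurableType dO) (P : probability Omega R).
Variables (F : R -> set (set Omega)).
Hypothesis FF : complete_right_continuous_filtration P T F.
Variables (f : R -> R) (f_incr : {homo f : x y / x <= y}).
Variables (u0 : Omega -> V) (SB : R -> Omega -> V).

(** This allows Omega to be viewed as a measurable type with sigma-algebra [F t], so that the
    results on strong measurability give adaptedness. *)
Lemma filtration_measurable t : 0 <= t <= T ->
  @measurable _ (g_sigma_algebraType (F t)) = F t.
Proof. by case: FF => + _ _ _ _ => /[apply]; exact: sigma_algebra_id. Qed.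

Lemma mild_unique (u u' : R -> Omega -> V) : mild_solution P T F S f u0 SB u ->
  mild_solution P T F S f u0 SB u' -> indistinguishable P T u u'.
Proof.
move=> [_ _ [g [_ [mg ig] incl eqn]]] [_ _ [g' [_ [mg' ig'] incl' eqn']]].
apply: filterS3 (filterI ig ig') (filterI incl incl') (filterI eqn eqn').
move=> w [i1 i2] [h1 h2] [e1 e2].
have msec (h : R -> Omega -> V) : measurable_process T h ->
    smeasI T (h^~ w).
  apply: (@smeas_measurable_comp _ _ _ _ _ _ (fun t : measurableTypeR R => (t, w)))%type.
    exact: pair2_measurable.
  by move=> t tT; split.
pose z t := S t (u0 w) + SB t w.
have c1 t : 0 <= t <= T -> convolution S (g^~ w) t (z t - u t w).
  by move=> /e1[v cv E]; rewrite /z -E addrAC subrr add0r.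
have c2 t : 0 <= t <= T -> convolution S (g'^~ w) t (z t - u' t w).
  by move=> /e2[v cv E]; rewrite /z -E addrAC subrr add0r.
exact: (mild_pathwise_unique muT HS sS f_incr (msec _ mg) (msec _ mg') i1 i2 c1 c2 h1 h2).
Qed.

End mild_solutions.

(** * Existence of an adapted solution *)

Section mild_existence.
Context d (X : measurableType d) (R : realType) (mu : {measure set X -> \bar R}).
Hypothesis muT : (mu setT < +oo)%E.
Local Notation V := (L1 mu).
Local Notation leb := (@lebesgue_measure R).
Variables (S : R -> V -> V) (HS : contraction_semigroup S) (sS : submarkovian S).
Variables (T : R) (T0 : 0 < T).
Context dO (Omega : measurableType dO) (P : probability Omega R).
Variables (F : R -> set (set Omega)).
Hypothesis FF : complete_right_continuous_filtration P T F.
Variables (f : R -> R) (f_incr : {homo f : x y / x <= y}).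
Variables (u0 : Omega -> V) (SB : R -> Omega -> V).
Hypothesis u0_measurable : strongly_measurable (F 0) setT u0.
Hypothesis SB_adapted : adapted T F SB.
Hypothesis SB_continuous : continuous_process P T SB.
Variable ul : R -> R -> Omega -> V.
Hypothesis ul_solution : forall lam, 0 < lam ->
  regularized_solution P T S f lam u0 SB (ul lam).
Local Notation D := (`[0, T] `*` setT : set (measurableTypeR R * X)).
Hypothesis ul_equi : {ae P, forall w, exists v : R -> measurableTypeR R * X -> R,
  (forall lam, 0 < lam -> represents T (v lam) (fun t => ul lam t w)) /\
  equiintegrable (leb \x^ mu)%E D [set lam | 0 < lam]
    (fun lam tx => yosida f lam (v lam tx))}.

(** A single sequence of parameters serves all outcomes, so that [u] is defined without a choice
    depending on w. *)
Let lam (n : nat) : R := n.+1%:R^-1.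
Let lam_gt0 n : 0 < lam n.
Proof. by rewrite invr_gt0. Qed.

Let z t w := S t (u0 w) + SB t w.

(** All the almost sure properties hold here at once. The complement is negligible, so by
    completeness of the filtration [good] belongs to every [F t]. *)
Let good : set Omega := [set w |
  [/\ forall n, {within `[0, T], continuous (ul (lam n) ^~ w)},
      forall n t, 0 <= t <= T -> exists2 v,
        convolution S (fun s => nemytskii (yosida f (lam n)) (ul (lam n) s w)) t v &
        ul (lam n) t w + v = z t w,
      {within `[0, T], continuous (SB ^~ w)}
    & exists v : R -> measurableTypeR R * X -> R,
      (forall lam, 0 < lam -> represents T (v lam) (fun t => ul lam t w)) /\
      equiintegrable (leb \x^ mu)%E D [set lam | 0 < lam]
        (fun lam tx => yosida f lam (v lam tx))]].

Let ae_good : {ae P, forall w, good w}.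
Proof.
have h1 : {ae P, forall w n, {within `[0, T], continuous (ul (lam n) ^~ w)}}.
  by apply: ae_foralln => n; have [[]] := ul_solution (lam_gt0 n).
have h2 : {ae P, forall w n, forall t, 0 <= t <= T -> exists2 v,
    convolution S (fun s => nemytskii (yosida f (lam n)) (ul (lam n) s w)) t v &
    ul (lam n) t w + v = z t w}.
  by apply: ae_foralln => n; have [] := ul_solution (lam_gt0 n).
have [_ h3] := SB_continuous.
by apply: filterS3 (filterI h1 h2) h3 ul_equi => w [? ?] ? ?; split.
Qed.

(** Off [good] both [u] and [y] are zero. Hence every path of [y] is continuous, as
    [smeas_caratheodory] demands of each w, and adaptedness is preserved since [good] is in
    [F t]. *)
Let u t w : V := (\1_good w : R) *: cauchy_lim (fun n => ul (lam n) t w).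
Let y t w : V := (\1_good w : R) *: z t w - u t w.

Let path w : good w ->
  [/\ forall t, 0 <= t <= T -> ul (lam n) t w @[n --> \oo] --> u t w,
      {within `[0, T], continuous (u ^~ w)},
      {within `[0, T], continuous (y ^~ w)},
      forall t, y t w = z t w - u t w
    & exists gh : R -> V,
      [/\ smeasI T gh,
          (\int[leb]_(t in `[0%R, T]) `|gh t|%:E < +oo)%E,
          forall t, 0 <= t <= T -> convolution S gh t (y t w)
        & {ae leb, forall t, 0 <= t <= T ->
            {ae mu, forall x, monotone_extension f (u t w x) (gh t x)}}]].
Proof.
move=> gw; have [cu convu cS [v [rv [bv ev]]]] := gw.
have one : \1_good w = 1 :> R by rewrite indicE mem_set.
have uE t : u t w = cauchy_lim (fun n => ul (lam n) t w).
  by rewrite /u one scale1r.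
have yE t : y t w = z t w - u t w by rewrite /y one scale1r.
pose gam n tx := yosida f (lam n) (v (lam n) tx).
have mgam n : measurable_fun D (gam n).
  have [mv _] := rv _ (lam_gt0 n).
  apply: measurableT_comp => //; apply: continuous_measurable_fun.
  apply: (@lipschitz_continuous _ R^o R^o _ (lam n)^-1); first by rewrite invr_ge0 ltW.
  exact: (yosida_lipschitz f_incr (lam_gt0 n)).
have gamE n : {ae leb, forall t, 0 <= t <= T -> {ae mu, forall x,
    gam n (t, x) = nemytskii (yosida f (lam n)) (ul (lam n) t w) x}}.
  have [_] := rv _ (lam_gt0 n).
  apply: ae_lebesgueS => t h tT.
  apply: filterS2 (h tT) (L1_nemytskiiE (ul (lam n) t w) muT (yosida_lipschitz f_incr (lam_gt0 n))).
  by move=> x E1 ->; rewrite /gam E1.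
have equi : equiintegrable (leb \x^ mu)%E D setT gam.
  split; first by have [M HM] := bv; exists M => i _; exact: HM (lam_gt0 i).
  move=> eps eps0; have [del del0 Hdel] := ev _ eps0; exists del => // i A _.
  exact: Hdel (lam_gt0 i).
have cz n t : 0 <= t <= T -> convolution S
    (fun s => nemytskii (yosida f (lam n)) (ul (lam n) s w)) t (z t w - ul (lam n) t w).
  by move=> /(convu n)[c cc <-]; rewrite addrAC subrr add0r.
have lam0 : lam n @[n --> \oo] --> (0 : R).
  by apply/cvgrPdist_lt => eps eps0; have [N _ HN] := near_infty_natSinv_lt (PosNum eps0);
    exists N => // n /HN; rewrite /= sub0r normrN (ger0_norm (ltW (lam_gt0 _))).
have [cvg_u cuu [gh [mgh igh cgh incl]]] := regularized_paths_limit muT HS sS T0 f_incr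
  lam_gt0 cu cz mgam gamE equi lam0.
have uF : u ^~ w = (fun t => cauchy_lim (fun n => ul (lam n) t w)).
  by apply/funext => t; exact: uE.
have cu' : {within `[0, T], continuous (u ^~ w)} by rewrite uF.
split => //.
- by move=> t tT; rewrite uE; exact: cvg_u.
- have -> : y ^~ w = (fun t => z t w - u t w) by apply/funext => t; exact: yE.
  have cz' : {within `[0, T], continuous (fun t => S t (u0 w) + SB t w)}.
    move=> t; apply: cvgD; last exact: cS.
    exact: (semigroup_orbit_continuous HS).
  by move=> t; apply: cvgB; [exact: cz'|exact: cu'].
- exists gh; split; [exact: mgh|exact: igh| |].
    by move=> t tT; rewrite yE uE; exact: cgh.
  apply: (ae_lebesgueS _ incl) => t ht tT.
  by apply: filterS (ht tT) => x; rewrite uE.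
Qed.

Let F_sub s t : 0 <= s -> s <= t -> t <= T -> F s `<=` F t.
Proof. by case: FF => _ _ + _ _; exact. Qed.

Let F_good t : 0 <= t <= T -> F t good.
Proof.
move=> tT; have /andP[t0 t_T] := tT.
have [_ _ _ _ FN] := FF.
have h : F t (~` good) by apply: (F_sub _ t0) => //; apply: FN; exact: ae_good.
rewrite -[good]setCK -(filtration_measurable FF tT); apply: measurableC.
by rewrite (filtration_measurable FF tT).
Qed.

Let adapted_sub (h : R -> Omega -> V) s t : adapted T F h -> 0 <= s <= t -> t <= T ->
  strongly_measurable (F t) setT (h s).
Proof.
move=> ah /andP[s0 st] tT.
apply: (strongly_measurable_sub (F_sub s0 st tT)); apply: ah.
by rewrite s0 (le_trans st).
Qed.

Let z_adapted : adapted T F z.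
Proof.
move=> t tT; have /andP[t0 t_T] := tT.
have := strongly_measurable_sub (F_sub (lexx 0) t0 t_T) u0_measurable.
have := SB_adapted tT.
rewrite -(filtration_measurable FF tT) => mS mu0.
apply: (@smeasD _ _ _ (g_sigma_algebraType (F t)) setT (fun w => S t (u0 w)) (SB t)) => //.
exact: (smeas_comp (semigroup_continuous HS t0)).
Qed.

(** A [regularized_solution] is only given as a continuous process satisfying the equation. The
    Euler scheme on a grid of [[0, t]] uses [z] at times up to t, and thus expresses the solution at
    time t as a limit of [F t]-measurable variables. *)
Let ul_adapted n t : 0 <= t <= T ->
  strongly_measurable (F t) setT (fun w => (\1_good w : R) *: ul (lam n) t w).
Proof.
move=> tT; have /andP[t0 t_T] := tT.
have Fm := filtration_measurable FF tT.
pose N := nemytskii (yosida f (lam n)) : V -> V.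
have NL x x' : `|N x - N x'| <= (lam n)^-1 * `|x - x'|.
  exact: (L1_nemytskii_lipschitz _ _ muT (yosida_lipschitz f_incr (lam_gt0 n))).
have lam0 : 0 <= (lam n)^-1 by rewrite invr_ge0 ltW.
have cN : continuous N by exact: lipschitz_continuous NL.
have mgood : @measurable _ (g_sigma_algebraType (F t)) good by rewrite Fm; exact: F_good.
have mz s : 0 <= s <= t -> strongly_measurable (@measurable _ (g_sigma_algebraType (F t))) setT (z s).
  by move=> st; rewrite Fm; exact: adapted_sub.
rewrite -Fm.
apply: (@smeas_cvg _ _ _ (g_sigma_algebraType (F t)) setT
  (fun m w => (\1_good w : R) *: (z t w - euler S N (z^~ w) (t / m.+1%:R) m.+1))) => //.
  move=> m; apply: smeas_indic => //; apply: smeasB; first by apply: mz; rewrite t0/=.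
  apply: (@euler_smeas _ _ S N _ (g_sigma_algebraType (F t)) z) => //.
    by rewrite divr_ge0.
  move=> j jm; apply: mz; rewrite mulr_ge0 ?divr_ge0//=.
  by rewrite mulrCA ler_piMr// ler_pdivrMr// mul1r ler_nat.
move=> w _; have [gw|ngw] := pselect (good w); last first.
  rewrite indicE memNset// scale0r; under eq_fun do rewrite scale0r.
  exact: cvg_cst.
rewrite indicE mem_set// scale1r; under eq_fun do rewrite scale1r.
have [cu convu _ _] := gw.
apply: (@euler_cvg _ _ _ HS _ _ lam0 NL T (ul (lam n) ^~ w) (z^~ w)) => //.
by move=> s /(convu n)[c cc <-]; rewrite addrAC subrr add0r.
Qed.

Let u_adapted : adapted T F u.
Proof.
move=> t tT; have Fm := filtration_measurable FF tT.
rewrite -Fm; apply: (@smeas_cvg _ _ _ (g_sigma_algebraType (F t)) setT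
  (fun n w => (\1_good w : R) *: ul (lam n) t w)) => //.
  by move=> n; rewrite Fm; exact: ul_adapted.
move=> w _; have [gw|ngw] := pselect (good w); last first.
  rewrite /u indicE memNset// scale0r; under eq_fun do rewrite scale0r.
  exact: cvg_cst.
have [cvg_u _ _ _ _] := path gw.
rewrite indicE mem_set//; under eq_fun do rewrite scale1r.
exact: cvg_u.
Qed.

Let y_adapted : adapted T F y.
Proof.
move=> t tT; have Fm := filtration_measurable FF tT.
rewrite -Fm; apply: (@smeasB _ _ _ (g_sigma_algebraType (F t)) setT (fun w => (\1_good w : R) *: z t w) (u t));
  last by rewrite Fm; exact: u_adapted.
by apply: smeas_indic; rewrite Fm; [exact: F_good|exact: z_adapted].
Qed.

Let y_continuous w : {within `[0, T], continuous (y ^~ w)}.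
Proof.
have [gw|ngw] := pselect (good w); first by have [] := path gw.
have -> : y ^~ w = fun=> 0.
  by apply/funext => t; rewrite /y /u indicE memNset// !scale0r subrr.
by move=> t; exact: cvg_cst.
Qed.

Let g t w := left_derivative S (y^~ w) t.

Let quotient_adapted n : adapted T F (fun t w => left_quotient S (y^~ w) n t).
Proof.
move=> t tT; have Fm := filtration_measurable FF tT; have /andP[t0 t_T] := tT.
have r0 : (0 : R) <= n.+1%:R^-1 by [].
set s := Num.max 0 (t - n.+1%:R^-1).
rewrite -Fm; apply: (@smeasZ _ _ _ (g_sigma_algebraType (F t)) setT
  (fun w => y t w - S n.+1%:R^-1 (y s w)) n.+1%:R).
apply: (@smeasB _ _ _ (g_sigma_algebraType (F t)) setT (y t) (fun w => S n.+1%:R^-1 (y s w))).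
  by rewrite Fm; exact: y_adapted.
apply: (@smeas_comp _ _ _ (g_sigma_algebraType (F t)) _ _ setT (y s) (semigroup_continuous HS r0)).
rewrite Fm; apply: (adapted_sub y_adapted) => //.
by rewrite le_max lexx/= ge_max t0/= lerBlDr lerDl.
Qed.

Let measurable_adapted (h : R -> Omega -> V) : adapted T F h ->
  forall t, 0 <= t <= T -> strongly_measurable (@measurable _ Omega) setT (h t).
Proof.
move=> ah t tT; apply: strongly_measurable_sub (ah t tT).
by case: FF => _ + _ _ _; exact.
Qed.

Lemma mild_exists : exists v, mild_solution P T F S f u0 SB v.
Proof.
exists u; split.
- exact: u_adapted.
- split; first exact: measurable_adapted.
  by apply: filterS ae_good => w gw; have [] := path gw.
exists g; split.
- move=> t tT; have Fm := filtration_measurable FF tT.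
  rewrite -Fm; apply: (@smeas_cauchy_lim _ _ (@L1_complete _ _ _ mu) _ (g_sigma_algebraType (F t))
    setT (fun n w => left_quotient S (y^~ w) n t)) => // n.
  by rewrite Fm; exact: quotient_adapted.
- split.
    (* The left quotients have continuous paths and are measurable at each fixed time, hence jointly
       measurable; so is their limit. *)
    apply: (@smeas_cauchy_lim _ _ (@L1_complete _ _ _ mu) _ (measurableTypeR R * Omega)%type
      (`[0, T] `*` setT) (fun n tw => left_quotient S (y^~ tw.2) n tw.1)).
      exact: measurable_itv_prod.
    move=> n; apply: (smeas_caratheodory (f := fun t w => left_quotient S (y^~ w) n t) T0).
      exact: measurable_adapted.
    by move=> w; apply: left_quotient_continuous => //; exact: y_continuous.
  apply: filterS ae_good => w /path[_ _ cy _ [gh [mgh igh cgh incl]]].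
  by have [] := canonical_solution HS T0 cy mgh igh cgh incl.
- apply: filterS ae_good => w /path[_ _ cy _ [gh [mgh igh cgh incl]]].
  by have [] := canonical_solution HS T0 cy mgh igh cgh incl.
- apply: filterS ae_good => w /path[_ _ cy yE [gh [mgh igh cgh incl]]] t tT.
  have [_ cg _] := canonical_solution HS T0 cy mgh igh cgh incl.
  by exists (y t w); [exact: cg|rewrite yE addrCA subrr addr0].
Qed.

End mild_existence.

(** * Lebesgue measure of bounded sets *)

Section bounded_lebesgue.
Context (R : realType).

Definition tuple_box n (M : R) : set (n.-tuple (measurableTypeR R)) :=
  [set x | forall i, tnth x i \in `[- M, M]].
Arguments tuple_box : clear implicits.

Lemma measurable_tuple_box n M : measurable (tuple_box n M).
Proof.
rewrite (_ : tuple_box n M = \bigcap_(i in [set: 'I_n])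
  ((fun x : n.-tuple (measurableTypeR R) => tnth x i) @^-1` `[- M, M])); last first.
  by apply/seteqP; split => [x xM i _|x xM i]; [exact: xM|exact: (xM i I)].
apply: fin_bigcap_measurable => // i _.
rewrite -[X in measurable X]setTI; exact: measurable_tnth.
Qed.

(** The preimage of a box under [tuple_cons] is an interval times a box of one dimension less. *)
Lemma lebesgue_tuple_box n M : (lebesgue_tuple R n (tuple_box n M) < +oo)%E.
Proof.
elim: n => [|n IH].
  apply: (@le_lt_trans _ _ 1%E); last exact: ltry.
  by rewrite /= diracE; case: (_ \in _).
rewrite /= /image_measure /pushforward.
rewrite (_ : _ @^-1` _ = `[- M, M] `*` tuple_box n M); last first.
  apply/seteqP; split => [[a x]/= ax|[a x]/= [aM xM] i].
    split=> [|i]; first by have := ax ord0; rewrite tnth0.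
    by have := ax (lift ord0 i); rewrite tnthS.
  by have [j ->|->] := unliftP ord0 i; [rewrite tnthS; exact: xM|rewrite tnth0].
rewrite product_measure2E//=; last exact: measurable_tuple_box.
by rewrite lte_mul_pinfty// ?ge0_fin_numE//; exact: (@lebesgue_itv_lty _ _ (- M) M).
Qed.

(** The norm on row vectors is the maximum of the entries, so a bounded set lies in a box. *)
Lemma lebesgue_on_bounded n (G : set 'rV[R]_n) (oG : open G) : bounded_set G ->
  (lebesgue_on oG setT < +oo)%E.
Proof.
move=> bG; have [M GM] : exists M : R, forall x, G x -> `|x| <= M.
  by have [M [_ HM]] := bG; exists (M + 1) => x Gx; apply: (HM _ _ x Gx); rewrite ltrDl.
rewrite /= /mrestr setTI /= /image_measure /pushforward.
have mG : measurable (@tuple_rV R n @^-1` G).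
  rewrite -[X in measurable X]setTI; apply: (@measurable_tuple_rV R n) => //.
  exact: open_measurable_rV.
apply: le_lt_trans (lebesgue_tuple_box n M); apply: le_measure.
- by rewrite inE.
- by rewrite inE; exact: measurable_tuple_box.
move=> x /= /GM xM i; rewrite in_itv/= -ler_norml; apply: le_trans xM.
rewrite [leRHS]/Num.norm /= mx_normrE; apply/bigmax_geP; right => /=.
by exists (ord0, i) => //=; rewrite mxE.
Qed.

End bounded_lebesgue.

Theorem theorem3p17 (R : realType)
  (n : nat) (G : set 'rV[R]_n) (G_open : open G) (G_neq0 : G !=set0)
  (G_connected : connected G) (G_bounded : bounded_set G)
  (T : R) (T_gt0 : 0 < T)
  (d : measure_display) (Omega : measurableType d) (P : probability Omega R)
  (F : R -> set (set Omega))
  (F_filtration : complete_right_continuous_filtration P T F)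
  (H : completeNormedModType R) (ip : H -> H -> R)
  (H_hilbert : hilbert_space ip) (H_separable : separable_space H)
  (W : R -> H -> Omega -> R) (W_wiener : cylindrical_wiener P T F W)
  (A : set (L1 (lebesgue_on G_open) * L1 (lebesgue_on G_open)))
  (S : R -> L1 (lebesgue_on G_open) -> L1 (lebesgue_on G_open))
  (A_accretive : consistent_accretive_operator A S)
  (E : completeNormedModType R) (SE : R -> E -> L1 (lebesgue_on G_open))
  (SE_action : semigroup_action S SE)
  (B : R -> Omega -> H -> E) (B_process : adapted_operator_process T F B)
  (f : R -> R) (f_incr : {homo f : x y / x <= y})
  (deg C : R) (deg_ge0 : 0 <= deg)
  (f_growth : forall x, `|f x| <= C * (1 + `|x| `^ deg))
  (SB : R -> Omega -> L1 (lebesgue_on G_open))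
  (SB_convolution : stochastic_convolution P T F ip W SE B SB)
  (SB_adapted : adapted T F SB)
  (S_submarkovian : submarkovian S)
  (f00 : monotone_extension f 0 0)
  (u0 : Omega -> L1 (lebesgue_on G_open))
  (u0_measurable : strongly_measurable (F 0) setT u0)
  (SB_continuous : continuous_process P T SB)
  (ul : R -> R -> Omega -> L1 (lebesgue_on G_open))
  (ul_solution : forall lam, 0 < lam ->
    regularized_solution P T S f lam u0 SB (ul lam))
  (ul_bounds : {ae P, forall w,
    exists v : R -> measurableTypeR R * borel_rV R n -> R,
      [/\ forall lam, 0 < lam -> represents T (v lam) (fun t => ul lam t w),
          equiintegrable (@lebesgue_measure R \x^ lebesgue_on G_open)%E
            (`[0, T] `*` setT) [set lam | 0 < lam]
            (fun lam tx => yosida f lam (v lam tx))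
        & bounded_in_L1 (@lebesgue_measure R \x^ lebesgue_on G_open)%E
            (`[0, T] `*` setT) [set lam | 0 < lam]
            (fun lam tx => yosida f lam (v lam tx) * v lam tx)]}) :
  (exists u, mild_solution P T F S f u0 SB u) /\
  (forall u u', mild_solution P T F S f u0 SB u ->
     mild_solution P T F S f u0 SB u' -> indistinguishable P T u u').
Proof.
have muT := lebesgue_on_bounded G_open G_bounded.
have [_ HS _ _] := A_accretive.
split; last by move=> u u'; exact: (mild_unique muT HS S_submarkovian f_incr).
apply: (mild_exists muT HS S_submarkovian T_gt0 F_filtration f_incr u0_measurable
  SB_adapted SB_continuous ul_solution).
by apply: filterS ul_bounds => w [v [rv ev _]]; exists v.
Qed.
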